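(* Let $k\ge1$. (i) For every $\delta>0$ and every $C^k$ Cantor set $\mathscr{C}\subset[0,1]$ with box counting dimension $D$, $$\Delta(\mathscr{C},\varepsilon)\preccurlyeq\varepsilon^{-\frac{D}{k}-\delta}.$$ (ii) For every $D\in(0,1)$ and every $\delta>0$ there exist $C^k$ central Cantor sets $\mathscr{C}\subset[0,1]$ with box counting dimension at most $D+\delta$ such that $$\varepsilon^{-\frac{D}{k}+\delta}\preccurlyeq\Delta(\mathscr{C},\varepsilon).$$ Here $f\preccurlyeq g$ means that there is a constant $C>0$ (possibly depending on $\mathscr{C}$, $k$, $\delta$) such that $f(\varepsilon)\le C g(\varepsilon)$ for all sufficiently small $\varepsilon>0$.
   Context: Complexity. Fix a universal Turing machine $U$. A program is a finite binary word $\mathtt P\in\{0,1\}^*$ run on $U$, with length $\ell(\mathtt P)$; when it halts, its output is read (in a fixed standard encoding, e.g. as a finite list of points with rational coordinates) as a finite set $\mathtt C(\mathtt P)\subset\mathbb R$. For a compact set $\mathscr{C}\subset\mathbb R$ and $\varepsilon>0$, the $\varepsilon$-distortion complexity is $$\Delta(\mathscr{C},\varepsilon)=\min\{\ell(\mathtt P) : d_{\mathrm H}(\mathtt C(\mathtt P),\mathscr{C})<\varepsilon\},$$ where the minimum is over programs producing a finite set and $d_{\mathrm H}$ is the Hausdorff distance, $d_{\mathrm H}(F_1,F_2)=\max\{\sup_{x\in F_2}d(x,F_1),\sup_{x\in F_1}d(x,F_2)\}$. Iterated function systems. Let $A=[0,1]$ and let $\mathcal I$ be a finite index set with at least two elements.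 An iterated function system (IFS) is a collection $\{\phi_i:A\to A : i\in\mathcal I\}$ of injective contractions with a uniform contraction rate $\rho\in(0,1)$ (i.e. $|\phi_i(x)-\phi_i(y)|\le\rho|x-y|$ for all $i$) such that $\phi_i(A)\cap\phi_j(A)=\emptyset$ for $i\ne j$. The Cantor set generated by the IFS is the unique nonempty compact set $\mathscr{C}\subset A$ with $\mathscr{C}=\bigcup_{i\in\mathcal I}\phi_i(\mathscr{C})$. A $C^k$ Cantor set is a Cantor set generated by an IFS whose maps are all of class $C^k$ on $[0,1]$; for non-integer $k$ this means $\lfloor k\rfloor$ times differentiable with $\lfloor k\rfloor$-th derivative Hölder continuous of exponent $k-\lfloor k\rfloor$. Central. For $\mathcal I=\{0,1\}$ and a finite word $\omega_1^n=\omega_1\cdots\omega_n\in\mathcal I^n$ put $J_{\omega_1^n}=\phi_{\omega_n}\circ\cdots\circ\phi_{\omega_1}([0,1])$ (with $J=[0,1]$ for the empty word), so that $J_{0\omega_1^n},J_{1\omega_1^n}\subset J_{\omega_1^n}$. The Cantor set generated by $\{\phi_0,\phi_1\}$ is central if, for every finite word, $J_{0\omega_1^n}$ and $J_{1\omega_1^n}$ have equal length and are situated at the two ends of $J_{\omega_1^n}$, i.e. they are what remains after deleting a concentric open interval from $J_{\omega_1^n}$. *)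

(* Defs.v *)
From HB Require Import structures.
From mathcomp Require Import all_boot all_order all_algebra.
From mathcomp Require Import all_classical all_reals all_analysis.

Set Implicit Arguments.
Unset Strict Implicit.
Unset Printing Implicit Defensive.

Import Order.TTheory GRing.Theory Num.Theory.
Import numFieldNormedType.Exports.

Local Open Scope classical_set_scope.
Local Open Scope ring_scope.

(* A cell is blank ([None]), holds a bit, or holds a symbol of the finite
   auxiliary alphabet [G]. *)
Definition cell (G : finType) : Type := option (bool + G).

(* Moving the head by -1, 0 or +1: [None] is 0, [Some true] is +1. *)
Definition move : Type := option bool.

Definition displacement (m : move) : int :=
  match m with None => 0 | Some true => 1 | Some false => -1 end.

(* Deterministic machines with [ntapes.+1] two-way infinite tapes.  The
   transition table answers [None] in order to halt. *)
Record machine := Machine {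
  ntapes : nat;
  state : finType;
  aux : finType;
  start : state;
  table : state -> {ffun 'I_ntapes.+1 -> cell aux} ->
          option (state * {ffun 'I_ntapes.+1 -> cell aux * move})
}.

Record config (M : machine) := Config {
  cur : state M;
  headpos : 'I_(ntapes M).+1 -> int;
  tape : 'I_(ntapes M).+1 -> int -> cell (aux M)
}.

Definition step (M : machine) (c : config M) : option (config M) :=
  if table (cur c) [ffun i => tape c i (headpos c i)] is Some (q, a) then
    Some (Config q (fun i => headpos c i + displacement (a i).2)
            (fun i z => if z == headpos c i then (a i).1 else tape c i z))
  else None.

(* The input word occupies the cells 0, 1, 2, ... of the first tape. *)
Definition initial (M : machine) (x : seq bool) : config M :=
  Config (start M) (fun=> 0)
    (fun i z => if (i == ord0) && (0 <= z)
                then omap inl (onth x `|z|%N) else None).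

(* The word on a tape extends from cell 0 to the first cell that is not a bit. *)
Definition reads (G : finType) (t : int -> cell G) (y : seq bool) : Prop :=
  (forall j, (j < size y)%N -> t j%:Z = Some (inl (nth false y j))) /\
  (forall b, t (size y)%:Z <> Some (inl b)).

(* The output word is read off the last tape once the machine has halted. *)
Definition computes (M : machine) (x y : seq bool) : Prop :=
  exists (t : nat) (c : config M),
    [/\ iter t (obind (@step M)) (Some (initial M x)) = Some c,
        step c = None & reads (tape c ord_max) y].

(* [U] simulates every machine [M] by means of a prefix describing [M]. *)
Definition universal (U : machine) : Prop :=
  forall M : machine, exists p : seq bool,
    forall x y, computes M x y <-> computes U (p ++ x) y.

(* Big-endian binary numerals; leading zeros are allowed. *)
Definition binval (s : seq bool) : nat := foldl (fun n (b : bool) => n.*2 + b)%N 0%N s.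

(* A fraction is given by its sign and by the numerals of its numerator and of
   its denominator; it need not be in lowest terms. *)
Record fraction := Fraction {
  negative : bool;
  numerator : seq bool;
  denominator : seq bool
}.

Definition fracval (q : fraction) : rat :=
  (-1) ^+ negative q * (binval (numerator q))%:R / (binval (denominator q))%:R.

(* Self-delimiting: every bit is announced by 1, and 0 marks the end. *)
Definition encode_word (s : seq bool) : seq bool :=
  flatten [seq [:: true; b] | b <- s] ++ [:: false].

Definition encode_fraction (q : fraction) : seq bool :=
  negative q :: encode_word (numerator q) ++ encode_word (denominator q).

Definition encode_list (l : seq fraction) : seq bool :=
  flatten [seq true :: encode_fraction q | q <- l] ++ [:: false].

Definition produces (R : realType) (U : machine) (P : seq bool) (F : set R) : Prop :=
  exists l : seq fraction,
    [/\ computes U P (encode_list l),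
        all (fun q => 0 < binval (denominator q))%N l
      & F = [set x : R | x \in [seq ratr (fracval q) | q <- l]]].

(* Extended-real valued, so that the empty set is at infinite distance from
   any nonempty set: [edist_inf F x] is +oo when [F] is empty. *)
Definition hausdorff_dist (R : realType) (F1 F2 : set R) : \bar R :=
  maxe (ereal_sup [set edist_inf F1 x | x in F2])
       (ereal_sup [set edist_inf F2 x | x in F1]).

(* Lengths are natural numbers, so the infimum is a minimum as soon as some
   program qualifies; it is +oo otherwise. *)
Definition distortion_complexity (R : realType) (U : machine) (C : set R)
    (e : R) : \bar R :=
  ereal_inf [set ((size P)%:R)%:E | P in
    [set P : seq bool | exists2 F : set R, produces U P F &
                          (hausdorff_dist F C < e%:E)%E]].

Definition preceq (R : realType) (f g : R -> \bar R) : Prop :=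
  exists2 c : R, 0 < c & \forall e \near 0^'+, (f e <= c%:E * g e)%E.

(* The least number of intervals of length [e] covering [C]. *)
Definition box_count (R : realType) (C : set R) (e : R) : R :=
  inf [set n%:R | n in [set n : nat | exists a : 'I_n -> R,
                          C `<=` \bigcup_(i in setT) `[a i, a i + e]%classic]].

Definition box_dim (R : realType) (C : set R) (D : R) : Prop :=
  ln (box_count C e) / - ln e @[e --> 0^'+] --> D.

(* [g] is the derivative of [f] on [0, 1], one-sided at the end points. *)
Definition deriv01 (R : realType) (f g : R -> R) : Prop :=
  forall x, x \in `[0, 1] ->
    (f y - f x) / (y - x) @[y --> within `[0, 1]%classic x^'] --> g x.

Definition holder01 (R : realType) (a : R) (f : R -> R) : Prop :=
  exists H : R, {in `[0, 1] &, forall x y, `|f x - f y| <= H * `|x - y| `^ a}.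

Definition class_C (R : realType) (k : R) (f : R -> R) : Prop :=
  let m := Num.truncn k in
  exists g : nat -> R -> R,
    [/\ {in `[0, 1], g 0%N =1 f},
        forall j, (j < m)%N -> deriv01 (g j) (g j.+1)
      & if k == m%:R then {within `[0, 1], continuous (g m)}
        else holder01 (k - m%:R) (g m)].

(* The values of [phi i] outside [0, 1] are irrelevant. *)
Definition ifs (R : realType) (I : finType) (phi : I -> R -> R) : Prop :=
  [/\ (1 < #|I|)%N,
      forall i, phi i @` `[0, 1]%classic `<=` `[0, 1]%classic,
      forall i, {in `[0, 1] &, injective (phi i)},
      exists rho : R, [/\ 0 < rho, rho < 1 &
        forall i, {in `[0, 1] &, forall x y,
          `|phi i x - phi i y| <= rho * `|x - y|}]
    & forall i j, i != j ->
        (phi i @` `[0, 1]%classic) `&` (phi j @` `[0, 1]%classic) = set0].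

Definition generates (R : realType) (I : finType) (phi : I -> R -> R)
    (C : set R) : Prop :=
  [/\ C !=set0, compact C, C `<=` `[0, 1]%classic
    & C = \bigcup_(i in setT) phi i @` C].

Definition Ck_cantor (R : realType) (k : R) (C : set R) : Prop :=
  exists (I : finType) (phi : I -> R -> R),
    [/\ ifs phi, forall i, class_C k (phi i) & generates phi C].

(* The letters of a word are applied from left to right; the index set {0, 1}
   is [bool], with [false] for 0 and [true] for 1. *)
Definition Jint (R : realType) (phi : bool -> R -> R) (w : seq bool) : set R :=
  foldl (fun A i => phi i @` A) `[0, 1]%classic w.

(* The two subintervals may come in either order, as the maps may be
   decreasing. *)
Definition central (R : realType) (phi : bool -> R -> R) : Prop :=
  forall w : seq bool, exists a b l : R,
    [/\ 0 < l, 2 * l < b - a, Jint phi w = `[a, b]%classic &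
      (Jint phi (false :: w) = `[a, a + l]%classic /\
       Jint phi (true :: w) = `[b - l, b]%classic) \/
      (Jint phi (true :: w) = `[a, a + l]%classic /\
       Jint phi (false :: w) = `[b - l, b]%classic)].

Definition Ck_central_cantor (R : realType) (k : R) (C : set R) : Prop :=
  exists phi : bool -> R -> R,
    [/\ ifs phi, forall i, class_C k (phi i), generates phi C & central phi].

(* Main.v *)
(** Upper bound.  Choose scales [2^-b] and [2^-w] with [b <= k w].  By Taylor's
    formula, the degree [m = truncn k] Taylor polynomials of the maps at the
    points of the grid [2^-w] near the Cantor set determine the maps near the set
    up to [O(2^-(k w))], hence up to [O(2^-b)].  There are about [2^(w D)] such
    points, and each contributes [O(b)] bits, namely its number and [m + 1] rounded
    coefficients.  A fixed machine iterates the rounded maps from a starting point;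
    contraction absorbs the errors, so the orbits are dense in the Cantor set up to
    [O(2^-b)], and the program has about [eps^(-D/k)] bits.  Universality only
    speaks of machines, so the decoder is written as a program over counters and
    compiled to a machine.

    Lower bound.  With [lam^D = 1/2], perturb the affine branch [x |-> lam x] so
    that each of prescribed pairwise incomparable intervals [J_v] may or may not
    have its children lengthened by [c mu^|v|].  Since the intervals of depth [n]
    have length about [lam^n] and [mu = lam^k'] with [k' > k], the result is still of
    class C^k; it is central, and its dimension is still [D].  At depth about
    [(K + 1) p] there are [2^(K p)] free bits, all of which can be read off an
    approximation at scale [mu^((K + 1) p)].  A counting argument then gives a choice
    of bits that defeats every program shorter than [2^(K p)], and the levels [p] can
    be chosen one after the other because deeper bits do not matter.  Large [K] and
    [k'] close to [k] give every exponent below [D/k]. *)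
Require Import Defs.
From mathcomp Require Import all_boot all_order all_algebra.
From mathcomp Require Import all_classical all_reals all_analysis.
From mathcomp Require Import zify ring lra.

Set Implicit Arguments.
Unset Strict Implicit.
Unset Printing Implicit Defensive.

Import Order.TTheory GRing.Theory Num.Theory.
Import numFieldNormedType.Exports.

Local Open Scope classical_set_scope.
Local Open Scope ring_scope.


(** * Programs over counters and their compilation to machines *)

(** Program length ignores running time, so the decoder may print all [nI ^ (L * b)] orbit points:
    only the stored data is charged. Data is needed only for cells that rounded orbits visit, and
    these lie near the Cantor set because rounded orbits shadow true ones; this is how the box
    dimension enters.

    The obstacle in the lower bound is a circularity: the bumps sit in gaps of a Cantor set that
    they themselves deform. It is broken by the fact that the interval of address [a :: w] is the
    image of the interval of address [w], so lengths and positions solve a recursion on words before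
    any map exists. The smooth branch is then built to interpolate the prescribed displacements of
    end points.

    Incomparable active words give disjoint intervals, so bumps do not interact and regularity is
    that of a single bump, however many there are. Lengthening both children equally keeps the set
    central. Writing [k' = m + alpha] with [alpha > 0] and [m] the integer part of [k] treats
    integer and fractional [k] alike. *)

Inductive instr :=
| IInc of nat
| IDec of nat & nat
| IJmp of nat
| IOut of bool
| IRead of nat.

(* Program counter, counters, number of input bits read, output. *)
Definition fconf : Type := (nat * (nat -> nat) * nat * seq bool)%type.

Definition setr (s : nat -> nat) (r v : nat) : nat -> nat :=
  fun q => if q == r then v else s q.

(* [IRead t] adds the next input bit to counter 1, and jumps to [t] at the end
   of the input; [IDec r t] jumps to [t] when counter [r] is zero. *)
Definition fstep (code : seq instr) (x : seq bool) (f : fconf) : option fconf :=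
  let: (pc, s, n, o) := f in
  match onth code pc with
  | None => None
  | Some (IInc r) => Some (pc.+1, setr s r (s r).+1, n, o)
  | Some (IDec r t) =>
      if s r == 0%N then Some (t, s, n, o) else Some (pc.+1, setr s r (s r).-1, n, o)
  | Some (IJmp t) => Some (t, s, n, o)
  | Some (IOut b) => Some (pc.+1, s, n, rcons o b)
  | Some (IRead t) =>
      if onth x n is Some b then Some (pc.+1, setr s 1 (s 1 + b)%N, n.+1, o)
      else Some (t, s, n, o)
  end.

Definition reach (T : Type) (f : T -> option T) (a b : T) : Prop :=
  exists t, iter t (obind f) (Some a) = Some b.

Lemma reach_refl T (f : T -> option T) a : reach f a a.
Proof. by exists 0%N. Qed.

Lemma reach_step T (f : T -> option T) a b c :
  f a = Some b -> reach f b c -> reach f a c.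
Proof. by move=> fab [t tbc]; exists t.+1; rewrite iterSr /= fab. Qed.

Lemma reach_trans T (f : T -> option T) a b c :
  reach f a b -> reach f b c -> reach f a c.
Proof. by move=> [t tab] [u ubc]; exists (u + t)%N; rewrite iterD tab. Qed.

Section TuringMachine.
Variables (nr : nat) (code : seq instr).

Definition bounded_instr (i : instr) : bool :=
  match i with
  | IInc r => r < nr
  | IDec r t => (r < nr) && (t <= size code)
  | IJmp t => t <= size code
  | IOut _ => true
  | IRead t => (1 < nr) && (t <= size code)
  end%N.

Let tapeI := 'I_(nr.+1).+1.
Let q0 (n : nat) : option 'I_(size code).+1 := Some (inord n).

Let write_back (cs : {ffun tapeI -> cell unit}) (mv : tapeI -> move) :
  {ffun tapeI -> cell unit * move} := [ffun i => (cs i, mv i)].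

(** Tape 0 carries the input and the last tape the output. The extra state [None] makes one
    preliminary step that marks cell 0 of every counter tape; [IDec] tests for zero by looking for
    that mark. The address [size code] holds no instruction, so reaching it halts the machine. *)
Definition counter_table (q : option 'I_(size code).+1)
    (cs : {ffun tapeI -> cell unit}) :
    option (option 'I_(size code).+1 * {ffun tapeI -> cell unit * move}) :=
  match q with
  | None => Some (q0 0, [ffun i : tapeI =>
      (if (i == ord0) || (i == ord_max) then cs i else Some (inr tt), None)])
  | Some pc =>
    match onth code pc with
    | None => None
    | Some (IInc r) => Some (q0 pc.+1,
        write_back cs (fun i => if val i == r.+1 then Some true else None))
    | Some (IDec r t) =>
        if cs (inord r.+1) == Some (inr tt) then Some (q0 t, write_back cs (fun=> None))
        else Some (q0 pc.+1,
          write_back cs (fun i => if val i == r.+1 then Some false else None))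
    | Some (IJmp t) => Some (q0 t, write_back cs (fun=> None))
    | Some (IOut b) => Some (q0 pc.+1,
        [ffun i : tapeI => if i == ord_max then (Some (inl b), Some true) else (cs i, None)])
    | Some (IRead t) =>
        if cs ord0 is Some (inl b) then Some (q0 pc.+1,
          write_back cs (fun i => if (i == ord0) || b && (val i == 2)
                                  then Some true else None))
        else Some (q0 t, write_back cs (fun=> None))
    end
  end.

(* Counter [r] is the head position on tape [r.+1], whose cell 0 is marked. *)
Definition counter_machine : machine :=
  @Machine nr.+1 (option 'I_(size code).+1) unit None counter_table.

Definition repr (x : seq bool) (f : fconf) : config counter_machine :=
  let: (pc, s, n, o) := f in
  @Config counter_machine (q0 pc)
    (fun i : tapeI => if i == ord0 then n%:Z
              else if i == ord_max then (size o)%:Z else (s i.-1)%:Z)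
    (fun (i : tapeI) z => if i == ord0 then (if 0 <= z then omap inl (onth x `|z|%N) else None)
                else if i == ord_max then (if 0 <= z then omap inl (onth o `|z|%N) else None)
                else if z == 0 then Some (inr tt) else None).

Lemma step_initial x :
  step (initial counter_machine x) = Some (repr x (0%N, fun=> 0%N, 0%N, [::])).
Proof.
rewrite /step /initial /repr /=; congr (Some _); congr Config.
  by apply/funext => i; rewrite ffunE /=; case: ifP => // _; case: ifP.
apply/funext => i; apply/funext => z; rewrite !ffunE /=.
have [->|i0] := eqVneq i ord0.
  by case: eqP => [->|].
have [_|im] /= := eqVneq i ord_max; last by case: eqP.
by rewrite onth0n; case: ifP; case: ifP.
Qed.

Lemma repr_step x f g : all bounded_instr code -> (f.1.1.1 <= size code)%N ->
  fstep code x f = Some g ->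
  step (repr x f) = Some (repr x g) /\ (g.1.1.1 <= size code)%N.
Proof.
case: f => [[[pc s] n] o] /= wf pcle.
have pcK : \val (inord pc : 'I_(size code).+1) = pc by rewrite /= inordK.
case Ei : (onth code pc) => [i|//].
have pclt : (pc < size code)%N by rewrite -onthTE Ei.
have wfi : bounded_instr i by by have /(all_nthP (IJmp 0))/(_ pc pclt) := wf; rewrite (onth_nth _ _ _ _ Ei).
have nmax (r : nat) : (r < nr)%N -> (inord r.+1 == ord_max :> tapeI) = false.
  by move=> rn; apply/negbTE/eqP => /(congr1 val); rewrite /= inordK; lia.
have nmin (r : nat) : (r < nr)%N -> (inord r.+1 == ord0 :> tapeI) = false.
  by move=> rn; apply/negbTE/eqP => /(congr1 val); rewrite /= inordK; lia.
have Em (i0 : tapeI) r : (r < nr)%N -> (val i0 == r.+1) -> i0 != ord_max.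
  by move=> rn /eqP e; apply/eqP => /(congr1 val); rewrite e /=; lia.
have Es (i0 : tapeI) r : i0 != ord0 -> val i0 == r.+1 = (i0.-1 == r).
  by case: i0 => [[|m] h] //= /eqP; case; apply: val_inj.
have ext a b hp tp hp' tp' :
    a = b -> hp = hp' -> tp = tp' ->
    Some (@Config counter_machine a hp tp) = Some (@Config counter_machine b hp' tp').
  by move=> -> -> ->.
rewrite /step /= pcK Ei.
case: i Ei wfi => [r|r t|t|b|t] Ei /= wfi.
- move=> [<-]; split; last by [].
  apply: ext => //.
    apply/funext => i; rewrite !ffunE /=.
    have [e|i0] := eqVneq i ord0; first by rewrite ?e /= addr0.
    have [im|im] := eqVneq i ord_max.
      by case: ifP => [/(Em _ _ wfi)|]; rewrite ?im ?eqxx //= addr0.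
    rewrite (Es _ _ i0) /setr; case: ifP => [/eqP ->|]; rewrite /= ?addr0 //; lia.
  by apply/funext => i; apply/funext => z; rewrite !ffunE /=; case: eqP => [->|].
- case/andP: wfi => rn tn.
  rewrite ffunE nmin // nmax // inordK ?ltnS; last lia.
  rewrite /=; have -> : (Posz (s r) == 0) = (s r == 0%N) by [].
  case: eqP => [sr0|sr0] /=; move=> [<-]; split => //; apply: ext => //.
  + apply/funext => i; rewrite !ffunE /= addr0; by [].
  + by apply/funext => i; apply/funext => z; rewrite !ffunE /=; case: eqP => [->|].
  + apply/funext => i; rewrite !ffunE /=.
    have [e|i0] := eqVneq i ord0; first by rewrite ?e /= addr0.
    have [im|im] := eqVneq i ord_max.
      by case: ifP => [/(Em _ _ rn)|]; rewrite ?im ?eqxx //= addr0.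
    rewrite (Es _ _ i0) /setr; case: ifP => [/eqP ->|]; rewrite /= ?addr0 //; lia.
  + by apply/funext => i; apply/funext => z; rewrite !ffunE /=; case: eqP => [->|].
- move=> [<-]; split => //; apply: ext => //.
    by apply/funext => i; rewrite !ffunE /= addr0.
  by apply/funext => i; apply/funext => z; rewrite !ffunE /=; case: eqP => [->|].
- move=> [<-]; split => //; apply: ext => //.
    apply/funext => i; rewrite !ffunE /=.
    have [e|im] := eqVneq i ord_max; last by rewrite addr0.
    by rewrite ?e /= size_rcons; lia.
  apply/funext => i; apply/funext => z; rewrite !ffunE /=.
  have [e|im] := eqVneq i ord_max; last by case: eqP => [->|].
  rewrite ?e /=; case: eqP => [->|zs]; first by rewrite /= -cats1 onth_cat ltnn subnn.
  case: ifP => // z0; case: z zs z0 => // zs zs0 _ /=.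
  have zso : zs <> size o by move=> zsE; apply: zs0; rewrite zsE.
  rewrite -cats1 onth_cat; case: ltnP => // sz.
  by rewrite !onth_default //=; lia.
- case/andP: wfi => nr1 tn; rewrite ffunE /=.
  case Ex : (onth x n) => [b|] /=; move=> [<-]; split => //; apply: ext => //.
  + apply/funext => i; rewrite !ffunE /=.
    have [e|i0] := eqVneq i ord0; first by rewrite ?e /=; lia.
    have [im|im] := eqVneq i ord_max.
      rewrite im /=; case: ifP => [/andP[_ /eqP]|]; rewrite /= ?addr0 //; lia.
    rewrite /setr -(Es _ 1%N i0) /=.
    by case: b {Ex} => /=; case: eqP => [->|_] /=; rewrite ?addr0 ?addn0 //; lia.
  + by apply/funext => i; apply/funext => z; rewrite !ffunE /=; case: eqP => [->|].
  + by apply/funext => i; rewrite !ffunE /= addr0.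
  + by apply/funext => i; apply/funext => z; rewrite !ffunE /=; case: eqP => [->|].
Qed.

Lemma repr_reach x f g : all bounded_instr code -> (f.1.1.1 <= size code)%N ->
  reach (fstep code x) f g -> reach (@step counter_machine) (repr x f) (repr x g).
Proof.
move=> wf fle [t]; elim: t f fle => [|t IH] f fle; first by move=> [->]; exact: reach_refl.
rewrite iterSr /=; case Ef : (fstep code x f) => [h|]; last first.
  by rewrite (_ : iter t _ _ = None) //; elim: t {IH} => //= t ->.
have [sf hle] := repr_step wf fle Ef.
by move=> /(IH _ hle); apply: reach_step.
Qed.

Lemma counter_machine_computes x s n o : all bounded_instr code ->
  reach (fstep code x) (0%N, fun=> 0%N, 0%N, [::]) (size code, s, n, o) ->
  computes counter_machine x o.
Proof.
move=> wf fx.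
have [t tc] := reach_step (step_initial x)
  (@repr_reach x (0%N, fun=> 0%N, 0%N, [::]) _ wf isT fx).
exists t, (repr x (size code, s, n, o)); split => //.
  by rewrite /step /= inordK // onth_default.
split=> [j js|b] /=; rewrite eqxx /=; last by rewrite onth_default.
by rewrite onthE (nth_map false).
Qed.

End TuringMachine.


(** * Structured commands and their translation into jumps *)

Inductive cmd :=
| Skip
| Inc of nat
| Out of bool
| Seq of cmd & cmd
| Loop of nat & cmd.

Definition cstate : Type := ((nat -> nat) * seq bool)%type.

Fixpoint run (c : cmd) (p : cstate) : cstate :=
  match c with
  | Skip => p
  | Inc r => (setr p.1 r (p.1 r).+1, p.2)
  | Out b => (p.1, rcons p.2 b)
  | Seq c1 c2 => run c2 (run c1 p)
  | Loop r c => iter (p.1 r) (fun q => run c (setr q.1 r (q.1 r).-1, q.2)) p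
  end.

Fixpoint writes (c : cmd) (r : nat) : bool :=
  match c with
  | Skip | Out _ => false
  | Inc q => r == q
  | Seq c1 c2 => writes c1 r || writes c2 r
  | Loop q c => (r == q) || writes c r
  end.

(* Under this condition [Loop r c] is a while loop on the counter [r]. *)
Fixpoint well_formed (c : cmd) : bool :=
  match c with
  | Seq c1 c2 => well_formed c1 && well_formed c2
  | Loop r c => well_formed c && ~~ writes c r
  | _ => true
  end.

Fixpoint width (c : cmd) : nat :=
  match c with
  | Inc r => r.+1
  | Seq c1 c2 => maxn (width c1) (width c2)
  | Loop r c => maxn r.+1 (width c)
  | _ => 0
  end%N.

Fixpoint csize (c : cmd) : nat :=
  match c with
  | Skip => 0
  | Inc _ | Out _ => 1
  | Seq c1 c2 => csize c1 + csize c2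
  | Loop _ c => (csize c).+2
  end%N.

Fixpoint compile (b : nat) (c : cmd) : seq instr :=
  match c with
  | Skip => [::]
  | Inc r => [:: IInc r]
  | Out o => [:: IOut o]
  | Seq c1 c2 => compile b c1 ++ compile (b + csize c1) c2
  | Loop r c => IDec r (b + csize c).+2 :: rcons (compile b.+1 c) (IJmp b)
  end%N.

Lemma size_compile b c : size (compile b c) = csize c.
Proof.
elim: c b => //= [c1 IH1 c2 IH2|r c IH] b; first by rewrite size_cat IH1 IH2.
by rewrite size_rcons IH.
Qed.

Lemma compile_bounded b c code nr : (width c <= nr)%N -> (b + csize c <= size code)%N ->
  all (bounded_instr nr code) (compile b c).
Proof.
elim: c b => //= [r|c1 IH1 c2 IH2|r c IH] b; first by rewrite andbT.
- by rewrite geq_max all_cat => /andP[w1 w2] le; rewrite IH1 ?IH2 //; lia.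
- by rewrite geq_max all_rcons /= => /andP[w1 w2] le; rewrite IH //; lia.
Qed.

Lemma run_unwritten c r p : ~~ writes c r -> (run c p).1 r = p.1 r.
Proof.
elim: c p => //= [q|c1 IH1 c2 IH2|q c IH] p.
- by move=> /negbTE rq; rewrite /setr rq.
- by rewrite negb_or => /andP[w1 w2]; rewrite IH2 // IH1.
- rewrite negb_or => /andP[/negbTE rq w]; elim: (p.1 q) => //= n {}IHn.
  by rewrite IH //= /setr rq.
Qed.

Lemma onth_mid T (pre post : seq T) i : onth (pre ++ i :: post) (size pre) = Some i.
Proof. by rewrite onth_cat ltnn subnn. Qed.

(** [run] fixes the number of passes of a loop at its entry, whereas the compiled code tests the
    counter before each pass. The two agree because a well-formed body leaves the loop counter
    alone, which is what the inner induction on the counter value uses. *)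
Lemma compile_run c : well_formed c -> forall code pre post,
  code = pre ++ compile (size pre) c ++ post -> forall x s n o,
  reach (fstep code x) (size pre, s, n, o)
    ((size pre + csize c)%N, (run c (s, o)).1, n, (run c (s, o)).2).
Proof.
elim: c => [|r|b|c1 IH1 c2 IH2|r c IH] /=.
- by move=> _ code pre post _ x s n o; rewrite addn0; exact: reach_refl.
- move=> _ code pre post -> x s n o; apply: (@reach_step _ _ _ (_, _, _, _)).
    by rewrite /fstep onth_mid.
  by rewrite addn1; exact: reach_refl.
- move=> _ code pre post -> x s n o; apply: (@reach_step _ _ _ (_, _, _, _)).
    by rewrite /fstep onth_mid.
  by rewrite addn1; exact: reach_refl.
- move=> /andP[wf1 wf2] code pre post codeE x s n o.
  apply: (reach_trans (IH1 wf1 code pre (compile (size pre + csize c1) c2 ++ post) _ x s n o)).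
    by rewrite codeE -catA.
  case: (run c1 (s, o)) => s1 o1 /=.
  have := IH2 wf2 code (pre ++ compile (size pre) c1) post _ x s1 n o1.
  rewrite size_cat size_compile addnA; apply.
  by rewrite codeE -!catA.
- move=> /andP[wfc wr] code pre post codeE x.
  have {}IH := IH wfc code (rcons pre (IDec r (size pre + csize c).+2)) (IJmp (size pre) :: post).
  have pre_at : onth code (size pre) = Some (IDec r (size pre + csize c).+2).
    by rewrite codeE onth_mid.
  have jmp_at : onth code (size pre + csize c).+1 = Some (IJmp (size pre)).
    have -> : code = (pre ++ IDec r (size pre + csize c).+2 :: compile (size pre).+1 c)
        ++ IJmp (size pre) :: post by rewrite codeE cat_rcons -catA.
    rewrite -(onth_mid (pre ++ IDec r (size pre + csize c).+2 :: compile (size pre).+1 c)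
      post (IJmp (size pre))).
    by rewrite size_cat /= size_compile addnS.
  have {}IH : forall s n o, reach (fstep code x) ((size pre).+1, s, n, o)
       ((size pre + csize c).+1, (run c (s, o)).1, n, (run c (s, o)).2).
    move=> s n o; rewrite -addSn -[(size pre).+1](size_rcons pre (IDec r (size pre + csize c).+2)).
    by apply: IH; rewrite codeE size_rcons cat_rcons -cats1 -catA.
  move=> s n o; move E : (s r) => m.
  rewrite !addnS.
  elim: m s o E => [|m IHm] s o E.
    apply: (@reach_step _ _ _ (_, _, _, _)); last exact: reach_refl.
    by rewrite /fstep pre_at E.
  apply: (@reach_step _ _ _ (_, _, _, _)); first by rewrite /fstep pre_at E /=.
  apply: reach_trans (IH _ _ _) _.
  apply: (@reach_step _ _ _ (_, _, _, _)); first by rewrite /fstep jmp_at.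
  rewrite iterSr /= E /=.
  have := IHm _ (run c (setr s r m, o)).2 _; case Er: (run _ _) => [s1 o1] /=; apply.
  by have := @run_unwritten c r (setr s r m, o) wr; rewrite Er /= /setr eqxx.
Qed.

(* [binval] folds the bits by [n.*2 + b]; counter 0 holds [n], counter 1 the bit
   just read. *)
Definition absorb_bit : cmd :=
  Seq (Loop 0 (Seq (Inc 2) (Inc 2))) (Seq (Loop 2 (Inc 0)) (Loop 1 (Inc 0))).

Definition in0 (v : nat) : nat -> nat := fun r => if r == 0%N then v else 0%N.

Lemma run_absorb_bit v (b : bool) o :
  run absorb_bit (setr (in0 v) 1 b, o) = (in0 (v.*2 + b), o).
Proof.
have tr (s s' : nat -> nat) : s =1 s' -> (s, o) = (s', o) by move=> /funext ->.
rewrite /absorb_bit.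
have L1 s m : iter m (fun q => run (Seq (Inc 2) (Inc 2)) (setr q.1 0 (q.1 0).-1, q.2)) (s, o)
    = (fun r => if r == 0%N then (s 0 - m)%N else if r == 2%N then (s 2 + m.*2)%N else s r, o).
  elim: m => [|m IH] /=; first by apply: tr => -[|[|[|r]]] /=; rewrite ?subn0 ?addn0.
  by rewrite IH /=; apply: tr => -[|[|[|r]]] /=; rewrite /setr /=; lia.
have L2 a s m : (0 < a)%N -> iter m (fun q => run (Inc 0) (setr q.1 a (q.1 a).-1, q.2)) (s, o)
    = (fun r => if r == 0%N then (s 0 + m)%N else if r == a then (s a - m)%N else s r, o).
  move=> a0; elim: m => [|m IH] /=.
    apply: tr => r; rewrite subn0 addn0; case: eqP => [->//|_]; by case: eqP => [->|].
  rewrite IH /=; apply: tr => r; rewrite /setr /= eqxx.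
  rewrite (ltn_eqF a0) (gtn_eqF a0); case: (r == 0%N); first by rewrite addnS.
  by case: (r == a) => //; rewrite subnS.
rewrite /= L1 /= L2 //= L2 //=; apply: tr => -[|[|[|r]]]; rewrite /setr /in0 //=; lia.
Qed.

(** The code of [c] is preceded by a reading loop at address 0, which folds the input into counter
    0; at the end of the input [IRead] jumps past the loop to [a.+2]. Commands can therefore treat
    their input as one number. *)
Lemma program_machine (c : cmd) : well_formed c ->
  exists M : machine, forall x, computes M x (run c (in0 (binval x), [::])).2.
Proof.
move=> wf.
have [c1 [wf1 wd1 run_c1]] : exists c1, [/\ well_formed c1, (width c1 <= 3)%N &
    forall v (b : bool) o, run c1 (setr (in0 v) 1 b, o) = (in0 (v.*2 + b), o)].
  by exists absorb_bit; split=> //; exact: run_absorb_bit.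
pose a := csize c1.
pose code := IRead a.+2 :: rcons (compile 1 c1) (IJmp 0) ++ compile a.+2 c.
have sc : size code = (a.+2 + csize c)%N.
  by rewrite /code /= size_cat size_rcons !size_compile.
pose nr := maxn 3 (width c).
exists (counter_machine nr code) => x.
apply: (@counter_machine_computes _ _ _ (run c (in0 (binval x), [::])).1 (size x)).
  rewrite {2}/code /= all_cat all_rcons /= !compile_bounded ?leq_maxr ?sc //=.
  - by rewrite size_cat size_rcons !size_compile /nr -/a; lia.
  - by rewrite /nr; lia.
  - by rewrite -/a; lia.
have body n o s : reach (fstep code x) (1%N, s, n, o)
    (0%N, (run c1 (s, o)).1, n, (run c1 (s, o)).2).
  apply: (reach_trans (@compile_run c1 wf1 code [:: IRead a.+2]
    (IJmp 0 :: compile a.+2 c) _ x s n o)); first by rewrite /code cat_rcons.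
  apply: (@reach_step _ _ _ (_, _, _, _)); last exact: reach_refl.
  by rewrite /fstep /code cat_rcons -cat_cons (_ : (size _ + _)%N = size (IRead a.+2 :: compile 1 c1))
    ?onth_mid //= size_compile.
have reading k : (k <= size x)%N -> reach (fstep code x)
    (0%N, fun=> 0%N, 0%N, [::]) (0%N, in0 (binval (take k x)), k, [::]).
  elim: k => [|k IH] kx.
    rewrite take0 (_ : in0 _ = fun=> 0%N); first exact: reach_refl.
    by apply/funext => -[].
  apply: reach_trans (IH (ltnW kx)) _.
  apply: (@reach_step _ _ _ (_, _, _, _)).
    by rewrite /fstep /= (onthE x) (nth_map false) //=.
  have := body k.+1 [::] (setr (in0 (binval (take k x))) 1 (nth false x k)).
  rewrite run_c1 (take_nth false kx) /binval foldl_rcons /= => h.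
  exact: h.
have := reading _ (leqnn _); rewrite take_size => read; apply: (reach_trans read).
apply: (@reach_step _ _ _ (_, _, _, _)).
  by rewrite /fstep /= onth_default.
have sa : size (IRead a.+2 :: rcons (compile 1 c1) (IJmp 0)) = a.+2.
  by rewrite /= size_rcons size_compile.
have := @compile_run c wf code (IRead a.+2 :: rcons (compile 1 c1) (IJmp 0)) [::] _ x
  (in0 (binval x)) (size x) [::].
by rewrite sa -sc cats0; apply.
Qed.


(** * Functions computed with scratch counters *)

Definition agree_on (V : pred nat) (s s' : nat -> nat) : Prop :=
  forall r, V r -> s r = s' r.

Definition vanishes_from (e : nat) (s : nat -> nat) : Prop :=
  forall r, (e <= r)%N -> s r = 0%N.

Definition below (V : pred nat) (e : nat) : Prop := forall r, V r -> (r < e)%N.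

(* [f] depends on the counters in [V] only, and can be evaluated with all
   intermediate results in the counters from [e] on, for any [e] above [V]. *)
Definition computable (V : pred nat) (f : (nat -> nat) -> nat) : Prop :=
  (forall s s', agree_on V s s' -> f s = f s') /\
  forall e, below V e -> exists c,
    [/\ well_formed c, forall r, writes c r -> V r || (e <= r)%N &
        forall s o, vanishes_from e s -> run c (s, o) = (setr s e (f s), o)].

Definition emittable (V : pred nat) (w : (nat -> nat) -> seq bool) : Prop :=
  (forall s s', agree_on V s s' -> w s = w s') /\
  forall e, below V e -> exists c,
    [/\ well_formed c, forall r, writes c r -> V r || (e <= r)%N &
        forall s o, vanishes_from e s -> run c (s, o) = (s, o ++ w s)].

Ltac setr_cases := rewrite /setr; repeat match goal with
  |- context [@eq_op _ ?a ?b] => case: (@eqP _ a b) => ? end; subst; try (by []); try lia.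

Lemma run_move r t s o : r <> t ->
  run (Loop r (Inc t)) (s, o) = (setr (setr s t (s t + s r)%N) r 0, o).
Proof.
move=> rt /=; move E : (s r) => n.
elim: n s E => [|n IH] s E.
  by congr (_, _); apply/funext => q; setr_cases.
rewrite iterSr /= IH; last by setr_cases.
by congr (_, _); apply/funext => q; setr_cases.
Qed.

Lemma run_clear r s o : run (Loop r Skip) (s, o) = (setr s r 0, o).
Proof.
rewrite /=; move E : (s r) => n.
elim: n s E => [|n IH] s E.
  by congr (_, _); apply/funext => q; setr_cases.
rewrite iterSr /= IH; last by setr_cases.
by congr (_, _); apply/funext => q; setr_cases.
Qed.

Lemma run_fork r a b s o : r <> a -> r <> b -> a <> b ->
  run (Loop r (Seq (Inc a) (Inc b))) (s, o) =
  (setr (setr (setr s a (s a + s r)%N) b (s b + s r)%N) r 0, o).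
Proof.
move=> ra rb ab /=; move E : (s r) => n.
elim: n s E => [|n IH] s E.
  by congr (_, _); apply/funext => q; setr_cases.
rewrite iterSr /= IH; last by setr_cases.
by congr (_, _); apply/funext => q; setr_cases.
Qed.

Lemma run_seq c1 c2 p : run (Seq c1 c2) p = run c2 (run c1 p).
Proof. by []. Qed.

Lemma computable_ext V f g : f =1 g -> computable V f -> computable V g.
Proof. by move=> /funext ->. Qed.

Lemma computable_weaken (V W : pred nat) f :
  computable V f -> subpred V W -> computable W f.
Proof.
move=> [dep cf] VW; split=> [s s' ag|e be].
  by apply: dep => r rd; apply: ag; exact: VW.
have [c [wf wr rc]] := cf e (fun r Vr => be r (VW r Vr)); exists c; split=> // r /wr.
by case/orP => [/VW -> //|->]; rewrite orbT.
Qed.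

Lemma computable_var (V : pred nat) r : V r -> computable V (fun s => s r).
Proof.
move=> Vr; split=> [s s' ag|e be]; first exact: ag.
have re := be r Vr.
(* Reading a counter empties it: [r] is poured into both [e] and [e.+1], then restored from [e.+1].
   This is why commands are allowed to write the counters of [V]. *)
exists (Seq (Loop r (Seq (Inc e) (Inc e.+1))) (Loop e.+1 (Inc r))); split.
- by rewrite /=; lia.
- move=> q /=; have [->|] := eqVneq q r; [by rewrite Vr | lia].
move=> s o v; rewrite run_seq run_fork; [|lia..].
rewrite run_move; last lia.
have := v e (leqnn e); have := v e.+1 (leqnSn e) => v1 v0.
by congr (_, _); apply/funext => q; setr_cases.
Qed.

Lemma computable_const V n : computable V (fun=> n).
Proof.
split=> // e be; exists (iter n (Seq (Inc e)) Skip); split.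
- by elim: n.
- by elim: n => //= n IH r /orP[/eqP ->|/IH //]; rewrite leqnn orbT.
move=> s o /(_ e (leqnn e)) se.
have H m u : u e = m -> run (iter n (Seq (Inc e)) Skip) (u, o) = (setr u e (m + n)%N, o).
  elim: n m u => [|n IH] m u ue /=.
    by congr (_, _); apply/funext => q; setr_cases.
  rewrite (IH m.+1); last by setr_cases.
  by congr (_, _); apply/funext => q; setr_cases.
exact: (H 0%N s se).
Qed.

Lemma computable_succ V f : computable V f -> computable V (fun s => (f s).+1).
Proof.
move=> [dep cf]; split=> [s s' /dep ->//|e be].
have [c [wf wr rc]] := cf e be; exists (Seq c (Inc e)); split.
- by rewrite /= wf.
- by move=> r /= /orP[/wr //|/eqP ->]; rewrite leqnn orbT.
move=> s o v; rewrite /= rc //=.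
by congr (_, _); apply/funext => q; setr_cases.
Qed.

Lemma vanishes_setr e s r v :
  vanishes_from e s -> (r < e)%N -> vanishes_from e (setr s r v).
Proof. by move=> ve re q eq; setr_cases; exact: ve. Qed.

Lemma vanishes_weaken e e' s : vanishes_from e s -> (e <= e')%N -> vanishes_from e' s.
Proof. by move=> ve ee' q e'q; apply: ve; exact: leq_trans e'q. Qed.

Definition with2 (V : pred nat) (e : nat) : pred nat :=
  fun r => [|| V r, r == e | r == e.+1].

Definition with1 (V : pred nat) (e : nat) : pred nat :=
  fun r => V r || (r == e).

(* The loop counter sits in [e.+2], the index and the accumulator in [e] and
   [e.+1]. *)
Lemma computable_rec V f g (h : (nat -> nat) -> nat -> nat -> nat) :
  computable V f -> computable V g ->
  (forall i a, computable V (fun s => h s i a)) ->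
  (forall e, below V e -> computable (with2 V e) (fun s => h s (s e) (s e.+1))) ->
  computable V (fun s => iteri (f s) (h s) (g s)).
Proof.
move=> [depf cf] [depg cg] consth ch; split=> [s s' ag|e be].
  rewrite (depf _ _ ag) (depg _ _ ag); elim: (f s') => //= n ->.
  by have [+ _] := consth n (iteri n (h s') (g s')); apply.
have beW k : below V (e + k) by move=> r /be; lia.
have [kg [wfg wrg rg]] := cg (e + 1)%N (beW 1%N).
have [kf [wff wrf rf]] := cf (e + 2)%N (beW 2).
have [deph chh] := ch e be.
have [|kh [wfh wrh rh]] := chh (e + 3)%N; first by move=> r /or3P[/be|/eqP|/eqP]; lia.
rewrite !addnS !addn0 in kg wfg wrg rg kf wff wrf rf kh wfh wrh rh *.
pose body := Seq kh (Seq (Loop e.+1 Skip) (Seq (Loop e.+3 (Inc e.+1)) (Inc e))).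
exists (Seq kg (Seq kf (Seq (Loop e.+2 body) (Seq (Loop e Skip) (Loop e.+1 (Inc e)))))).
have Vf r : V r -> r <> e.+2 by move/be => + E; rewrite E; lia.
split.
- rewrite /= wfg wff wfh /=.
  have -> : writes kh e.+2 = false.
    by apply/negP => /wrh /orP[/or3P[/Vf//|/eqP|/eqP]|]; lia.
  by lia.
- move=> r; rewrite /=.
  have [Vr|Vr] //= := boolP (V r); case: (leqP e r) => //= re.
  have -> : writes kg r = false by apply/negP => /wrg; rewrite (negbTE Vr); lia.
  have -> : writes kf r = false by apply/negP => /wrf; rewrite (negbTE Vr); lia.
  have -> : writes kh r = false by apply/negP => /wrh; rewrite /with2 (negbTE Vr); lia.
  by lia.
move=> s o v; rewrite !run_seq rg; last exact: vanishes_weaken v _.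
rewrite rf; last by apply: vanishes_setr; [apply: vanishes_weaken v _; lia | lia].
have agf : agree_on V s (setr s e.+1 (g s)) by move=> r /be; setr_cases.
rewrite -(depf _ _ agf).
have v0 := v e (leqnn e).
(* The store after [j] passes. The result of [kh] appears in [e.+3] and is moved to the accumulator,
   so the scratch counters vanish again before the next pass. *)
pose st j r := if r == e then j else if r == e.+1 then iteri j (h s) (g s)
  else if r == e.+2 then (f s - j)%N else s r.
have loop j : (j <= f s)%N ->
    iter j (fun q => run body (setr q.1 e.+2 (q.1 e.+2).-1, q.2)) (st 0%N, o) = (st j, o).
  elim: j => // j IH jf; rewrite iterS IH ?(ltnW jf) //.
  change (run body (setr (st j) e.+2 (st j e.+2).-1, o) = (st j.+1, o)).
  rewrite /body !run_seq rh; last first.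
    by move=> q eq; rewrite /st; setr_cases; apply: v; lia.
  set u := setr (st j) _ _.
  have -> : h u (u e) (u e.+1) = h s j (iteri j (h s) (g s)).
    rewrite [u e](_ : _ = j); last by rewrite /u /st; setr_cases.
    rewrite [u e.+1](_ : _ = iteri j (h s) (g s)); last by rewrite /u /st; setr_cases.
    have [+ _] := consth j (iteri j (h s) (g s)); apply=> r Vr.
    by rewrite /u /st; have := be _ Vr; setr_cases.
  have v3 : s e.+3 = 0%N by apply: v; lia.
  rewrite run_clear run_move; last lia.
  rewrite /=; by congr (_, _); apply/funext => q; rewrite /u /st; setr_cases.
have -> : setr (setr s e.+1 (g s)) e.+2 (f s) = st 0%N.
  by apply/funext => q; rewrite /st; setr_cases.
rewrite [run (Loop e.+2 body) _](_ : _ = (st (f s), o)); last first.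
  have E0 : st 0%N e.+2 = f s by rewrite /st; setr_cases.
  rewrite -[LHS]/(iter (st 0%N e.+2) (fun q => run body (setr q.1 e.+2 (q.1 e.+2).-1, q.2))
    (st 0%N, o)).
  by rewrite E0 loop.
rewrite run_clear run_move; last lia.
have v1 := v e.+1 (leqnSn e); have v2 : s e.+2 = 0%N by apply: v; lia.
by congr (_, _); apply/funext => q; rewrite /st; setr_cases.
Qed.

Lemma emittable_ext V w w' : w =1 w' -> emittable V w -> emittable V w'.
Proof. by move=> /funext ->. Qed.

Lemma emittable_const V w : emittable V (fun=> w).
Proof.
split=> // e be; exists (foldr (fun b => Seq (Out b)) Skip w); split.
- by elim: w.
- by move=> r; elim: w => //= n w IH /IH.
move=> s o _; elim: w o => [|b w IH] o /=; first by rewrite cats0.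
by rewrite IH cat_rcons.
Qed.

Lemma emittable_cat V w w' :
  emittable V w -> emittable V w' -> emittable V (fun s => w s ++ w' s).
Proof.
move=> [dw cw] [dw' cw']; split=> [s s' ag|e be]; first by rewrite (dw _ _ ag) (dw' _ _ ag).
have [c [wf wr rc]] := cw e be; have [c' [wf' wr' rc']] := cw' e be.
exists (Seq c c'); split; first by rewrite /= wf.
  by move=> r /= /orP[/wr|/wr'].
by move=> s o v; rewrite run_seq rc // rc' // catA.
Qed.

(** The hypothesis on constant indices shows that the output depends on [V] only; the one on [s e]
    supplies the code of the body, with the running index held in counter [e]. *)
Lemma emittable_loop V f (w : (nat -> nat) -> nat -> seq bool) :
  computable V f -> (forall i, emittable V (fun s => w s i)) ->
  (forall e, below V e -> emittable (with1 V e) (fun s => w s (s e))) ->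
  emittable V (fun s => flatten [seq w s i | i <- iota 0 (f s)]).
Proof.
move=> [depf cf] constw cw; split=> [s s' ag|e be].
  rewrite (depf _ _ ag); congr flatten; apply: eq_map => i.
  by have [+ _] := constw i; apply.
have beW k : below V (e + k) by move=> r /be; lia.
have [kf [wff wrf rf]] := cf (e + 1)%N (beW 1%N).
have [depw cww] := cw e be.
have [|kw [wfw wrw rw]] := cww (e + 2)%N; first by move=> r /orP[/be|/eqP]; lia.
rewrite !addnS !addn0 in kf wff wrf rf kw wfw wrw rw *.
pose body := Seq kw (Inc e).
exists (Seq kf (Seq (Loop e.+1 body) (Loop e Skip))).
have Vf r : V r -> r <> e.+1 by move/be => + E; rewrite E; lia.
split.
- rewrite /= wff wfw /=.
  have -> : writes kw e.+1 = false.
    by apply/negP => /wrw /orP[/orP[/Vf//|/eqP]|]; lia.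
  by lia.
- move=> r; rewrite /=.
  have [Vr|Vr] //= := boolP (V r); case: (leqP e r) => //= re.
  have -> : writes kf r = false by apply/negP => /wrf; rewrite (negbTE Vr); lia.
  have -> : writes kw r = false by apply/negP => /wrw; rewrite /with1 (negbTE Vr); lia.
  by lia.
move=> s o v; rewrite !run_seq rf; last exact: vanishes_weaken v _.
have v0 := v e (leqnn e).
pose st j r := if r == e then j else if r == e.+1 then (f s - j)%N else s r.
have loop j : (j <= f s)%N ->
    iter j (fun q => run body (setr q.1 e.+1 (q.1 e.+1).-1, q.2)) (st 0%N, o) =
    (st j, o ++ flatten [seq w s i | i <- iota 0 j]).
  elim: j => [_|j IH jf]; first by rewrite cats0.
  rewrite iterS IH ?(ltnW jf) //.
  change (run body (setr (st j) e.+1 (st j e.+1).-1, o ++ flatten [seq w s i | i <- iota 0 j]) =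
    (st j.+1, o ++ flatten [seq w s i | i <- iota 0 j.+1])).
  rewrite /body !run_seq rw; last first.
    by move=> q eq; rewrite /st; setr_cases; apply: v; lia.
  set u := setr (st j) _ _.
  have -> : w u (u e) = w s j.
    rewrite [u e](_ : _ = j); last by rewrite /u /st; setr_cases.
    have [+ _] := constw j; apply=> r Vr.
    by rewrite /u /st; have := be _ Vr; setr_cases.
  rewrite -addn1 iotaD map_cat flatten_cat /= cats0 catA add0n; congr (_, _).
  by apply/funext => q; rewrite /u /st; setr_cases.
have -> : setr s e.+1 (f s) = st 0%N.
  by apply/funext => q; rewrite /st; setr_cases.
rewrite [run (Loop e.+1 body) _](_ : _ = (st (f s), o ++ flatten [seq w s i | i <- iota 0 (f s)])); last first.
  have E0 : st 0%N e.+1 = f s by rewrite /st; setr_cases.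
  rewrite -[LHS]/(iter (st 0%N e.+1) (fun q => run body (setr q.1 e.+1 (q.1 e.+1).-1, q.2))
    (st 0%N, o)).
  by rewrite E0 loop.
have v1 := v e.+1 (leqnSn e).
by rewrite run_clear; congr (_, _); apply/funext => q; rewrite /st; setr_cases.
Qed.


(** * Arithmetic functions *)

Definition computable1 (F : nat -> nat) : Prop :=
  forall V f, computable V f -> computable V (fun s => F (f s)).

Definition computable2 (F : nat -> nat -> nat) : Prop :=
  forall V f g, computable V f -> computable V g -> computable V (fun s => F (f s) (g s)).

Definition computable3 (F : nat -> nat -> nat -> nat) : Prop :=
  forall V f g h, computable V f -> computable V g -> computable V h ->
    computable V (fun s => F (f s) (g s) (h s)).

Ltac weaken := eapply computable_weaken;
  [eassumption | by let r := fresh in let Vr := fresh in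
                 move=> r Vr; rewrite /with2 /with1 Vr].
Ltac comp_step := cbv beta; first
  [ assumption | apply: computable_const
  | (apply: computable_var; by rewrite /with2 /with1 ?eqxx ?orbT) | weaken ].

Lemma computable_add : computable2 addn.
Proof.
move=> V f g cf cg; apply: (@computable_ext _ (fun s => iteri (f s) (fun _ a => a.+1) (g s))).
  by move=> s; elim: (f s) => //= n ->.
apply: (@computable_rec _ _ _ (fun _ _ a => a.+1)); intros; try apply: computable_succ; comp_step.
Qed.

Lemma computable_mul : computable2 muln.
Proof.
move=> V f g cf cg; apply: (@computable_ext _ (fun s => iteri (f s) (fun _ a => a + g s) 0)%N).
  by move=> s; elim: (f s) => //= n ->; rewrite mulSn addnC.
apply: (@computable_rec _ _ _ (fun s _ a => a + g s)%N); intros; try apply: computable_add; comp_step.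
Qed.

Lemma computable_exp : computable2 expn.
Proof.
move=> V f g cf cg; apply: (@computable_ext _ (fun s => iteri (g s) (fun _ a => a * f s) 1)%N).
  by move=> s; elim: (g s) => //= n ->; rewrite expnSr.
apply: (@computable_rec _ _ _ (fun s _ a => a * f s)%N); intros; try apply: computable_mul; comp_step.
Qed.

Lemma computable_pred : computable1 predn.
Proof.
move=> V f cf; apply: (@computable_ext _ (fun s => iteri (f s) (fun i _ => i) 0)%N).
  by move=> s; case: (f s).
by apply: (@computable_rec _ _ _ (fun _ i _ => i)); intros; comp_step.
Qed.

Lemma computable_sub : computable2 subn.
Proof.
move=> V f g cf cg; apply: (@computable_ext _ (fun s => iteri (g s) (fun _ a => a.-1) (f s))%N).
  by move=> s; elim: (g s) => /= [|n ->]; rewrite ?subn0 ?subnS.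
apply: (@computable_rec _ _ _ (fun s _ a => a.-1)%N); intros; try apply: computable_pred; comp_step.
Qed.

Lemma computable_if0 V f g h : computable V f -> computable V g -> computable V h ->
  computable V (fun s => if f s == 0%N then g s else h s).
Proof.
move=> cf cg ch; apply: (@computable_ext _ (fun s => iteri (f s) (fun _ _ => h s) (g s))%N).
  by move=> s; case: (f s).
by apply: (@computable_rec _ _ _ (fun s _ _ => h s)%N); intros; comp_step.
Qed.

Lemma computable_if_le V f f' g h : computable V f -> computable V f' ->
  computable V g -> computable V h ->
  computable V (fun s => if (f s <= f' s)%N then g s else h s).
Proof. by move=> cf cf' cg ch; apply: computable_if0 => //; exact: computable_sub. Qed.

Lemma computable_if_eq V f f' g h : computable V f -> computable V f' ->
  computable V g -> computable V h ->
  computable V (fun s => if f s == f' s then g s else h s).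
Proof.
move=> cf cf' cg ch.
apply: (@computable_ext _ (fun s => if (f s <= f' s)%N then if (f' s <= f s)%N then g s else h s else h s)).
  by move=> s; rewrite eqn_leq; case: ifP.
by do 2 apply: computable_if_le => //.
Qed.

(** The quotient is the number of [i < f s] with [i.+1 * g s <= f s]. A zero divisor is split off
    because this count would then be [f s] and not the value 0 of [divn]. *)
Lemma computable_div : computable2 divn.
Proof.
move=> V f g cf cg; apply: (@computable_ext _ (fun s => if g s == 0%N then 0%N else
    iteri (f s) (fun i a => if (i.+1 * g s <= f s)%N then a.+1 else a) 0)%N).
  move=> s; case: eqP => [->|/eqP]; first by rewrite divn0.
  rewrite -lt0n => g0.
  have cnt n : iteri n (fun i a => if (i.+1 * g s <= f s)%N then a.+1 else a) 0%N
      = minn n (f s %/ g s).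
    by elim: n => [|n /= ->]; rewrite ?min0n // -leq_divRL //; case: ifP; lia.
  by rewrite cnt; apply/minn_idPr; exact: leq_div.
apply: computable_if0 => //; first exact: computable_const.
apply: (@computable_rec _ _ _ (fun s i a => if (i.+1 * g s <= f s)%N then a.+1 else a)); intros;
  try (apply: computable_if_le; try apply: computable_mul; try apply: computable_succ); comp_step.
Qed.

Lemma computable_mod : computable2 modn.
Proof.
move=> V f g cf cg; apply: (@computable_ext _ (fun s => f s - f s %/ g s * g s)%N).
  by move=> s; rewrite {1}(divn_eq (f s) (g s)) addKn.
by apply: computable_sub => //; apply: computable_mul => //; exact: computable_div.
Qed.

Lemma computable_min : computable2 minn.
Proof.
move=> V f g cf cg; apply: (@computable_ext _ (fun s => if (f s <= g s)%N then f s else g s)).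
  by move=> s; case: ifP; lia.
exact: computable_if_le.
Qed.

Lemma computable_logn2 : computable1 (logn 2).
Proof.
move=> V f cf; apply: (@computable_ext _ (fun s =>
    iteri (f s) (fun i a => if f s %% 2 ^ i.+1 == 0 then a.+1 else a) 0)%N).
  move=> s; case: (posnP (f s)) => [->//|f0].
  have cnt n : iteri n (fun i a => if f s %% 2 ^ i.+1 == 0 then a.+1 else a)%N 0%N
      = minn n (logn 2 (f s)).
    elim: n => [|n /= ->]; first by rewrite min0n.
    by rewrite -/(dvdn _ _) pfactor_dvdn //; case: ifP; lia.
  rewrite cnt; apply/minn_idPr; apply: ltnW; apply: leq_trans (ltn_expl _ (ltnSn 1)) _.
  by apply: dvdn_leq => //; exact: pfactor_dvdnn.
apply: (@computable_rec _ _ _ (fun s i a => if f s %% 2 ^ i.+1 == 0 then a.+1 else a)%N); intros;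
  try (apply: computable_if0; [apply: computable_mod;
    [|apply: computable_exp; [|apply: computable_succ]] | apply: computable_succ |]); comp_step.
Qed.

Lemma computable_sum V f (h : (nat -> nat) -> nat -> nat) : computable V f ->
  (forall i, computable V (fun s => h s i)) ->
  (forall e, below V e -> computable (with2 V e) (fun s => h s (s e))) ->
  computable V (fun s => \sum_(j < f s) h s j)%N.
Proof.
move=> cf ch ch'; apply: (@computable_ext _ (fun s => iteri (f s) (fun i a => a + h s i) 0)%N).
  by move=> s; elim: (f s) => [|n /= ->]; rewrite ?big_ord0 // big_ord_recr.
apply: (@computable_rec _ _ _ (fun s i a => a + h s i)%N) => //; first exact: computable_const.
  by move=> i a; apply: computable_add; [comp_step | exact: ch].
by move=> e be; apply: computable_add; [comp_step | exact: ch'].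
Qed.

(** * The decoder *)

(** There are [b.+1] digits because numerators range up to [2 ^ b] inclusive, the end point 1 being
    a possible value. *)
Definition bits (b v : nat) : seq bool := [seq odd (v %/ 2 ^ (b - j)) | j <- iota 0 b.+1].

Lemma binval_rcons s b : binval (rcons s b) = ((binval s).*2 + b)%N.
Proof. by rewrite /binval foldl_rcons. Qed.

Lemma binval_bits b v : (v < 2 ^ b.+1)%N -> binval (bits b v) = v.
Proof.
elim: b v => [|b IH] v vb; first by case: v vb => [|[|v]].
have -> : bits b.+1 v = rcons (bits b v./2) (odd v).
  rewrite /bits -[b.+2]addn1 iotaD map_cat [iota (_ + _) 1]/= cats1; congr rcons; last first.
    by rewrite add0n subnn expn0 divn1.
  apply/eq_in_map => j; rewrite mem_iota /= => jb.
  by rewrite -divn2 -divnMA -expnS subSn.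
rewrite binval_rcons IH; first by rewrite addnC odd_double_half.
by rewrite ltn_half_double -muln2 -expnSr.
Qed.

Lemma binval_one_zeros b : binval (true :: nseq b false) = (2 ^ b)%N.
Proof.
elim: b => // b IH.
have -> : true :: nseq b.+1 false = rcons (true :: nseq b false) false.
  by rewrite rcons_cons; congr (_ :: _); elim: b {IH} => //= b <-.
by rewrite binval_rcons IH addn0 -muln2 expnSr.
Qed.

(** Loops replace a conditional: of two loops of lengths [f s %% 2] and [1 - f s %% 2], exactly one
    runs, and it runs once. *)
Lemma emittable_bit V f : computable V f -> emittable V (fun s => [:: odd (f s)]).
Proof.
move=> cf; apply: (@emittable_ext _ (fun s =>
    flatten [seq [:: true] | i <- iota 0 (f s %% 2)] ++
    flatten [seq [:: false] | i <- iota 0 (1 - f s %% 2)])).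
  by move=> s; rewrite modn2; case: (odd _).
have c2 : computable V (fun s => f s %% 2)%N.
  by apply: computable_mod => //; exact: computable_const.
apply: emittable_cat; apply: (@emittable_loop _ _ (fun _ _ => _)); intros;
  try exact: emittable_const; try exact: c2.
by apply: computable_sub => //; exact: computable_const.
Qed.

(* The points [pt n w / 2 ^ b n] for [w < cnt n], where [n] is the input. *)
Definition dyadic_list (b cnt : nat -> nat) (pt : nat -> nat -> nat) (n : nat) : seq fraction :=
  [seq Fraction false (bits (b n) (pt n w)) (true :: nseq (b n) false) | w <- iota 0 (cnt n)].

Lemma decoder_machine (b cnt : nat -> nat) (pt : nat -> nat -> nat) :
  computable1 b -> computable1 cnt -> computable2 pt ->
  exists M : machine, forall x,
    computes M x (encode_list (dyadic_list b cnt pt (binval x))).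
Proof.
move=> cb cc cp.
pose V0 : pred nat := fun r => r == 0%N.
have v0 : computable V0 (fun s => s 0%N) by apply: computable_var.
have em : emittable V0 (fun s => encode_list (dyadic_list b cnt pt (s 0%N))).
  apply: (@emittable_ext _ (fun s => flatten [seq ([:: true; false] ++
     (flatten [seq ([:: true] ++ [:: odd (pt (s 0) w %/ 2 ^ (b (s 0) - j))]) | j <- iota 0 (b (s 0)).+1]
      ++ [:: false]) ++
     ([:: true; true] ++ flatten [seq [:: true; false] | j <- iota 0 (b (s 0))] ++ [:: false]))
       | w <- iota 0 (cnt (s 0))] ++ [:: false])%N).
    move=> s; rewrite /encode_list /dyadic_list -map_comp; congr (flatten _ ++ _).
    apply: eq_map => w; rewrite /= /encode_fraction /= /encode_word /bits -map_comp.
    congr [:: _, _, _, _ & _]; congr (_ ++ _).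
    rewrite /=; congr [:: _, _ & _]; congr (_ ++ _); congr flatten.
    by move: (b (s 0%N)) => B; elim: B 0%N => //= B IH k; rewrite (IH k.+1).
  have body V (f g : (nat -> nat) -> nat) : computable V f -> computable V g ->
    emittable V (fun s => [:: true; false] ++
     (flatten [seq ([:: true] ++ [:: odd (pt (f s) (g s) %/ 2 ^ (b (f s) - j))]) | j <- iota 0 (b (f s)).+1]
      ++ [:: false]) ++
     ([:: true; true] ++ flatten [seq [:: true; false] | j <- iota 0 (b (f s))] ++ [:: false]))%N.
    move=> cf cg; apply: emittable_cat; first exact: emittable_const.
    have cbf : computable V (fun s => b (f s)) by exact: cb.
    have cpf : computable V (fun s => pt (f s) (g s)) by exact: cp.
    apply: emittable_cat; apply: emittable_cat; try exact: emittable_const.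
      apply: (@emittable_loop _ _ (fun s j => [:: true] ++
          [:: odd (pt (f s) (g s) %/ 2 ^ (b (f s) - j))])%N).
      - exact: computable_succ.
      - move=> i; apply: emittable_cat; first exact: emittable_const.
        apply: emittable_bit; apply: computable_div => //; apply: computable_exp; first comp_step.
        by apply: computable_sub => //; comp_step.
      - move=> e be; apply: emittable_cat; first exact: emittable_const.
        apply: emittable_bit; apply: computable_div => //; first comp_step.
        by apply: computable_exp; [comp_step|apply: computable_sub; comp_step].
    apply: emittable_cat; last exact: emittable_const.
    apply: (@emittable_loop _ _ (fun _ _ => [:: true; false])) => // *; exact: emittable_const.
  apply: emittable_cat; last exact: emittable_const.
  apply: (@emittable_loop _ _ (fun s w => [:: true; false] ++
     (flatten [seq ([:: true] ++ [:: odd (pt (s 0) w %/ 2 ^ (b (s 0) - j))]) | j <- iota 0 (b (s 0)).+1]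
      ++ [:: false]) ++
     ([:: true; true] ++ flatten [seq [:: true; false] | j <- iota 0 (b (s 0))] ++ [:: false]))%N).
  - exact: cc.
  - by move=> i; apply: (body _ (fun s => s 0%N) (fun=> i)) => //; exact: computable_const.
  - by move=> e be; apply: (body _ (fun s => s 0%N) (fun s => s e)); comp_step.
have [_ /(_ 1%N)] := em; case=> [r /eqP -> //|c [wf _ rc]].
have [M hM] := program_machine wf; exists M => x.
by have := hM x; rewrite rc // => r; rewrite /in0; case: r.
Qed.


(** * Program data packed into one number *)

Section Records.
Variables (nI m L s0 : nat).

(* A record is a number [n = (2 c + 1) 2 ^ (b + s0)]; the digits of [c] in base
   [2 ^ (b + s0)] are the cell width, the starting point, the number of entries
   and the entries, each made of a key and of [m.+1] positive and [m.+1] negative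
   parts of coefficients. *)
Definition rdigit (n j : nat) : nat :=
  ((n %/ 2 ^ logn 2 n) %/ 2 %/ 2 ^ (logn 2 n * j) %% 2 ^ logn 2 n)%N.

Definition rprec (n : nat) : nat := (logn 2 n - s0)%N.

Definition esize : nat := (2 * m + 3)%N.

(** A linear search for the digit position of a key. The default 0 for an absent key is harmless,
    since rounded orbits will be shown to meet listed cells only. *)
Definition entry (n key : nat) : nat :=
  iteri (rdigit n 2) (fun p acc => if rdigit n (3 + p * esize)%N == key then (3 + p * esize)%N else acc) 0%N.

(** The polynomial with coefficients [c j] at the point [T / 2 ^ b], cleared of denominators by the
    factor [(2 ^ b) ^ m] so that only natural numbers occur. *)
Definition scaled_sum (b T : nat) (c : nat -> nat) : nat :=
  (\sum_(j < m.+1) c j * (T ^ j * (2 ^ b) ^ (m - j)))%N.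

(** Truncated subtraction and [minn] clip the value to the interval from 0 to [2 ^ b]; this brings
    it no farther from a target lying in that interval. *)
Definition poly_value (b T : nat) (pos neg : nat -> nat) : nat :=
  minn (2 ^ b) ((scaled_sum b T pos - scaled_sum b T neg) %/ (2 ^ b) ^ m).

Definition cell_key (W i a : nat) : nat := ((a %/ W) * nI + i).+1.

Definition rbranch (n i a : nat) : nat :=
  poly_value (rprec n) (a %% rdigit n 0)
    (fun j => rdigit n (entry n (cell_key (rdigit n 0) i a) + 1 + j)%N)
    (fun j => rdigit n (entry n (cell_key (rdigit n 0) i a) + m.+2 + j)%N).

(** The digits of [w] in base [nI] choose the branches, so counting up through [w] enumerates all
    words of length [L * b]. *)
Definition orbit_point (b a0 : nat) (B : nat -> nat -> nat) (w : nat) : nat :=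
  iteri (L * b) (fun t a => B (w %/ nI ^ t %% nI)%N a) a0.

Lemma computable_rdigit : computable2 rdigit.
Proof.
move=> V f g cf cg.
have cl : computable V (fun s => logn 2 (f s)) by exact: computable_logn2.
have ce : computable V (fun s => 2 ^ logn 2 (f s))%N.
  by apply: computable_exp => //; exact: computable_const.
apply: computable_mod => //; apply: computable_div; last first.
  by apply: computable_exp; [exact: computable_const | exact: computable_mul].
by apply: computable_div; [exact: computable_div | exact: computable_const].
Qed.

Lemma computable_rprec : computable1 rprec.
Proof.
by move=> V f cf; apply: computable_sub; [exact: computable_logn2 | exact: computable_const].
Qed.

Lemma computable_entry : computable2 entry.
Proof.
move=> V f g cf cg; rewrite /entry.
have cm p : computable p (fun s => f s) -> forall h, computable p h -> computable p (fun s => 3 + h s * esize)%N.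
  move=> _ h ch; apply: computable_add; first exact: computable_const.
  by apply: computable_mul => //; exact: computable_const.
apply: (@computable_rec _ _ _ (fun s p acc =>
  if rdigit (f s) (3 + p * esize)%N == g s then (3 + p * esize)%N else acc)).
- by apply: computable_rdigit => //; exact: computable_const.
- exact: computable_const.
- move=> i a; apply: computable_if_eq; try comp_step.
  by apply: computable_rdigit; comp_step.
- move=> e be; have cf' : computable (with2 V e) f by comp_step.
  apply: computable_if_eq; try comp_step.
    by apply: computable_rdigit; first comp_step; apply: cm; comp_step.
  by apply: cm; comp_step.
Qed.

Lemma computable_scaled_sum V fb fT (c : (nat -> nat) -> nat -> nat) :
  computable V fb -> computable V fT -> (forall j, computable V (fun s => c s j)) ->
  (forall e, below V e -> computable (with2 V e) (fun s => c s (s e))) ->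
  computable V (fun s => scaled_sum (fb s) (fT s) (c s)).
Proof.
move=> cb cT cc cc'.
apply: (@computable_sum _ _ (fun s j => c s j * (fT s ^ j * (2 ^ fb s) ^ (m - j)))%N).
- exact: computable_const.
- move=> i; apply: computable_mul => //; apply: computable_mul.
    by apply: computable_exp; comp_step.
  by apply: computable_exp; [apply: computable_exp|]; comp_step.
- move=> e be; apply: computable_mul; first exact: cc'.
  apply: computable_mul; first by apply: computable_exp; comp_step.
  by apply: computable_exp; [apply: computable_exp|apply: computable_sub]; comp_step.
Qed.

Lemma computable_rbranch : computable3 rbranch.
Proof.
move=> V f g h cf cg ch.
have cw U f' : computable U f' -> computable U (fun s => rdigit (f' s) 0).
  by move=> cf'; apply: computable_rdigit => //; exact: computable_const.
have ck U f' g' h' : computable U f' -> computable U g' -> computable U h' ->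
    computable U (fun s => entry (f' s) (cell_key (rdigit (f' s) 0) (g' s) (h' s))).
  move=> cf' cg' ch'; apply: computable_entry => //; apply: computable_succ.
  apply: computable_add => //; apply: computable_mul; last exact: computable_const.
  by apply: computable_div => //; exact: cw.
have cd k U f' g' h' j : computable U f' -> computable U g' -> computable U h' -> computable U j ->
    computable U (fun s => rdigit (f' s) (entry (f' s) (cell_key (rdigit (f' s) 0) (g' s) (h' s)) + k + j s))%N.
  move=> cf' cg' ch' cj; apply: computable_rdigit => //; apply: computable_add => //.
  by apply: computable_add; [exact: ck | exact: computable_const].
have cb : computable V (fun s => rprec (f s)) by exact: computable_rprec.
have cT : computable V (fun s => h s %% rdigit (f s) 0)%N.
  by apply: computable_mod => //; exact: cw.
apply: computable_min; first by apply: computable_exp; comp_step.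
apply: computable_div; last first.
  by apply: computable_exp; [apply: computable_exp|]; comp_step.
by apply: computable_sub; (apply: computable_scaled_sum => // *; apply: cd; comp_step).
Qed.

Lemma computable_orbit_point :
  computable2 (fun n w => orbit_point (rprec n) (rdigit n 1) (rbranch n) w).
Proof.
move=> V f g cf cg.
apply: (@computable_rec _ _ _ (fun s t a => rbranch (f s) (g s %/ nI ^ t %% nI)%N a)).
- by apply: computable_mul; [exact: computable_const | exact: computable_rprec].
- by apply: computable_rdigit => //; exact: computable_const.
- move=> i a; apply: computable_rbranch; try comp_step.
  apply: computable_mod; last comp_step; apply: computable_div; first comp_step.
  by apply: computable_exp; comp_step.
- move=> e be; apply: computable_rbranch; try comp_step.
  apply: computable_mod; last comp_step; apply: computable_div; first comp_step.
  by apply: computable_exp; comp_step.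
Qed.

Definition digits_value (base : nat) (ds : seq nat) : nat :=
  foldr (fun d c => d + base * c)%N 0%N ds.

Lemma digits_valueE base ds j : all (fun d => d < base)%N ds ->
  (digits_value base ds %/ base ^ j %% base)%N = nth 0%N ds j.
Proof.
elim: ds j => [|d ds IH] j /=; first by rewrite div0n mod0n nth_nil.
case/andP => db dsb; have b0 : (0 < base)%N by lia.
case: j => [|j] /=; first by rewrite expn0 divn1 addnC mulnC modnMDl modn_small.
by rewrite expnS divnMA addnC mulnC divnMDl // (divn_small db) addn0 IH.
Qed.

Lemma digits_value_lt base ds : all (fun d => d < base)%N ds ->
  (digits_value base ds < base ^ size ds)%N.
Proof.
elim: ds => //= d ds IH /andP[db /IH lt]; rewrite expnS.
by apply: (@leq_trans (base + base * digits_value base ds)); [lia | rewrite -mulnS leq_mul2l lt orbT].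
Qed.

Lemma nth_flatten_blocks E (ss : seq (seq nat)) p q : all (fun t => size t == E) ss ->
  (p < size ss)%N -> (q < E)%N ->
  nth 0%N (flatten ss) (p * E + q) = nth 0%N (nth [::] ss p) q.
Proof.
elim: ss p => //= t ss IH p /andP[/eqP tE ssE] ps qE.
rewrite nth_cat tE; case: p ps => [|p] ps /=; first by rewrite mul0n add0n qE.
rewrite mulSn ltnNge -addnA leq_addr /= addKn; exact: IH.
Qed.

(** One machine serves all parameters; the existential [B] hides the digit extraction and retains
    only the values at listed cells. The record has [size K * esize + 3] digits of [b + s0] bits,
    one more block pays for the factor [2 ^ (b + s0)], and a last one for rounding up. *)
Lemma record_program : exists M : machine, forall (b W a0 : nat) (K : seq nat) (pos neg : nat -> nat -> nat),
  (0 < b + s0)%N -> uniq K -> (W < 2 ^ (b + s0))%N -> (a0 < 2 ^ (b + s0))%N ->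
  (size K < 2 ^ (b + s0))%N -> {in K, forall key, (key < 2 ^ (b + s0))%N} ->
  {in K, forall key j, (j <= m)%N -> (pos key j < 2 ^ (b + s0))%N} ->
  {in K, forall key j, (j <= m)%N -> (neg key j < 2 ^ (b + s0))%N} ->
  exists (B : nat -> nat -> nat) (x : seq bool),
  [/\ forall i a, cell_key W i a \in K ->
        B i a = poly_value b (a %% W) (pos (cell_key W i a)) (neg (cell_key W i a)),
      (size x <= (size K * esize + 5) * (b + s0))%N &
      computes M x (encode_list [seq Fraction false (bits b (orbit_point b a0 B w))
        (true :: nseq b false) | w <- iota 0 (nI ^ (L * b))])].
Proof.
have [|||M hM] := @decoder_machine rprec (fun n => nI ^ (L * rprec n))%N
    (fun n w => orbit_point (rprec n) (rdigit n 1) (rbranch n) w).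
- exact: computable_rprec.
- move=> V f cf; apply: computable_exp; first exact: computable_const.
  by apply: computable_mul; [exact: computable_const | exact: computable_rprec].
- exact: computable_orbit_point.
exists M => b W a0 K pos neg bs0 uK Wb ab Kb keyb posb negb.
set base := (2 ^ (b + s0))%N in Wb ab Kb keyb posb negb *.
pose ds := [:: W; a0; size K] ++
  flatten [seq key :: mkseq (pos key) m.+1 ++ mkseq (neg key) m.+1 | key <- K].
pose c := digits_value base ds.
pose n := (c.*2.+1 * base)%N.
(* The odd factor does not affect the valuation, so the digit width can be recovered from [n]
   itself. *)
have ln : logn 2 n = (b + s0)%N.
  rewrite /n lognM ?expn_gt0 // pfactorK // -[RHS]add0n; congr (_ + _)%N.
  by apply/eqP; rewrite -leqn0 leqNgt logn_gt0 mem_primes /= dvdn2 /= odd_double.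
have size_block key : size (key :: mkseq (pos key) m.+1 ++ mkseq (neg key) m.+1) = esize.
  rewrite -[LHS]/((size (mkseq (pos key) m.+1 ++ mkseq (neg key) m.+1)).+1).
  by rewrite size_cat !size_mkseq /esize; lia.
have dsb : all (fun d => d < base)%N ds.
  rewrite all_cat; apply/andP; split; first by rewrite /= Wb ab Kb.
  apply/allP => d /flattenP[t /mapP[key keyK ->]].
  rewrite in_cons mem_cat => /or3P[/eqP ->|/mapP[j + ->]|/mapP[j + ->]]; rewrite ?mem_iota.
  - exact: keyb.
  - exact: posb.
  - exact: negb.
have dsize : size ds = (size K * esize + 3)%N.
  rewrite size_cat size_flatten /shape -map_comp (@eq_map _ _ _ (fun=> esize) size_block).
  by rewrite addnC; congr (_ + _)%N; elim: (K) => //= key K' ->.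
have rd j : rdigit n j = nth 0%N ds j.
  rewrite /rdigit ln -/base expnM -/base /n mulnK ?expn_gt0 // -addn1 -muln2.
  by rewrite divnMDl // addn0 digits_valueE.
have rp : rprec n = b by rewrite /rprec ln addnK.
have rde p q : (p < size K)%N -> (q < esize)%N -> rdigit n (3 + (p * esize + q)) =
    nth 0%N (nth 0%N K p :: mkseq (pos (nth 0%N K p)) m.+1 ++ mkseq (neg (nth 0%N K p)) m.+1) q.
  move=> pK qE; rewrite rd /ds nth_cat /= addKn nth_flatten_blocks ?size_map //.
    by rewrite (nth_map 0%N).
  by apply/allP => t /mapP[key _ ->]; rewrite size_block.
have re p : (p < size K)%N -> entry n (nth 0%N K p) = (3 + p * esize)%N.
  move=> pK; rewrite /entry (rd 2) /=.
  have H k : (k <= size K)%N -> iteri k (fun p0 acc => if rdigit n (3 + p0 * esize)%N == nth 0%N K p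
      then (3 + p0 * esize)%N else acc) 0%N = if (p < k)%N then (3 + p * esize)%N else 0%N.
    elim: k => //= k IH kK; rewrite IH ?(ltnW kK) //.
    have E0 : (0 < esize)%N by rewrite /esize; lia.
    rewrite -[(k * esize)%N]addn0 rde //= nth_uniq // addn0.
    have [->|kp] := eqVneq k p; first by rewrite ltnSn.
    by rewrite (_ : (p < k.+1)%N = (p < k)%N) //; lia.
  by rewrite H // pK.
exists (rbranch n), (bits ((size K * esize + 4) * (b + s0)) n); split.
- move=> i a keyK; rewrite /rbranch rp (rd 0%N) /=.
  set key := cell_key W i a in keyK *.
  have pK : (index key K < size K)%N by rewrite index_mem.
  have := re _ pK; rewrite nth_index // => ->.
  have ext cc cc' T : (forall j, (j < m.+1)%N -> cc j = cc' j) ->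
      scaled_sum b T cc = scaled_sum b T cc'.
    by move=> e; apply: eq_bigr => j _; rewrite e.
  congr (minn _ ((_ - _) %/ _)); apply: ext => j jm.
    rewrite -!addnA rde ?index_mem //; last by rewrite /esize; lia.
    rewrite nth_index // -[LHS]/(nth 0%N (mkseq (pos key) m.+1 ++ mkseq (neg key) m.+1) j).
    by rewrite nth_cat size_mkseq jm nth_mkseq.
  rewrite -!addnA rde ?index_mem //; last by rewrite /esize; lia.
  rewrite nth_index // -[LHS]/(nth 0%N (mkseq (pos key) m.+1 ++ mkseq (neg key) m.+1) (m.+1 + j)).
  by rewrite nth_cat size_mkseq ltnNge leq_addr /= addKn nth_mkseq.
- by rewrite size_map size_iota; lia.
- have nb : (n < 2 ^ ((size K * esize + 4) * (b + s0)).+1)%N.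
    have := digits_value_lt dsb; rewrite -/c dsize => cb.
    have -> : (2 ^ ((size K * esize + 4) * (b + s0)).+1 = 2 * base ^ (size K * esize + 3) * base)%N.
      by rewrite expnS mulnC [(_ * (b + s0))%N]mulnC expnM -/base addnS expnSr mulnC mulnA.
    by rewrite /n ltn_pmul2r ?expn_gt0 //; lia.
  have := hM (bits ((size K * esize + 4) * (b + s0)) n).
  by rewrite binval_bits // /dyadic_list rp (rd 1%N).
Qed.

End Records.


(** * Taylor estimates *)

Section Derivatives.
Variable R : realType.
Implicit Types (f g : R -> R) (x y : R).

(* Differentiability at [x] relative to [A], in the form that does not divide. *)
Definition diff_at (A : set R) f (l x : R) : Prop :=
  forall e, 0 < e -> exists2 d, 0 < d &
    forall y, A y -> `|y - x| < d -> `|f y - f x - l * (y - x)| <= e * `|y - x|.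

Lemma deriv01P f g :
  deriv01 f g <-> forall x, x \in `[0, 1] -> diff_at [set` `[0, 1]] f (g x) x.
Proof.
have quot l x y : y != x ->
    `|f y - f x - l * (y - x)| = `|l - (f y - f x) / (y - x)| * `|y - x|.
  move=> yx; have yx0 : y - x != 0 by rewrite subr_eq0.
  rewrite -normrM -[LHS]normrN; congr `|_|; rewrite mulrBl divfK //; ring.
split=> fg x x01.
- move=> e e0; have /cvgrPdist_le /(_ e e0) := fg x x01.
  rewrite !near_withinE => /nbhs_ballP[d /= d0 H]; exists d => // y y01 yx.
  have [->|neq] := eqVneq y x; first by rewrite !subrr mulr0 subr0 normr0 mulr0.
  rewrite quot // ler_wpM2r //; apply: H => //=.
  by rewrite /ball /= distrC.
- apply/cvgrPdist_le => e e0; rewrite !near_withinE; apply/nbhs_ballP.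
  have [d d0 H] := fg x x01 e e0; exists d => //= y yx neq y01.
  rewrite -(ler_pM2r (x := `|y - x|)) ?normr_gt0 ?subr_eq0 // -quot //.
  by apply: H => //; rewrite distrC.
Qed.

Lemma is_derive_diff_at f l x : is_derive x 1 f l -> diff_at setT f l x.
Proof.
move=> df e e0.
have /cvgrPdist_le /(_ e e0) : (fun h => h^-1 *: ((f \o shift x) (h *: (1 : R)) - f x)) @ 0^' --> l.
  by have := @ex_derive _ _ _ _ _ _ _ df; rewrite /derivable -[l](@derive_val _ _ _ _ _ _ _ df).
rewrite !near_withinE => /nbhs_ballP[d /= d0 H]; exists d => // y _ yx.
have [->|neq] := eqVneq y x; first by rewrite !subrr mulr0 subr0 normr0 mulr0.
have yx0 : y - x != 0 by rewrite subr_eq0.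
have := H (y - x); rewrite /ball /= sub0r normrN => /(_ yx yx0).
rewrite /shift /= [_ *: 1]mulr1 subrK => le.
rewrite (_ : _ - _ = - ((l - (y - x)^-1 *: (f y - f x)) * (y - x))).
  by rewrite normrN normrM ler_wpM2r.
by rewrite -[_ *: _]/(_ * _); field.
Qed.

Lemma diff_at_is_derive A f l x : nbhs x A -> diff_at A f l x -> is_derive x 1 f l.
Proof.
move=> /nbhs_ballP[r /= r0 rA] df.
suff cv : (fun h => h^-1 *: ((f \o shift x) (h *: (1 : R)) - f x)) @ 0^' --> l.
  by apply: DeriveDef; [apply/cvg_ex; exists l | exact: cvg_lim].
apply/cvgrPdist_le => e e0; rewrite !near_withinE; apply/nbhs_ballP.
have [d d0 H] := df e e0; exists (Num.min d r); first by rewrite /= lt_min d0.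
move=> h /=; rewrite /ball /= sub0r normrN lt_min => /andP[hd hr] h0.
rewrite /shift /= [_ *: 1]mulr1.
have := H (h + x); rewrite addrK => /(_ _ hd) le.
rewrite -(ler_pM2r (x := `|h|)) ?normr_gt0 // -normrM mulrBl.
rewrite -[_ *: _]/(_ * _) mulrAC mulVf // mul1r distrC; apply: le.
by apply: rA; rewrite /ball /= opprD addrCA subrr addr0 normrN.
Qed.

Lemma diff_at_continuous A f l x : diff_at A f l x ->
  forall e, 0 < e -> exists2 d, 0 < d & forall y, A y -> `|y - x| < d -> `|f y - f x| < e.
Proof.
move=> df e e0; have [d d0 H] := df 1 ltr01.
have l1 : 0 < `|l| + 1 by rewrite ltr_pwDr.
exists (Num.min d (e / (`|l| + 1))); first by rewrite lt_min d0 divr_gt0.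
move=> y Ay; rewrite lt_min => /andP[yd]; rewrite ltr_pdivlMr // => ye.
have := H y Ay yd; rewrite mul1r => le; apply: le_lt_trans ye.
have : `|f y - f x| <= `|f y - f x - l * (y - x)| + `|l * (y - x)|.
  by rewrite -{1}(subrK (l * (y - x)) (f y - f x)) ler_normD.
rewrite normrM; lra.
Qed.

Lemma deriv01_continuous f g : deriv01 f g -> {within `[0, 1], continuous f}.
Proof.
move=> /deriv01P df; apply/continuous_within_itvP => //.
have H x e : x \in `[0, 1] -> 0 < e ->
    exists2 d, 0 < d & forall y, y \in `[0, 1] -> `|y - x| < d -> `|f y - f x| < e.
  move=> x01 e0; have [d d0 h] := diff_at_continuous (df x x01) e0.
  by exists d => // y; apply: h.
split.
- move=> x x01; apply/cvgrPdist_lt => e e0.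
  have [d d0 h] := H x e (subset_itv_oo_cc x01) e0.
  near=> y; rewrite distrC; apply: h.
    by apply: subset_itv_oo_cc; near: y; exact: near_in_itvoo.
  by near: y; apply/nbhs_ballP; exists d => //= t; rewrite /ball /= distrC.
- apply/cvgrPdist_lt => e e0.
  have [|d d0 h] := H 0 e _ e0; first by rewrite in_itv /= lexx ler01.
  near=> y; rewrite distrC; apply: h.
    by rewrite in_itv /=; apply/andP; split; near: y; [exact: nbhs_right_ge | exact: nbhs_right_le].
  rewrite subr0 gtr0_norm; near: y; [exact: nbhs_right_lt | exact: nbhs_right_gt].
- apply/cvgrPdist_lt => e e0.
  have [|d d0 h] := H 1 e _ e0; first by rewrite in_itv /= lexx ler01.
  near=> y; rewrite distrC; apply: h.
    by rewrite in_itv /=; apply/andP; split; near: y; [exact: nbhs_left_ge | exact: nbhs_left_le].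
  rewrite distrC gtr0_norm ?subr_gt0; last by near: y; exact: nbhs_left_lt.
  by rewrite ltrBlDr -ltrBlDl; near: y; apply: nbhs_left_gt; rewrite ltrBlDr ltrDl.
Unshelve. all: by end_near. Qed.

(** The condition [|t - x| <= |y - x|] covers both orders of [x] and [y], and suits bounds on [g] by
    powers of the distance to [x]. *)
Lemma deriv01_mvt f g K x y : deriv01 f g -> x \in `[0, 1] -> y \in `[0, 1] ->
  (forall t, t \in `[0, 1] -> `|t - x| <= `|y - x| -> `|g t| <= K) ->
  `|f y - f x| <= K * `|y - x|.
Proof.
have main a b : a <= b -> deriv01 f g -> a \in `[0, 1] -> b \in `[0, 1] ->
    (forall t, a <= t -> t <= b -> `|g t| <= K) -> `|f b - f a| <= K * `|b - a|.
  move=> ab dh a01 b01 hK.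
  have [z zab| |c /itvP cab ->] := @MVT_segment R f g a b ab.
  - have z01 : z \in `]0, 1[.
      by move: zab a01 b01; rewrite !in_itv /= => /andP[? ?] /andP[? ?] /andP[? ?]; lra.
    apply: (@diff_at_is_derive [set` `[0, 1]]).
      by near=> t; apply: subset_itv_oo_cc; near: t; exact: near_in_itvoo.
    exact: (deriv01P _ _).1 dh z (subset_itv_oo_cc z01).
  - apply: continuous_subspaceW (deriv01_continuous dh).
    by move=> t /=; move: a01 b01; rewrite !in_itv /=; lra.
  - by rewrite normrM ler_wpM2r // hK // cab.
move=> dg x01 y01 gK; have [xy|/ltW yx] := leP x y.
  apply: main => // t xt ty; apply: gK.
    by move: x01 y01; rewrite !in_itv /=; lra.
  by rewrite !ger0_norm ?subr_ge0 ?(le_trans xt ty) //; lra.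
rewrite distrC (distrC y); apply: main => // t xt ty; apply: gK.
  by move: x01 y01; rewrite !in_itv /=; lra.
by rewrite !ler0_norm ?subr_le0 ?(le_trans xt ty) //; lra.
Unshelve. all: by end_near. Qed.

Lemma diff_at_sub A f f' l l' x :
  diff_at A f l x -> diff_at A f' l' x -> diff_at A (fun t => f t - f' t) (l - l') x.
Proof.
move=> df df' e e0; have e2 : 0 < e / 2 by rewrite divr_gt0.
have [d d0 H] := df _ e2; have [d' d'0 H'] := df' _ e2.
exists (Num.min d d'); first by rewrite lt_min d0.
move=> y Ay; rewrite lt_min => /andP[/(H y Ay) le /(H' y Ay) le'].
rewrite (_ : _ - _ = (f y - f x - l * (y - x)) - (f' y - f' x - l' * (y - x))); last by ring.
apply: le_trans (ler_normB _ _) _; lra.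
Qed.

Lemma diff_at_horner A (p : {poly R}) (a x : R) :
  diff_at A (fun t => p.[t - a]) (p^`()).[x - a] x.
Proof.
move=> e e0; have [d d0 H] := is_derive_diff_at (is_derive_poly p (x - a)) e0.
exists d => // y _ yx; have := H (y - a) I.
by rewrite (_ : y - a - (x - a) = y - x); [exact | ring].
Qed.

Definition taylor_poly (g : nat -> R -> R) (i n : nat) (x : R) : {poly R} :=
  \poly_(j < n.+1) (g (i + j)%N x / j`!%:R).

Lemma deriv_taylor_poly (g : nat -> R -> R) i n x :
  (taylor_poly g i n.+1 x)^`() = taylor_poly g i.+1 n x.
Proof.
apply/polyP => j; rewrite coef_deriv !coef_poly ltnS; case: ifP => _; last by rewrite mul0rn.
rewrite addSnnS factS natrM -[_ / _ *+ _]mulr_natr.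
have j0 : (j.+1%:R : R) != 0 by rewrite pnatr_eq0.
have f0 : (j`!%:R : R) != 0 by rewrite pnatr_eq0 -lt0n fact_gt0.
move: (j.+1%:R) (j`!%:R) j0 f0 => u v u0 v0; field.
by rewrite u0 v0.
Qed.

Lemma horner_taylor_poly (g : nat -> R -> R) i n x y :
  (taylor_poly g i n x).[y] = \sum_(j < n.+1) g (i + j)%N x / j`!%:R * y ^+ j.
Proof. by rewrite horner_poly. Qed.

(** Induction downwards from the top derivative. Its Hölder bound, or mere boundedness when [k] is
    an integer and the exponent [k - m] is 0, gains one power of [|y - x|] at each use of the mean
    value inequality. The factorials that integration would gain are given away, so one constant
    serves every order. *)
Lemma class_C_taylor (k : R) f : 1 <= k -> class_C k f ->
  exists (g : nat -> R -> R) (H : R),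
  [/\ 0 <= H,
      forall j, (j <= Num.truncn k)%N -> {in `[0, 1], forall x, `|g j x| <= H} &
      {in `[0, 1] &, forall x y,
        `|f y - \sum_(j < (Num.truncn k).+1) g j x / j`!%:R * (y - x) ^+ j|
        <= H * `|y - x| `^ k}].
Proof.
move=> k1 [g [g0 dg gm]]; set m := Num.truncn k in dg gm *.
have mk : m%:R <= k by rewrite truncn_le; lra.
have [H0 gmH] : exists H0, {in `[0, 1], forall x, `|g m x| <= H0}.
  case: ifP gm => [_ cg|_ [H hH]].
    have := @continuous_compact _ _ (g m) _ cg (@segment_compact R 0 1).
    move=> /compact_bounded[M [_ HM]]; exists (M + 1) => x x01.
    by apply: (HM (M + 1)); [rewrite ltrDl | exists x].
  exists (`|g m 0| + `|H|) => x x01.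
  have z01 : 0 \in `[0, 1 : R] by rewrite in_itv /= lexx ler01.
  have := hH x 0 x01 z01; rewrite subr0 => le.
  have le1 : `|x| `^ (k - m%:R) <= 1.
    have /andP[x0 x1] : 0 <= x <= 1 by move: x01; rewrite in_itv.
    apply: (@le_trans _ _ (1 `^ (k - m%:R))); last by rewrite powR1.
    rewrite ge0_ler_powR ?nnegrE ?subr_ge0 //.
    by rewrite ger0_norm.
  have := ler_distD (g m 0) (g m x) 0; rewrite !subr0 => le2.
  have : H * `|x| `^ (k - m%:R) <= `|H|.
    apply: le_trans (ler_wpM2r (powR_ge0 _ _) (ler_norm H)) _.
    by rewrite -[leRHS]mulr1 ler_wpM2l.
  lra.
have H00 : 0 <= H0 by apply: le_trans (gmH 0 _); rewrite ?normr_ge0 // in_itv /= lexx ler01.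
have [H1 H1H0 gb] : exists2 H1, H0 <= H1 & forall j, (j <= m)%N -> {in `[0, 1], forall x, `|g j x| <= H1}.
  suff: forall i, (i <= m)%N -> exists2 H1, H0 <= H1 &
      forall j, (m - i <= j <= m)%N -> {in `[0, 1], forall x, `|g j x| <= H1}.
    by move=> /(_ m (leqnn m)); rewrite subnn => -[H1 h01 h]; exists H1.
  elim=> [_|i IH im]; first by exists H0 => // j; rewrite subn0 -eqn_leq => /eqP <-.
  have [H1 h01 h] := IH (ltnW im).
  exists (H1 + `|g (m - i.+1)%N 0|) => [|j /andP[mj jm] x x01]; first by rewrite ler_wpDr.
  have [ij|ij] := leqP (m - i) j; first by apply: ler_wpDr; rewrite // h ?ij.
  have ejm : j = (m - i.+1)%N by lia.
  have z01 : 0 \in `[0, 1 : R] by rewrite in_itv /= lexx ler01.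
  have := @deriv01_mvt (g j) (g j.+1) H1 0 x (dg j _) z01 x01 _.
  rewrite -ejm subr0 => le.
  have {}le : `|g j x - g j 0| <= H1 * `|x|.
    by apply: le => [|t t01 _]; [lia | apply: h => //; lia].
  have x1 : `|x| <= 1 by move: x01; rewrite in_itv /= => /andP[x0 x1]; rewrite ger0_norm.
  have H10 : 0 <= H1 by apply: le_trans h01.
  have : H1 * `|x| <= H1 by rewrite -[leRHS]mulr1 ler_wpM2l.
  have := ler_distD (g j 0) (g j x) 0; rewrite !subr0; lra.
have [H2 H1H2 base] : exists2 H2, H1 <= H2 & {in `[0, 1] &, forall x y,
    `|g m y - g m x| <= H2 * `|y - x| `^ (k - m%:R)}.
  case: ifP gm => [/eqP km _|_ [H hH]].
    exists (H1 + H1) => [|x y x01 y01]; first by rewrite lerDl (le_trans H00).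
    rewrite km subrr powRr0 mulr1; apply: le_trans (ler_normB _ _) _.
    by apply: lerD; apply: gb.
  exists (Num.max H H1) => [|x y x01 y01]; first by rewrite le_max lexx orbT.
  by apply: le_trans (hH y x y01 x01) _; rewrite ler_wpM2r ?powR_ge0 // le_max lexx.
have H20 : 0 <= H2 by lra.
exists g, H2; split=> // [j jm x x01|x y x01 y01]; first exact: le_trans (gb j jm x x01) _.
suff: forall i, (i <= m)%N -> {in `[0, 1], forall y,
    `|g (m - i)%N y - (taylor_poly g (m - i)%N i x).[y - x]| <= H2 * `|y - x| `^ (k - m%:R + i%:R)}.
  move=> /(_ m (leqnn m) y y01); rewrite subnn horner_taylor_poly subrK g0 //.
elim=> [_ z z01|i IH im z z01].
  by rewrite subn0 horner_taylor_poly big_ord1 addn0 fact0 divr1 expr0 mulr1 addr0 base.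
(* [G j] is the Taylor remainder at [x] of the derivative of order [m - j]; the derivative of
   [G i.+1] is [G i], and [G i.+1] vanishes at [x]. *)
pose G j t := g (m - j)%N t - (taylor_poly g (m - j)%N j x).[t - x].
have dG : deriv01 (G i.+1) (G i).
  apply/deriv01P => t t01; rewrite /G -(subnSK im).
  rewrite -deriv_taylor_poly; apply: diff_at_sub; last exact: diff_at_horner.
  by apply: (deriv01P _ _).1 => //; apply: dg; rewrite subnSK ?leq_subr.
have Gx : G i.+1 x = 0.
  rewrite /G horner_taylor_poly subrr big_ord_recl addn0 fact0 divr1 expr0 mulr1.
  by rewrite big1 ?addr0 ?subrr // => j _; rewrite /= expr0n /= mulr0.
have := @deriv01_mvt _ _ (H2 * `|z - x| `^ (k - m%:R + i%:R)) x z dG x01 z01 _.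
rewrite Gx subr0 -/(G i.+1 z) => le; apply: le_trans (le _) _ => [t t01 tz|].
  apply: le_trans (IH (ltnW im) t t01) _; rewrite ler_wpM2l // ge0_ler_powR ?nnegrE //.
  by rewrite addr_ge0 // subr_ge0.
have [->|zx] := eqVneq z x; first by rewrite subrr normr0 mulr0 mulr_ge0 ?powR_ge0.
rewrite -mulrA ler_wpM2l // -{2}[`|z - x|]powRr1 // -powRD; last first.
  by rewrite normr_eq0 subr_eq0 zx implybT.
by rewrite -addrA -natr1.
Qed.

End Derivatives.


(** * Rounded iteration *)

Section Rounding.
Variable R : realType.

(** Clipping to the interval from 0 to [N] does not increase the distance to a point [y] of it, and
    the integer part costs at most 1. *)
Lemma truncated_quotient_close (U V d N : nat) (y : R) : (0 < d)%N -> 0 <= y <= N%:R ->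
  `|(minn N ((U - V) %/ d))%:R - y| <= `|(U%:R - V%:R) / d%:R - y| + 1.
Proof.
move=> d0 /andP[y0 yN].
have dR : 0 < d%:R :> R by rewrite ltr0n.
have [UV|VU] := leqP U V.
  have -> : (U - V = 0)%N by lia.
  rewrite div0n minn0 sub0r normrN (ger0_norm y0).
  have s0 : (U%:R - V%:R) / d%:R <= 0 :> R.
    by rewrite pmulr_lle0 ?invr_gt0 // subr_le0 ler_nat.
  rewrite ler0_norm; lra.
set s := _ / _; set q := ((U - V) %/ d)%N.
have [qs sq] : q%:R <= s /\ s < q%:R + 1.
  rewrite /s -natrB ?(ltnW VU) // ler_pdivlMr // ltr_pdivrMr // natr1 -!natrM ler_nat ltr_nat.
  by rewrite leq_divM ltn_ceil.
have [qN|Nq] := leqP q N.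
  have := ler_distD s q%:R y.
  have : `|q%:R - s| <= 1 by rewrite ler0_norm; lra.
  lra.

have : N%:R < q%:R :> R by rewrite ltr_nat.
move=> ?; rewrite !ger0_norm; lra.
Qed.

(** Applied to [c] and to [- c], it gives the two natural numbers stored for a signed coefficient;
    one of them is 0. *)
Definition pos_part (N : nat) (c : R) : nat := Num.truncn (N%:R * Num.max c 0).

Lemma pos_part_diff (N : nat) (c : R) :
  `|(pos_part N c)%:R - (pos_part N (- c))%:R - N%:R * c| <= 1.
Proof.
wlog c0 : c / 0 <= c.
  move=> H; have [/H //|/ltW c0] := leP 0 c.
  have := H (- c); rewrite oppr_ge0 opprK => /(_ c0).
  by rewrite -normrN; congr (_ <= _); congr `|_|; ring.
rewrite /pos_part (max_l c0) max_r ?oppr_le0 // mulr0 truncn0 subr0.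
have Nc : 0 <= N%:R * c by rewrite mulr_ge0.
have /andP[le lt] := truncn_itv Nc.
rewrite ler0_norm; rewrite -?natr1 in lt *; lra.
Qed.

Lemma pos_part_lt (N s0 : nat) (c : R) : (0 < N)%N -> `|c| < (2 ^ s0)%:R ->
  (pos_part N c < 2 ^ s0 * N)%N.
Proof.
move=> N0 cs; rewrite truncn_lt_nat; last first.
  by rewrite mulr_ge0 // le_max lexx orbT.
rewrite natrM mulrC ltr_pM2r ?ltr0n //; apply: le_lt_trans cs.
by rewrite ge_max normr_ge0 ler_norm.
Qed.

Lemma scaled_sumE (m b T : nat) (c : nat -> nat) :
  (scaled_sum m b T c)%:R / ((2 ^ b) ^ m)%:R =
  \sum_(j < m.+1) (c j)%:R * (T%:R / (2 ^ b)%:R) ^+ j :> R.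
Proof.
rewrite natr_sum mulr_suml; apply: eq_bigr => j _.
have N0 : 2 ^+ b != 0 :> R by rewrite expf_neq0.
have jm : (j <= m)%N by rewrite -ltnS.
rewrite !natrM !natrX; move: (2 ^+ b) N0 => N N0.
have -> : N ^+ m = N ^+ (m - j) * N ^+ j by rewrite -exprD subnK.
rewrite expr_div_n.
have Nj : N ^+ j != 0 by rewrite expf_neq0.
have Nmj : N ^+ (m - j) != 0 by rewrite expf_neq0.
field; by rewrite Nj Nmj.
Qed.

(** Each of the [m.+1] rounded coefficients costs at most 1, because [T / 2 ^ b] is at most 1, and
    the final quotient costs one more. *)
Lemma poly_value_err (m b T : nat) (c : nat -> R) (y : R) :
  (T <= 2 ^ b)%N -> 0 <= y <= (2 ^ b)%:R ->
  `|(poly_value m b T (fun j => pos_part (2 ^ b) (c j)) (fun j => pos_part (2 ^ b) (- c j)))%:R - y|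
  <= (2 ^ b)%:R * `|\sum_(j < m.+1) c j * (T%:R / (2 ^ b)%:R) ^+ j - y / (2 ^ b)%:R| + m.+2%:R.
Proof.
move=> TN yN; have N0 : 0 < (2 ^ b)%:R :> R by rewrite ltr0n expn_gt0.
apply: le_trans (truncated_quotient_close _ _ _ yN) _; first by rewrite !expn_gt0.
rewrite mulrBl !scaled_sumE -[m.+2%:R]natr1 addrA lerD2r -sumrB.
set t := T%:R / _; have t01 : 0 <= t <= 1.
  by rewrite divr_ge0 // ler_pdivrMr // mul1r ler_nat.
set S := \sum_(j < _) c j * t ^+ j.
apply: le_trans (ler_distD ((2 ^ b)%:R * S) _ _) _; rewrite addrC; apply: lerD; last first.
  have -> : (2 ^ b)%:R * S - y = (2 ^ b)%:R * (S - y / (2 ^ b)%:R).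
    by field; rewrite gt_eqF.
  by rewrite normrM gtr0_norm.
rewrite /S mulr_sumr -sumrB; apply: le_trans (ler_norm_sum _ _ _) _.
rewrite -[m.+1 in leRHS]card_ord -sum1_card natr_sum; apply: ler_sum => j _.
rewrite mulrA -mulrBl -mulrBl normrM -[leRHS]mulr1; apply: ler_pM => //.
  exact: pos_part_diff.
case/andP: t01 => t0 t1; rewrite normrX ger0_norm //; exact: exprn_ile1.
Qed.

(** The distance from [a / 2 ^ b] to the corner of its cell is at most [2 ^ - w], whose [k]-th power
    is at most [2 ^ - b] by [b <= w * k]. In units of [2 ^ - b] the Taylor remainder is thus at most
    [H], comparable to the rounding. *)
Lemma branch_err (k : R) (m b w : nat) (f : R -> R) (g : nat -> R -> R) (H : R) (a W : nat)
    (c : nat -> R) :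
  W = (2 ^ (b - w))%N -> c = (fun j => g j (((a %/ W) * W)%:R / (2 ^ b)%:R) / j`!%:R) ->
  0 <= k -> 0 <= H -> (w <= b)%N -> b%:R <= w%:R * k ->
  {in `[0, 1], forall x, 0 <= f x <= 1} ->
  {in `[0, 1] &, forall x y, `|f y - \sum_(j < m.+1) g j x / j`!%:R * (y - x) ^+ j|
        <= H * `|y - x| `^ k} -> (a <= 2 ^ b)%N ->
  `|(poly_value m b (a %% W) (fun j => pos_part (2 ^ b) (c j)) (fun j => pos_part (2 ^ b) (- c j)))%:R
     - (2 ^ b)%:R * f (a%:R / (2 ^ b)%:R)| <= H + m.+2%:R.
Proof.
move=> WE cE k0 H0 wb bwk f01 taylor aN.
have N0 : 0 < (2 ^ b)%:R :> R by rewrite ltr0n expn_gt0.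
have W0 : (0 < W)%N by rewrite WE expn_gt0.
pose x : R := ((a %/ W) * W)%:R / (2 ^ b)%:R; set z := a%:R / (2 ^ b)%:R.
have aE := divn_eq a W.
have x01 : x \in `[0, 1].
  rewrite in_itv /= divr_ge0 //= ler_pdivrMr // mul1r ler_nat; lia.
have z01 : z \in `[0, 1].
  by rewrite in_itv /= divr_ge0 //= ler_pdivrMr // mul1r ler_nat.
have zx : z - x = (a %% W)%:R / (2 ^ b)%:R.
  by rewrite /z /x -mulrBl {1}aE natrD addrAC subrr add0r.
have /andP[fz0 fz1] := f01 _ z01.
apply: le_trans (@poly_value_err m b (a %% W) c _ _ _) _.
- by apply: leq_trans aN; exact: leq_mod.
- by rewrite mulr_ge0 //= -[leRHS]mulr1 ler_wpM2l.
rewrite lerD2r cE -/x -zx mulrAC mulfV ?gt_eqF // mul1r distrC.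
apply: le_trans (ler_wpM2l (ltW N0) (taylor _ _ x01 z01)) _.
rewrite mulrCA -[leRHS]mulr1 ler_wpM2l // -ler_pdivlMl // mulr1.
have zxw : `|z - x| <= (2^-1) ^+ w.
  rewrite zx ger0_norm ?divr_ge0 // ler_pdivrMr //.
  rewrite exprVn ler_pdivlMl ?exprn_gt0 // -natrX -natrM ler_nat.
  apply: leq_trans (leq_mul (leqnn _) (ltnW (ltn_pmod a W0))) _.
  by rewrite WE -expnD subnKC.
apply: (@le_trans _ _ (((2^-1) ^+ w) `^ k)).
  by rewrite ge0_ler_powR ?nnegrE // exprn_ge0 // invr_ge0.
rewrite -powR_mulrn ?invr_ge0 // -powRrM natrX -exprVn -powR_mulrn ?invr_ge0 //.
by apply: ger_powR => //; rewrite invr_gt0 ltr0n /= invf_le1 ?ler1n.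
Qed.

End Rounding.


(** * Hausdorff distance, addresses and orbits *)

Section HausdorffDistance.
Variable R : realType.
Implicit Types F C : set R.

Lemma hausdorff_dist_le F C (r : R) : 0 < r ->
  (forall x, C x -> exists2 y, F y & `|x - y| < r) ->
  (forall y, F y -> exists2 x, C x & `|y - x| < r) ->
  (hausdorff_dist F C <= r%:E)%E.
Proof.
move=> r0 CF FC; rewrite /hausdorff_dist ge_max.
apply/andP; split; apply: ge_ereal_sup => _ [x Ax <-].
  have [y Fy xy] := CF x Ax; apply: (@le_trans _ _ (edist (x, y))).
    by apply: ereal_inf_lbound; exists y.
  exact: edist_fin.
have [y Fy xy] := FC x Ax; apply: (@le_trans _ _ (edist (x, y))).
  by apply: ereal_inf_lbound; exists y.
exact: edist_fin.
Qed.

Lemma hausdorff_dist_lt F C (r : R) : (hausdorff_dist F C < r%:E)%E ->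
  (forall x, C x -> exists2 y, F y & `|x - y| < r) /\
  (forall y, F y -> exists2 x, C x & `|y - x| < r).
Proof.
have near (A B : set R) : (ereal_sup [set edist_inf A x | x in B] < r%:E)%E ->
    forall x, B x -> exists2 y, A y & `|x - y| < r.
  move=> lt x Bx.
  have /ereal_inf_lt[_ [y Ay <-]] : (edist_inf A x < r%:E)%E.
    by apply: le_lt_trans lt; apply: ereal_sup_ubound; exists x.
  by move=> /edist_lt_ball; exists y.
by rewrite /hausdorff_dist gt_max => /andP[/near h1 /near h2].
Qed.

End HausdorffDistance.

Section Orbits.
Variable R : realType.

Lemma eq_iteri (T : Type) n (f g : nat -> T -> T) x :
  (forall t, (t < n)%N -> f t =1 g t) -> iteri n f x = iteri n g x.
Proof.
elim: n => //= n IH fg; rewrite fg // IH // => t tn; exact: fg (leqW tn).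
Qed.

Lemma word_of_digits (q n : nat) (d : nat -> nat) : (0 < q)%N -> (forall t, (d t < q)%N) ->
  exists2 w, (w < q ^ n)%N & forall t, (t < n)%N -> (w %/ q ^ t %% q)%N = d t.
Proof.
move=> q0 dq; have ds : all (fun c => c < q)%N (mkseq d n) by apply/allP => _ /mapP[j _ ->].
exists (digits_value q (mkseq d n)); first by rewrite -[n in (_ ^ n)%N](size_mkseq d) digits_value_lt.
by move=> t tn; rewrite digits_valueE // nth_mkseq.
Qed.

Variables (I : finType) (phi : I -> R -> R) (C : set R).
Hypothesis genC : generates phi C.

Lemma generates_map i x : C x -> C (phi i x).
Proof. by case: genC => _ _ _ E Cx; rewrite E; exists i => //; exists x. Qed.

Lemma generates_iteri n (d : nat -> I) c : C c -> C (iteri n (fun t => phi (d t)) c).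
Proof. by move=> Cc; elim: n => //= n; exact: generates_map. Qed.

Lemma generates_address n (i0 : I) c : C c ->
  exists (d : nat -> I) c', C c' /\ c = iteri n (fun t => phi (d t)) c'.
Proof.
elim: n c => [|n IH] c Cc; first by exists (fun=> i0), c.
have [_ _ _ E] := genC.
have [i _ [c1 Cc1 <-]] : (\bigcup_(i in setT) phi i @` C) c by rewrite -E.
have [d [c' [Cc' ->]]] := IH c1 Cc1.
exists (fun t => if t == n then i else d t), c'; split => //=.
by rewrite eqxx; congr (phi i _); apply: eq_iteri => t tn x; rewrite ltn_eqF.
Qed.

Lemma iteri_contraction (rho : R) n (d : nat -> I) c c' : 0 <= rho ->
  (forall i, {in `[0, 1] &, forall x y, `|phi i x - phi i y| <= rho * `|x - y|}) ->
  C c -> C c' ->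
  `|iteri n (fun t => phi (d t)) c - iteri n (fun t => phi (d t)) c'| <= rho ^+ n * `|c - c'|.
Proof.
move=> rho0 lip Cc Cc'; have [_ _ C01 _] := genC.
elim: n => [|n IH]; first by rewrite expr0 mul1r.
apply: le_trans (lip _ _ _ _ _) _; try exact/C01/generates_iteri.
by rewrite exprS -mulrA ler_wpM2l.
Qed.

End Orbits.

Lemma record_size_bound (p x S n e s b : nat) : (x <= (S * n * e + 5) * (b + s))%N ->
  (p + x <= (p + (n * e + 5) * s.+1) * S.+1 * b.+1)%N.
Proof.
move=> le; apply: leq_trans (leq_add (leqnn _) le) _.
have h1 : (S * n * e + 5 <= (n * e + 5) * S.+1)%N by nia.
have h2 : (b + s <= s.+1 * b.+1)%N by nia.
apply: leq_trans (leq_add (leqnn _) (leq_mul h1 h2)) _.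
move: (n * e + 5)%N => D; rewrite -[leqRHS]mulnA mulnDl; apply: leq_add.
  by rewrite leq_pmulr // muln_gt0.
by rewrite -!mulnA (mulnCA S.+1).
Qed.

(** The list [Q] must contain every grid point within [E / 2 ^ w] of [C]. This is exactly what keeps
    the rounded orbit defined: as long as it shadows a true orbit, the corner of its cell is that
    close to [C], so the next Taylor polynomial is available. *)
Lemma program_at_scale (R : realType) (U : machine) (hU : universal U) (k : R) (I : finType)
    (phi : I -> R -> R) (C : set R) :
  1 <= k -> ifs phi -> (forall i, class_C k (phi i)) -> generates phi C ->
  exists (E : R) (A : nat), [/\ 1 <= E,
    forall (b w : nat) (Q : seq nat), (w <= b)%N -> b%:R <= w%:R * k -> uniq Q ->
      {in Q, forall q, (q <= 2 ^ w)%N} ->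
      (forall q c, (q <= 2 ^ w)%N -> C c -> `|q%:R / (2 ^ w)%:R - c| <= E / (2 ^ w)%:R -> q \in Q) ->
      exists P F, [/\ produces U P F, (hausdorff_dist F C <= (E / (2 ^ b)%:R)%:E)%E &
        (size P <= A * (size Q).+1 * b.+1)%N] & True].
Proof.
move=> k1 [cardI phi01 _ [rho [rho0 rho1 lip]] _] Ck genC.
set m := Num.truncn k.
have [i0] : exists i0 : I, True by move: cardI => /ltnW /card_gt0P[i0 _]; exists i0.
move=> _; pose nI := #|I|.
have nI0 : (0 < nI)%N by exact: ltnW.
pose ix (n : nat) : I := nth i0 (enum I) n.
have /choice[gH hgH] : forall i, exists p : (nat -> R -> R) * R, [/\ 0 <= p.2,
      forall j, (j <= m)%N -> {in `[0, 1], forall x, `|p.1 j x| <= p.2} &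
      {in `[0, 1] &, forall x y,
        `|phi i y - \sum_(j < m.+1) p.1 j x / j`!%:R * (y - x) ^+ j|
        <= p.2 * `|y - x| `^ k}].
  by move=> i; have [g [H [H0 Hb HT]]] := class_C_taylor k1 (Ck i); exists (g, H).
pose H := \sum_i (gH i).2.
have HH i : (gH i).2 <= H.
  rewrite /H (bigD1 i) //= lerDl sumr_ge0 // => j _; by have [] := hgH j.
have H0 : 0 <= H by apply: le_trans (HH i0); have [] := hgH i0.
(* [L] steps halve distances, so [L * b] steps make the choice of the starting point matter by at
   most [2 ^ - b]. *)
have [L rhoL] : exists L : nat, rho ^+ L <= 2^-1.
  have := @cvg_geometric R 1 rho; rewrite ger0_norm ?(ltW rho0) // => /(_ rho1).
  move=> /cvgr0Pnorm_lt /(_ 2^-1); rewrite invr_gt0 ltr0n => /(_ isT) [L _ hL].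
  exists L; have := hL L (leqnn L); rewrite /= mul1r.
  by move=> /ltW; apply: le_trans; exact: ler_norm.
(* Room for all digits in [b + s0] bits: keys and their number are at most [2 * nI * 2 ^ b], rounded
   coefficients at most [H * 2 ^ b]. *)
pose s0 := (2 * nI + (Num.truncn H).+1)%N.
have [M hM] := record_program nI m L s0.
have [p hp] := hU M.
pose E0 := H + m.+2%:R; have E00 : 0 <= E0 by rewrite addr_ge0.
(* [E0] bounds the error of one rounded step, and [E1] solves [E0 + rho * E1 <= E1]; the summand 1
   covers the rounding of the starting point. *)
pose E1 := 1 + E0 / (1 - rho).
have rho1' : 0 < 1 - rho by rewrite subr_gt0.
have E11 : 1 <= E1 by rewrite lerDl divr_ge0 // ltW.
have E1step : E0 + rho * E1 <= E1.
  have : E0 / (1 - rho) * (1 - rho) = E0 by rewrite divfK // gt_eqF.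
  rewrite /E1; move: (E0 / (1 - rho)) => z; lra.
have [c0 Cc0] : C !=set0 by case: genC.
have C01 c : C c -> c \in `[0, 1] by case: genC => _ _ + _; apply.
exists (E1 + 2), (size p + (nI * esize m + 5) * s0.+1)%N; split => //; first lra.
move=> b w Q wb bwk uQ Qle Qnear.
pose N := (2 ^ b)%N; pose W := (2 ^ (b - w))%N.
have N0 : 0 < N%:R :> R by rewrite ltr0n expn_gt0.
have W0 : (0 < W)%N by rewrite expn_gt0.
have WN : (2 ^ w * W = N)%N by rewrite -expnD subnKC.
have wR0 : 0 < (2 ^ w)%:R :> R by rewrite ltr0n expn_gt0.
have sN (c d : nat) : (c <= d)%N -> (d < 2 ^ s0)%N -> (c * N < 2 ^ (b + s0))%N.
  move=> cd ds; rewrite expnD mulnC ltn_pmul2l ?expn_gt0 //; exact: leq_ltn_trans ds.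
have s0_nI : (2 * nI < 2 ^ s0)%N.
  by apply: leq_ltn_trans (ltn_expl _ (ltnSn 1)); rewrite leq_addr.
have s0_H : H < (2 ^ s0)%:R.
  apply: (@lt_le_trans _ _ (Num.truncn H).+1%:R); first exact: truncnS_gt.
  rewrite ler_nat; apply: leq_trans (ltnW (ltn_expl s0 (ltnSn 1))); exact: leq_addl.
pose K := [seq (q * nI + i).+1 | q <- Q, i <- iota 0 nI].
pose c key j := (gH (ix (key.-1 %% nI)%N)).1 j ((key.-1 %/ nI * W)%:R / N%:R) / j`!%:R.
have keyE q i : (i < nI)%N -> ((q * nI + i) %/ nI = q)%N /\ ((q * nI + i) %% nI = i)%N.
  by move=> iI; rewrite divnMDl // divn_small // addn0 modnMDl modn_small.
have KP key : key \in K -> exists q i, [/\ q \in Q, (i < nI)%N & key = (q * nI + i).+1].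
  by move=> /allpairsP[[q i] /= [qQ]]; rewrite mem_iota => /andP[_ iI] ->; exists q, i.
have wN : (2 ^ w <= N)%N by rewrite leq_exp2l.
have cH key j : key \in K -> (j <= m)%N -> `|c key j| < (2 ^ s0)%:R.
  move=> /KP[q [i [qQ iI ->]]] jm; rewrite /c /= (keyE _ _ iI).1 (keyE _ _ iI).2.
  have [_ gb _] := hgH (ix i); apply: le_lt_trans s0_H; apply: le_trans (HH (ix i)).
  rewrite normrM; apply: (@le_trans _ _ `|(gH (ix i)).1 j ((q * W)%:R / N%:R)|).
    rewrite -[leRHS]mulr1 ler_wpM2l // normfV ger0_norm // invf_le1 ?ltr0n ?fact_gt0 //.
    by rewrite ler1n fact_gt0.
  apply: gb => //; rewrite in_itv /= divr_ge0 //= ler_pdivrMr // mul1r ler_nat -WN.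
  by rewrite leq_mul2r Qle ?orbT.
pose a0 := Num.truncn (N%:R * c0).
have /andP[c00 c01] : 0 <= c0 <= 1 by have := C01 _ Cc0; rewrite in_itv.
have Nc0 : 0 <= N%:R * c0 by rewrite mulr_ge0.
have /andP[a0le a0lt] := truncn_itv Nc0.
have a0N : (a0 <= N)%N.
  by rewrite -(ler_nat R); apply: le_trans a0le _; rewrite -[leRHS]mulr1 ler_wpM2l.
have uK : uniq K.
  apply: allpairs_uniq => //; first exact: iota_uniq.
  move=> [q i] [q' i'] /allpairsP[[x y] /= [_ + [-> ->]]] /allpairsP[[x' y'] /= [_ + [-> ->]]].
  rewrite !mem_iota => /andP[_ yI] /andP[_ y'I] [e].
  have [e1 e2] := keyE x y yI; have [e1' e2'] := keyE x' y' y'I.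
  by rewrite -e1 -{2}e2 -e1' -{2}e2' e.
have sK : size K = (size Q * nI)%N by rewrite size_allpairs size_iota.
have sQ : (size Q <= (2 ^ w).+1)%N.
  rewrite -[X in (_ <= X)%N](size_iota 0); apply: uniq_leq_size => // q qQ.
  by rewrite mem_iota ltnS Qle.
have s0_gt0 : (0 < s0)%N by rewrite /s0 addnS.
have N_lt : (N < 2 ^ (b + s0))%N by rewrite ltn_exp2l // -[X in (X < _)%N]addn0 ltn_add2l.
have W_lt : (W < 2 ^ (b + s0))%N.
  by apply: leq_ltn_trans N_lt; rewrite leq_exp2l // leq_subr.
have a0_lt : (a0 < 2 ^ (b + s0))%N.
  exact: leq_ltn_trans N_lt.
have sK_lt : (size K < 2 ^ (b + s0))%N.
  rewrite sK; apply: leq_ltn_trans (sN (2 * nI)%N (2 * nI)%N (leqnn _) s0_nI).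
  rewrite [(2 * nI)%N]mulnC mulnC -mulnA leq_mul2l; apply/orP; right.
  apply: leq_trans sQ _; apply: (@leq_trans (2 * 2 ^ w)); last by rewrite leq_mul2l.
  by rewrite mul2n -addnn -addn1 leq_add2l expn_gt0.
have K_lt : {in K, forall key, (key < 2 ^ (b + s0))%N}.
  move=> key /KP[q [i [qQ iI ->]]].
  apply: leq_ltn_trans (sN (2 * nI)%N (2 * nI)%N (leqnn _) s0_nI).
  have h1 : (q * nI <= N * nI)%N by rewrite leq_mul2r (leq_trans (Qle _ qQ)) ?orbT.
  have h2 : (nI <= N * nI)%N by rewrite leq_pmull // expn_gt0.
  rewrite mulnAC -mulnA mul2n -addnn -addnS; apply: leq_add => //; exact: leq_trans iI h2.
have pos_lt : {in K, forall key j, (j <= m)%N -> (pos_part N (c key j) < 2 ^ (b + s0))%N}.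
  by move=> key kK j jm; rewrite addnC expnD pos_part_lt ?expn_gt0 // cH.
have neg_lt : {in K, forall key j, (j <= m)%N -> (pos_part N (- c key j) < 2 ^ (b + s0))%N}.
  by move=> key kK j jm; rewrite addnC expnD pos_part_lt ?expn_gt0 // normrN cH.
have bs0 : (0 < b + s0)%N by rewrite addn_gt0 s0_gt0 orbT.
have [B [x [hB sx hx]]] := hM b W a0 K (fun key j => pos_part N (c key j))
  (fun key j => pos_part N (- c key j)) bs0 uK W_lt a0_lt sK_lt K_lt pos_lt neg_lt.
pose pt w' := orbit_point nI L b a0 B w'.
pose dig w' t := ix (w' %/ nI ^ t %% nI)%N.
(* Range and shadowing are proved together: the bound [E1] for the current point puts its cell into
   the list, and this gives control of the next step. *)
have key_lemma w' : (pt w' <= N)%N /\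
    `|(pt w')%:R - N%:R * iteri (L * b) (fun t => phi (dig w' t)) c0| <= E1.
  rewrite /pt /orbit_point; move: (L * b)%N => n.
  suff : [/\ (iteri n (fun t a => B (w' %/ nI ^ t %% nI) a) a0 <= N)%N,
      `|(iteri n (fun t a => B (w' %/ nI ^ t %% nI)%N a) a0)%:R -
          N%:R * iteri n (fun t => phi (dig w' t)) c0| <= E1 & True] by case.
  elim: n => [|n [IHN IH _]] /=.
    split=> //; apply: le_trans E11; rewrite ler0_norm; rewrite -?natr1 in a0lt *; lra.
  set a := iteri n _ a0 in IHN IH *; set cc := iteri n _ c0 in IH *.
  have Ccc : C cc by exact: (generates_iteri genC).
  set i := (w' %/ nI ^ n %% nI)%N; have iI : (i < nI)%N by rewrite ltn_mod.
  have keyK : cell_key nI W i a \in K.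
    rewrite /cell_key; apply/allpairsP; exists ((a %/ W)%N, i); split => //=; last first.
      by rewrite mem_iota.
    apply: (Qnear _ cc) => //.
      by rewrite -(leq_pmul2r W0) WN; apply: leq_trans IHN; exact: leq_divM.
    have e : (2 ^ w)%:R = N%:R / W%:R :> R by rewrite -WN natrM mulfK // gt_eqF // ltr0n.
    have WR : 0 < W%:R :> R by rewrite ltr0n.
    have W1 : 1 <= W%:R :> R by rewrite ler1n.
    rewrite ler_pdivlMr // -[X in _ * X]gtr0_norm // -normrM mulrBl divfK ?gt_eqF //.
    rewrite -(ler_pM2r WR) -[X in _ * X <= _]gtr0_norm // -normrM mulrBl e mulrA divfK ?gt_eqF //.
    have aE : a%:R = (a %/ W)%:R * W%:R + (a %% W)%:R :> R.
      by rewrite -natrM -natrD -divn_eq.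
    have amW : (a %% W)%:R <= W%:R :> R by rewrite ler_nat ltnW // ltn_mod.
    have am0 : 0 <= (a %% W)%:R :> R by [].
    have E1W : E1 <= E1 * W%:R by rewrite ler_pMr //; lra.
    have := ler_distD a%:R ((a %/ W)%:R * W%:R) (cc * N%:R).
    rewrite [cc * _]mulrC => le; apply: le_trans le _.
    have : `|(a %/ W)%:R * W%:R - a%:R| <= W%:R :> R by rewrite distrC aE addrC addKr ger0_norm.
    rewrite mulrDl; lra.
  have BE := hB _ _ keyK.
  have := @branch_err R k m b w (phi (ix i)) (gH (ix i)).1 H a W (c (cell_key nI W i a)) erefl.
  have cE : c (cell_key nI W i a) = (fun j => (gH (ix i)).1 j ((a %/ W * W)%:R / (2 ^ b)%:R) / j`!%:R).
    by apply/funext => j; rewrite /c /= (keyE _ _ iI).1 (keyE _ _ iI).2.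
  move=> /(_ cE) err; split=> //; first by rewrite BE geq_minl.
  rewrite BE.
  have aN01 : (a%:R / N%:R : R) \in `[0, 1].
    by rewrite in_itv /= divr_ge0 //= ler_pdivrMr // mul1r ler_nat.
  apply: le_trans (ler_distD (N%:R * phi (ix i) (a%:R / N%:R)) _ _) _.
  apply: le_trans E1step; apply: lerD.
    apply: err => //; first by lra.
      by move=> y y01; have := phi01 (ix i) (phi (ix i) y); rewrite /= in_itv /=; apply; exists y.
    have [_ _ T] := hgH (ix i); move=> y z y01 z01; apply: le_trans (T y z y01 z01) _.
    by rewrite ler_wpM2r ?powR_ge0.
  rewrite -mulrBr normrM gtr0_norm //.
  apply: le_trans (ler_wpM2l (ltW N0) (lip _ _ _ aN01 (C01 _ Ccc))) _.
  rewrite mulrCA ler_wpM2l ?(ltW rho0) //.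
  by rewrite -[X in X * _]gtr0_norm // -normrM mulrBr mulrCA mulfV ?mulr1 // gt_eqF.
exists (p ++ x), [set y : R | y \in [seq ratr (fracval q) | q <-
   [seq Fraction false (bits b (pt w')) (true :: nseq b false) | w' <- iota 0 (nI ^ (L * b))]]].
have memF (y : R) : y \in [seq ratr (fracval q) | q <-
   [seq Fraction false (bits b (pt w')) (true :: nseq b false) | w' <- iota 0 (nI ^ (L * b))]] <->
   exists2 w', (w' < nI ^ (L * b))%N & y = (pt w')%:R / N%:R.
  have val w' : ratr (fracval (Fraction false (bits b (pt w')) (true :: nseq b false))) =
      (pt w')%:R / N%:R :> R.
    rewrite /fracval /= expr0 mul1r binval_one_zeros binval_bits; last first.
      by apply: leq_ltn_trans (key_lemma w').1 _; rewrite ltn_exp2l.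
    by rewrite fmorph_div /= !ratr_nat.
  rewrite -map_comp; split=> [/mapP[w' + ->]|[w' lt ->]].
    by rewrite mem_iota => /andP[_ lt]; exists w'; rewrite //= val.
  by apply/mapP; exists w'; rewrite ?mem_iota //= val.
split.
- exists [seq Fraction false (bits b (pt w')) (true :: nseq b false) | w' <- iota 0 (nI ^ (L * b))].
  split=> //; first exact/hp.
  rewrite all_map; apply/allP => w' _.
  by change (0 < binval (true :: nseq b false))%N; rewrite binval_one_zeros expn_gt0.
- have rho_n : rho ^+ (L * b) <= N%:R^-1.
    rewrite exprM natrX -exprVn; apply: lerXn2r => //; rewrite nnegrE ?invr_ge0 //.
    by rewrite exprn_ge0 // ltW.
  have pt_close w' : `|(pt w')%:R / N%:R - iteri (L * b) (fun t => phi (dig w' t)) c0| <= E1 / N%:R.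
    rewrite ler_pdivlMr // -[X in _ * X]gtr0_norm // -normrM mulrBl divfK ?gt_eqF //.
    by rewrite [_ * N%:R]mulrC (key_lemma w').2.
  apply: hausdorff_dist_le.
  + by rewrite divr_gt0 //; lra.
  + move=> z Cz; have [d [c' [Cc' zE]]] := generates_address genC (L * b) i0 Cz.
    have [t|w' lt wd] := @word_of_digits nI (L * b) (fun t => index (d t) (enum I)) nI0.
      by rewrite /nI cardE index_mem mem_enum.
    exists ((pt w')%:R / N%:R); first by apply/memF; exists w'.
    have dE : iteri (L * b) (fun t => phi (dig w' t)) c0 = iteri (L * b) (fun t => phi (d t)) c0.
      by apply: eq_iteri => t tl y; rewrite /dig wd // /ix nth_index // mem_enum.
    have := pt_close w'; rewrite dE distrC => h1.
    have := iteri_contraction genC (L * b) d (ltW rho0) lip Cc' Cc0; rewrite -zE => h2.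
    have c'1 : `|c' - c0| <= 1.
      by have := C01 _ Cc'; rewrite in_itv /= ler_norml => /andP[? ?]; lra.
    have {}h2 : `|z - iteri (L * b) (fun t => phi (d t)) c0| <= N%:R^-1.
      apply: le_trans h2 _; rewrite -[leRHS]mulr1; apply: ler_pM => //.
      by rewrite exprn_ge0 // ltW.
    apply: le_lt_trans (ler_distD (iteri (L * b) (fun t => phi (d t)) c0) _ _) _.
    have : 0 < N%:R^-1 :> R by rewrite invr_gt0.
    rewrite [(E1 + 2) / _]mulrDl -/N; lra.
  + move=> y /memF[w' lt ->]; exists (iteri (L * b) (fun t => phi (dig w' t)) c0).
      exact: (generates_iteri genC).
    apply: le_lt_trans (pt_close w') _.
    have : 0 < N%:R^-1 :> R by rewrite invr_gt0.
    rewrite [(E1 + 2) / _]mulrDl -/N; lra.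
- by rewrite size_cat; apply: record_size_bound; rewrite -sK.
Qed.


(** * The upper bound *)

Section BoxCounting.
Variable R : realType.

Lemma near_rightP (P : R -> Prop) :
  (\forall e \near 0^'+, P e) <-> exists2 d, 0 < d & forall e, 0 < e -> e < d -> P e.
Proof.
split=> [|[d d0 H]].
  rewrite near_withinE => /nbhs_ballP[d /= d0 H]; exists d => // e e0 ed.
  by apply: H => //=; rewrite /ball /= sub0r normrN gtr0_norm.
near=> e; apply: H; near: e; [exact: nbhs_right_gt | exact: nbhs_right_lt].
Unshelve. all: by end_near. Qed.

Definition covered_by (C : set R) (e : R) (n : nat) : Prop :=
  exists a : 'I_n -> R, C `<=` \bigcup_(i in setT) `[a i, a i + e]%classic.

Lemma box_count_le (C : set R) (e : R) (n : nat) :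
  covered_by C e n -> box_count C e <= n%:R.
Proof.
move=> h; apply: ge_inf; last by exists n.
by exists 0 => _ [m _ <-].
Qed.

Lemma covered_by_unit (C : set R) (e : R) : C `<=` `[0, 1] -> 0 < e -> exists n, covered_by C e n.
Proof.
move=> C01 e0; exists (Num.truncn e^-1).+1, (fun i => i%:R * e) => x Cx.
have /andP[x0 x1] : 0 <= x <= 1 by have := C01 x Cx; rewrite /= in_itv.
have xe0 : 0 <= x / e by rewrite divr_ge0 // ltW.
have /andP[le lt] := truncn_itv xe0.
have xT : (Num.truncn (x / e) < (Num.truncn e^-1).+1)%N.
  rewrite ltnS truncn_ge_nat ?invr_ge0 ?(ltW e0) //; apply: le_trans le _.
  by rewrite -[leRHS]mul1r ler_wpM2r // invr_ge0 ltW.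
exists (Ordinal xT) => //=; rewrite in_itv /=; apply/andP; split.
  by rewrite -ler_pdivlMr.
by rewrite -[X in _ + X]mul1r -mulrDl -ler_pdivrMr // natr1 ltW.
Qed.

Lemma box_count_cover (C : set R) (e : R) : C `<=` `[0, 1] -> 0 < e ->
  exists2 n, covered_by C e n & n%:R < box_count C e + 1.
Proof.
move=> C01 e0; have [n0 h0] := covered_by_unit C01 e0.
pose S := [set n%:R | n in [set n | covered_by C e n]] : set R.
have hS : has_inf S.
  split; first by exists n0%:R, n0.
  by exists 0 => _ [m _ <-].
by have [_ [n hn <-] lt] := inf_adherent ltr01 hS; exists n.
Qed.

Lemma box_count_ge1 (C : set R) (e : R) : C !=set0 -> C `<=` `[0, 1] -> 0 < e ->
  1 <= box_count C e.
Proof.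
move=> [x Cx] C01 e0; have [n0 h0] := covered_by_unit C01 e0.
apply: lb_le_inf; first by exists n0%:R, n0.
move=> _ [[|n] [a h] <-]; last by rewrite ler1n.
by have [[]] := h x Cx.
Qed.

Lemma box_dim_ge0 (C : set R) (D : R) : C !=set0 -> C `<=` `[0, 1] -> box_dim C D -> 0 <= D.
Proof.
move=> C0 C01 dimC; rewrite leNgt; apply/negP => D0.
have /cvgrPdist_lt /(_ (- D)) := dimC; rewrite oppr_gt0 => /(_ D0) /near_rightP[d d0 H].
pose e := Num.min (d / 2) (2^-1).
have e0 : 0 < e by rewrite lt_min divr_gt0 //= invr_gt0.
have ed : e < d by rewrite gt_min; apply/orP; left; lra.
have e1 : e < 1 by rewrite gt_min; apply/orP; right; lra.
have q0 : 0 <= ln (box_count C e) / - ln e.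
  by rewrite divr_ge0 // ?ln_ge0 ?box_count_ge1 // oppr_ge0 ln_le0 // ltW.
have := H e e0 ed; rewrite ltr_norml => /andP[h _]; lra.
Qed.

Lemma box_count_power (C : set R) (D eta : R) : box_dim C D -> 0 < eta ->
  exists2 d, 0 < d & forall e, 0 < e -> e < d -> box_count C e <= e `^ (- (D + eta)).
Proof.
move=> /cvgrPdist_lt dimC eta0; have /near_rightP[d d0 H] := dimC eta eta0.
exists (Num.min d 1); first by rewrite lt_min d0 ltr01.
move=> e e0; rewrite lt_min => /andP[/(H e e0) + e1].
have lne : 0 < - ln e by rewrite oppr_gt0 ln_lt0 // e0.
rewrite ltr_norml => /andP[h _]; have [bc0|bc0] := leP (box_count C e) 0.
  by apply: le_trans bc0 _; exact: powR_ge0.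
have {}h : ln (box_count C e) <= - (D + eta) * ln e.
  rewrite mulNr -mulrN -ler_pdivrMr //; lra.
by rewrite /powR gt_eqF // -[leLHS](lnK bc0) ler_expR.
Qed.

(** In units of [2 ^ - w] a covering interval has length 1, so the grid numbers near the part of [C]
    inside it lie in a window of length [1 + 2 * E]. Counted from its truncated left end, the window
    holds at most [Num.truncn (2 * E) + 3] of them. *)
Lemma close_cells (C : set R) (E : R) : 0 <= E -> C `<=` `[0, 1] ->
  exists M : nat, forall w, exists Q : seq nat,
    [/\ uniq Q, {in Q, forall q, (q <= 2 ^ w)%N},
        forall q c, (q <= 2 ^ w)%N -> C c ->
          `|q%:R / (2 ^ w)%:R - c| <= E / (2 ^ w)%:R -> q \in Q &
        (size Q)%:R <= M%:R * (box_count C ((2 ^ w)%:R^-1) + 1)].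
Proof.
move=> E0 C01; exists (Num.truncn (2 * E)).+3 => w.
move ME : (Num.truncn (2 * E)).+3 => M.
have W0 : 0 < (2 ^ w)%:R :> R by rewrite ltr0n expn_gt0.
pose close q := `[< exists2 c, C c & `|q%:R / (2 ^ w)%:R - c| <= E / (2 ^ w)%:R >].
exists [seq q <- iota 0 (2 ^ w).+1 | close q]; split.
- by rewrite filter_uniq // iota_uniq.
- by move=> q; rewrite mem_filter mem_iota => /andP[_]; rewrite ltnS.
- move=> q c qw Cc qc; rewrite mem_filter mem_iota /= add0n ltnS qw andbT.
  by apply/asboolP; exists c.
have [|n [a cov] nb] := @box_count_cover C ((2 ^ w)%:R^-1) C01; first by rewrite invr_gt0.
apply: (@le_trans _ _ (M%:R * n%:R)); last by rewrite ler_wpM2l // ltW.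
rewrite -natrM ler_nat.
pose base i : nat := Num.truncn (Num.max 0 (a i * (2 ^ w)%:R - E)).
have -> : (M * n)%N = size [seq base i + j | i <- enum 'I_n, j <- iota 0 M]%N.
  by rewrite size_allpairs size_iota size_enum_ord mulnC.
apply: uniq_leq_size; first by rewrite filter_uniq // iota_uniq.
move=> q; rewrite mem_filter => /andP[/asboolP[c Cc qc] _].
have [i _] := cov c Cc; rewrite /= in_itv /= => /andP[ac ca].
have {qc} : `|q%:R - c * (2 ^ w)%:R| <= E.
  by move: qc; rewrite ler_pdivlMr // -[X in _ * X]gtr0_norm // -normrM mulrBl divfK ?gt_eqF.
rewrite ler_norml => /andP[qc1 qc2].
have ac' : a i * (2 ^ w)%:R <= c * (2 ^ w)%:R by rewrite ler_wpM2r // ltW.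
have ca' : c * (2 ^ w)%:R <= a i * (2 ^ w)%:R + 1.
  have Wn0 : (2 ^ w)%:R != 0 :> R by rewrite gt_eqF.
  by rewrite -[X in _ + X](mulVf Wn0) -mulrDl ler_wpM2r // ltW.
have b0 : 0 <= Num.max 0 (a i * (2 ^ w)%:R - E) by rewrite le_max lexx.
have /andP[ble blt] := truncn_itv b0.
have le1 : (base i <= q)%N.
  rewrite -(ler_nat R); apply: le_trans ble _; rewrite ge_max ler0n /=; lra.
have E20 : 0 <= 2 * E by rewrite mulr_ge0.
have /andP[_ Elt] := truncn_itv E20.
have lt2 : (q < base i + M)%N.
  rewrite -(ltr_nat R) natrD -ME -2!natr1 -/(base i) in blt *.
  have : a i * (2 ^ w)%:R - E < (base i)%:R + 1.
    by apply: le_lt_trans blt; rewrite le_max lexx orbT.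
  rewrite -natr1 in Elt; lra.
apply/allpairsP; exists (i, q - base i)%N; split; rewrite /= ?mem_enum ?mem_iota //.
  by rewrite add0n ltn_subLR.
by rewrite subnKC.
Qed.

End BoxCounting.

(** Bernoulli's inequality for [2 ^ d = 1 + x]. It lets the [O(b)] bits of each entry be absorbed by
    part of the [delta] in the exponent. *)
Lemma linear_le_exp (R : realType) (d : R) : 0 < d ->
  exists2 A : R, 0 < A & forall b : nat, b.+1%:R <= A * (2 ^ b)%:R `^ d.
Proof.
move=> d0; pose x : R := 2 `^ d - 1.
have x0 : 0 < x.
  rewrite subr_gt0 -[ltLHS](powRr0 2); rewrite /powR (_ : (2 == 0 :> R) = false); last by rewrite pnatr_eq0.
  by rewrite ltr_expR mul0r mulr_gt0 // ln_gt0 // ltr1n.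
exists (1 + x^-1); first by rewrite addr_gt0 // invr_gt0.
move=> b; have -> : (2 ^ b)%:R `^ d = (1 + x) ^+ b.
  rewrite natrX -powR_mulrn // -powRrM mulrC powRrM powR_mulrn ?powR_ge0 //.
  by congr (_ ^+ _); rewrite /x; ring.
have bern : 1 + x *+ b <= (1 + x) ^+ b.
  elim: b => [|b IH]; first by rewrite mulr0n addr0 expr0.
  rewrite exprS; have x1 : 0 <= 1 + x by rewrite addr_ge0 // ltW.
  apply: le_trans (ler_wpM2l x1 IH); rewrite mulrS -[x *+ b]mulr_natr.
  have : 0 <= x * (x * b%:R) by rewrite !mulr_ge0 // ltW.
  lra.
have xv0 : 0 <= 1 + x^-1 by rewrite addr_ge0 // invr_ge0 ltW.
apply: le_trans (ler_wpM2l xv0 bern).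
rewrite -[x *+ b]mulr_natr -natr1.
have -> : (1 + x^-1) * (1 + x * b%:R) = 1 + x * b%:R + x^-1 + b%:R.
  by field; rewrite gt_eqF.
have : 0 < x^-1 by rewrite invr_gt0.
have : 0 <= x * b%:R by rewrite mulr_ge0 // ltW.
lra.
Qed.

Lemma distortion_upper_bound (R : realType) (U : machine) (hU : universal U)
    (k : R) (hk : 1 <= k) (delta : R) (C : set R) (D : R) :
  0 < delta -> Ck_cantor k C -> box_dim C D ->
  preceq (fun e => distortion_complexity U C e)
         (fun e => (e `^ (- (D / k) - delta))%:E).
Proof.
move=> delta0 [I [phi [ifsphi Ck genC]]] dimC.
have [E [A [E1 scale _]]] := program_at_scale hU hk ifsphi Ck genC.
have [C0 _ C01 _] := genC.
have k0 : 0 < k by lra.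
have E0 : 0 < E by lra.
have D0 := box_dim_ge0 C0 C01 dimC.
(* Half of [delta] pays for the box count, as [(D + eta) / k = D / k + delta / 2]; the other half
   pays for the linear factor [b.+1]. *)
pose eta := k * delta / 2; have eta0 : 0 < eta by rewrite divr_gt0 // mulr_gt0.
have [d d0 bcd] := box_count_power dimC eta0.
have [M cells] := close_cells (ltW E0) C01.
have delta2 : 0 < delta / 2 by rewrite divr_gt0.
have [B B0 linB] := linear_le_exp delta2.
pose s := D / k + delta.
have s0 : 0 < s by rewrite ltr_wpDl // divr_ge0 // ltW.
pose K := A%:R * ((2 * M%:R + 1) * 2 `^ (D + eta)) * B * (2 * E) `^ s.
have K0 : 0 <= K by rewrite !mulr_ge0 ?powR_ge0 ?addr_ge0 ?mulr_ge0 ?(ltW B0).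
exists (K + 1); first by rewrite ltr_wpDl.
(* For [e < E] the least [b] with [E / e < 2 ^ b] is positive, so its minimality gives
   [2 ^ b <= 2 * (E / e)]. The second bound makes [2 ^ - w] smaller than [d], where the box count
   estimate is valid. *)
apply/near_rightP; exists (Num.min E (E * d `^ k)).
  by rewrite lt_min E0 mulr_gt0 // powR_gt0.
move=> e e0; rewrite lt_min => /andP[eE ed].
have [b [bgt ble]] : exists b : nat, E / e < (2 ^ b)%:R /\ (2 ^ b)%:R <= 2 * (E / e).
  have ex : exists b : nat, E / e < (2 ^ b)%:R.
    exists (Num.truncn (E / e)).+1; apply: lt_le_trans (truncnS_gt _) _.
    by rewrite ler_nat ltnW // ltn_expl.
  case: (ex_minnP ex) => -[|b] hb minb.
    by move: hb; rewrite ltr_pdivrMr // mul1r ltNge ltW.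
  exists b.+1; split => //; rewrite expnS natrM ler_wpM2l // leNgt; apply/negP => /minb.
  by rewrite ltnn.
have [w [wb bw wlt]] : exists w : nat, [/\ (w <= b)%N, b%:R <= w%:R * k & w%:R <= b%:R / k + 1].
  have hb : b%:R <= b%:R * k by rewrite ler_peMr.
  have ex : exists w : nat, b%:R <= w%:R * k by exists b.
  case: (ex_minnP ex) => -[|w] hw minw; first by exists 0%N; split; rewrite // ?addr_ge0 // divr_ge0 // ltW.
  exists w.+1; split=> //; first exact: minw.
  rewrite -natr1 lerD2r ler_pdivlMr // ltW // ltNge; apply/negP => /minw.
  by rewrite ltnn.
have [Q [uQ Qle Qnear sQ]] := cells w.
have [P [F [prodF distF sP]]] := scale b w Q wb bw uQ Qle Qnear.
have N0 : 0 < (2 ^ b)%:R :> R by rewrite ltr0n expn_gt0.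
have W0 : 0 < (2 ^ w)%:R :> R by rewrite ltr0n expn_gt0.
apply: (@le_trans _ _ ((size P)%:R%:E)).
  apply: ereal_inf_lbound; exists P => //; exists F => //.
  apply: le_lt_trans distF _; rewrite lte_fin ltr_pdivrMr // mulrC -ltr_pdivrMr //.
rewrite -EFinM lee_fin.
apply: (@le_trans _ _ (K * e `^ (- s))); last first.
  rewrite /s opprD; apply: ler_wpM2r; [exact: powR_ge0 | by rewrite lerDl].
have w_small : (2 ^ w)%:R^-1 < d.
  rewrite ltNge; apply/negP => dw.
  have : d `^ k <= ((2 ^ w)%:R^-1) `^ k.
    by rewrite ge0_ler_powR // ?nnegrE ?ltW // invr_gt0.
  apply/negP; rewrite -ltNge.
  have -> : (2 ^ w)%:R^-1 `^ k = ((2 `^ (w%:R * k))^-1 : R).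
    by rewrite natrX -powR_mulrn // -powRN -powRrM mulNr powRN.
  apply: (@le_lt_trans _ _ ((2 ^ b)%:R^-1)).
    rewrite lef_pV2 ?posrE ?powR_gt0 // natrX -powR_mulrn //.
    by apply: ler_powR => //; rewrite ler1n.
  apply: (@lt_trans _ _ (e / E)).
    by rewrite -[e / E]invrK invf_div ltf_pV2 ?posrE ?divr_gt0.
  by rewrite ltr_pdivrMr // mulrC.
have Winv0 : 0 < (2 ^ w)%:R^-1 :> R by rewrite invr_gt0.
have De0 : 0 < D + eta by lra.
have bcW := bcd _ Winv0 w_small.
have WE : (2 ^ w)%:R^-1 `^ (- (D + eta)) = (2 `^ ((D + eta) * w%:R) : R).
  by rewrite -powR_inv1 ?(ltW W0) // -powRrM mulrNN mul1r natrX -powR_mulrn // -powRrM mulrC.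
rewrite WE in bcW.
set T := 2 `^ _ in bcW.
have T1 : 1 <= T.
  by rewrite -[leLHS](powRr0 2); apply: ler_powR; rewrite ?ler1n // mulr_ge0 // ltW.
have sQT : (size Q).+1%:R <= (2 * M%:R + 1) * T.
  rewrite -natr1; have : M%:R * (box_count C (2 ^ w)%:R^-1 + 1) <= M%:R * (2 * T).
    by rewrite ler_wpM2l //; lra.
  have -> : (2 * M%:R + 1) * T = M%:R * (2 * T) + T by ring.
  lra.
have TN : T <= 2 `^ (D + eta) * (2 ^ b)%:R `^ ((D + eta) / k).
  rewrite natrX -[2 ^+ b]powR_mulrn // -powRrM -powRD; last by rewrite pnatr_eq0 implybT.
  apply: ler_powR; first by rewrite ler1n.
  apply: le_trans (ler_wpM2l (ltW De0) wlt) _.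
  by rewrite mulrDr mulr1 addrC mulrCA.
apply: (@le_trans _ _ (A%:R * (size Q).+1%:R * b.+1%:R)).
  by rewrite -!natrM ler_nat.
apply: (@le_trans _ _ (A%:R * ((2 * M%:R + 1) * (2 `^ (D + eta) * (2 ^ b)%:R `^ ((D + eta) / k)))
   * (B * (2 ^ b)%:R `^ (delta / 2)))).
  apply: ler_pM => //.
  by rewrite ler_wpM2l //; apply: le_trans sQT _; rewrite ler_wpM2l.
have -> : A%:R * ((2 * M%:R + 1) * (2 `^ (D + eta) * (2 ^ b)%:R `^ ((D + eta) / k)))
   * (B * (2 ^ b)%:R `^ (delta / 2)) =
  A%:R * ((2 * M%:R + 1) * 2 `^ (D + eta)) * B * (2 ^ b)%:R `^ s.
  have -> : s = (D + eta) / k + delta / 2 by rewrite /s /eta; field; rewrite gt_eqF.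
  rewrite [(2 ^ b)%:R `^ (_ + _)]powRD; last by rewrite (gt_eqF N0) implybT.
  ring.
rewrite /K -[leRHS]mulrA; apply: ler_wpM2l.
  by rewrite !mulr_ge0 ?powR_ge0 ?addr_ge0 ?mulr_ge0 ?(ltW B0).
rewrite powRN -powR_inv1 ?powR_ge0 // -powRrM mulrN1 -mulN1r powRrM powR_inv1 ?(ltW e0) //.
rewrite -powRM ?invr_ge0 ?mulr_ge0 ?(ltW e0) ?(ltW E0) //.
by apply: ge0_ler_powR; rewrite ?(ltW s0) ?nnegrE ?mulr_ge0 ?invr_ge0 ?(ltW e0) ?(ltW E0) // -mulrA.
Qed.


(** * A smooth step *)

Section SmoothStep.
Variable R : realType.

Lemma derivn_mul_exp (q u : {poly R}) n j : (j <= n)%N ->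
  exists q', (q * u ^+ n)^`(j) = q' * u ^+ (n - j).
Proof.
elim: j => [_|j IH jn]; first by exists q; rewrite derivn0 subn0.
have [q' e] := IH (ltnW jn); rewrite derivnS e.
exists (q'^`() * u + q' * (u^`() *+ (n - j))).
have -> : (n - j = (n - j.+1).+1)%N by rewrite subnSK.
by rewrite derivM deriv_exp exprS /= mulrDl mulrA -!mulrA mulrnAl.
Qed.

(* The first half of the binomial expansion of [('X + (1 - 'X)) ^+ (2 r + 1)]. *)
Lemma step_poly_exists (r : nat) : exists P : {poly R},
  [/\ P.[0] = 0, P.[1] = 1 &
    forall j, (0 < j <= r)%N -> (P^`(j)).[0] = 0 /\ (P^`(j)).[1] = 0].
Proof.
pose T (i : 'I_(r + r.+1).+1) : {poly R} :=
  ('X ^+ (r + r.+1 - i) * (1 - 'X) ^+ i) *+ 'C(r + r.+1, i).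
pose A := \sum_(i < (r + r.+1).+1 | (i <= r)%N) T i.
pose B := \sum_(i < (r + r.+1).+1 | ~~ (i <= r)%N) T i.
have AB : A + B = 1.
  transitivity (\sum_i T i); last by rewrite -exprDn addrC subrK expr1n.
  by rewrite [RHS](bigID (fun i : 'I__ => (i <= r)%N)).
have [qA AE] : exists q, A = q * 'X ^+ r.+1.
  exists (\sum_(i < (r + r.+1).+1 | (i <= r)%N) ('X ^+ (r - i) * (1 - 'X) ^+ i) *+ 'C(r + r.+1, i)).
  rewrite mulr_suml; apply: eq_bigr => i ir.
  have e : (r + r.+1 - i = (r - i) + r.+1)%N by lia.
  by rewrite /T e exprD mulrnAl mulrAC.
have [qB BE] : exists q, B = q * (1 - 'X) ^+ r.+1.
  exists (\sum_(i < (r + r.+1).+1 | ~~ (i <= r)%N) ('X ^+ (r + r.+1 - i) * (1 - 'X) ^+ (i - r.+1)) *+ 'C(r + r.+1, i)).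
  rewrite mulr_suml; apply: eq_bigr => i; rewrite -ltnNge => ri.
  rewrite /T mulrnAl; congr (_ *+ _); rewrite -mulrA -exprD subnK //.
have A1 : A = 1 - B by rewrite -AB addrK.
exists A; split.
- by rewrite AE hornerM hornerXn expr0n mulr0.
- by rewrite A1 BE hornerD hornerN hornerM horner_exp !hornerE subrr expr0n mulr0 subr0.
move=> j /andP[j0 jr]; split.
  have [q' e] := derivn_mul_exp qA 'X (leqW jr); rewrite AE e.
  by rewrite hornerM hornerXn expr0n subn_eq0 leqNgt ltnS jr mulr0.
have [q' e] := derivn_mul_exp qB (1 - 'X) (leqW jr).
rewrite A1 derivnB -{1}polyC1 derivnC (gtn_eqF j0) sub0r BE e hornerN hornerM horner_exp.
by rewrite !hornerE subrr expr0n subn_eq0 leqNgt ltnS jr mulr0 oppr0.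
Qed.

Lemma poly_bounded01 (p : {poly R}) : exists2 A, 0 <= A & {in `[0, 1], forall x, `|p.[x]| <= A}.
Proof.
exists (\sum_(i < size p) `|p`_i|); first by apply: sumr_ge0.
move=> x; rewrite in_itv /= => /andP[x0 x1]; rewrite horner_coef.
apply: le_trans (ler_norm_sum _ _ _) _; apply: ler_sum => i _.
by rewrite normrM ler_piMr // normrX ger0_norm // exprn_ile1.
Qed.

Lemma deriv01_horner (p : {poly R}) : deriv01 (horner p) (horner p^`()).
Proof.
apply/deriv01P => t _; have := @diff_at_horner _ [set` `[0, 1]] p 0 t.
rewrite subr0 (_ : (fun t0 => p.[t0 - 0]) = horner p) //.
by apply/funext => u; rewrite subr0.
Qed.

Lemma horner_lipschitz01 (p : {poly R}) A x y : {in `[0, 1], forall x, `|(p^`()).[x]| <= A} ->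
  x \in `[0, 1] -> y \in `[0, 1] -> `|p.[y] - p.[x]| <= A * `|y - x|.
Proof.
move=> pA x01 y01; apply: (@deriv01_mvt _ _ (horner p^`())) => // [|t t01 _]; last exact: pA.
exact: deriv01_horner.
Qed.

Lemma horner_taylor01 (p : {poly R}) A x y : {in `[0, 1], forall x, `|(p^`()^`()).[x]| <= A} ->
  x \in `[0, 1] -> y \in `[0, 1] ->
  `|p.[y] - p.[x] - (y - x) * (p^`()).[x]| <= A * `|y - x| ^+ 2.
Proof.
move=> pA x01 y01; pose q := p - (p^`()).[x] *: 'X.
have A0 : 0 <= A by apply: le_trans (pA x x01).
have -> : p.[y] - p.[x] - (y - x) * (p^`()).[x] = q.[y] - q.[x].
  by rewrite /q !hornerE; ring.
rewrite expr2 mulrA; apply: (@deriv01_mvt _ _ (horner q^`())) => // [|t t01 tx]; first exact: deriv01_horner.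
rewrite /q derivB derivZ derivX !hornerE.
apply: le_trans (horner_lipschitz01 pA x01 t01) _; exact: ler_wpM2l.
Qed.

Definition clamp (x : R) : R := Num.max 0 (Num.min x 1).

Lemma clamp01 x : clamp x \in `[0, 1].
Proof.
rewrite in_itv /= /clamp le_max lexx /= ge_max ler01 /=.
by rewrite ge_min lexx orbT.
Qed.

Lemma clamp_cases x : [\/ x <= 0 /\ clamp x = 0, 0 <= x <= 1 /\ clamp x = x | 1 <= x /\ clamp x = 1].
Proof.
have [x0|x0] := leP x 0.
  apply: Or31; split=> //; rewrite /clamp min_l ?max_l //; lra.
have [x1|x1] := leP x 1.
  by apply: Or32; rewrite (ltW x0); split=> //; rewrite /clamp min_l // max_r // ltW.
by apply: Or33; split; rewrite ?(ltW x1) // /clamp min_r ?(ltW x1) // max_r.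
Qed.

Lemma clamp_lipschitz x y : `|clamp y - clamp x| <= `|y - x|.
Proof.
have mono u v : u <= v -> `|clamp v - clamp u| <= `|v - u|.
  move=> uv; have vu : 0 <= v - u by lra.
  rewrite (ger0_norm vu) ler_norml.
  have [[? ->]|[/andP[? ?] ->]|[? ->]] := clamp_cases u;
  have [[? ->]|[/andP[? ?] ->]|[? ->]] := clamp_cases v; lra.
by have [/mono //|/ltW/mono] := leP x y; rewrite distrC (distrC x).
Qed.

(** For [z <= 1] the higher power gives the claim, for [z >= 1] the lower one. Bounds that are good
    near and bounds that are good far away thus merge into one valid on the whole line. *)
Lemma le_powers (alpha z a : R) : 0 < alpha <= 1 -> 0 <= z -> 0 <= a ->
  (forall t : R, t <= a * z ^+ 2 -> t <= a * z -> t <= a * z `^ (1 + alpha)) /\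
  (forall t : R, t <= a * z -> t <= a -> t <= a * z `^ alpha).
Proof.
move=> /andP[al0 al1] z0 a0; have [z1|z1] := leP z 1.
  have pw (s s' : R) : 0 < s -> s <= s' -> z `^ s' <= z `^ s.
    move=> s0 ss'; have [->|zn0] := eqVneq z 0; first by rewrite !powR0 // gt_eqF //; lra.
    by apply: ger_powR => //; rewrite z1 lt_neqAle eq_sym zn0 z0.
  split=> t t1 t2.
    apply: le_trans t1 _; rewrite ler_wpM2l // -powR_mulrn //; apply: pw; lra.
  apply: le_trans t1 _; rewrite ler_wpM2l // -{1}[z]powRr1 //; apply: pw; lra.
have z1' := ltW z1; split=> t t1 t2.
  apply: le_trans t2 _; rewrite ler_wpM2l // -{1}[z]powRr1 //; apply: ler_powR => //; lra.
apply: le_trans t2 _; rewrite ler_peMr // -(powRr0 z); apply: ler_powR => //; lra.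
Qed.

(** [Psi j] is the [j]-th derivative of a step polynomial at the clamped argument; flatness at 0 and
    1 makes these the derivatives of the extended step. The estimates hold for all real arguments,
    so that they survive rescaling to an arbitrary gap. *)
Lemma smooth_step (m : nat) (alpha : R) : 0 < alpha <= 1 -> exists (Psi : nat -> R -> R) (A : R),
  [/\ 0 <= A /\ (forall x, x <= 0 -> Psi 0%N x = 0) /\ (forall x, 1 <= x -> Psi 0%N x = 1),
      forall j x, (0 < j <= m.+1)%N -> x <= 0 \/ 1 <= x -> Psi j x = 0,
      forall j x y, (j <= m)%N ->
        `|Psi j y - Psi j x - (y - x) * Psi j.+1 x| <= A * `|y - x| `^ (1 + alpha),
      forall j x y, (j <= m)%N -> `|Psi j y - Psi j x| <= A * `|y - x| `^ alpha &
      forall j x y, (j <= m)%N -> `|Psi j y - Psi j x| <= A * `|y - x|].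
Proof.
move=> al; have [P [P0 P1 PD]] := step_poly_exists m.+1.
have [A [A0 PA]] : exists A, 0 <= A /\
    forall j, (j <= m.+2)%N -> {in `[0, 1], forall x, `|(P^`(j)).[x]| <= A}.
  elim: m.+2 => [|n [A [A0 IH]]].
    have [A A0 hA] := poly_bounded01 P; exists A; split=> // j; rewrite leqn0 => /eqP ->.
    by rewrite derivn0.
  have [A' A'0 hA'] := poly_bounded01 (P^`(n.+1)).
  exists (A + A'); split; first exact: addr_ge0.
  move=> j; rewrite leq_eqVlt ltnS => /orP[/eqP -> x x01|jn x x01].
    by apply: ler_wpDl => //; exact: hA'.
  by apply: ler_wpDr => //; exact: IH.
pose Psi j x := (P^`(j)).[clamp x].
have zero j x : (0 < j <= m.+1)%N -> x <= 0 \/ 1 <= x -> Psi j x = 0.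
  move=> /PD[D0 D1] x01; rewrite /Psi.
  by case: (clamp_cases x) => [[? ->]|[/andP[x0 x1] e]|[? ->]] //; rewrite e; case: x01 => h;
    [have -> : x = 0 by lra | have -> : x = 1 by lra].
have bound j x : (j <= m.+2)%N -> `|Psi j x| <= A by move=> /PA; apply; exact: clamp01.
have lip j x y : (j <= m.+1)%N -> `|Psi j y - Psi j x| <= A * `|y - x|.
  move=> jm; apply: (@le_trans _ _ (A * `|clamp y - clamp x|)).
    apply: horner_lipschitz01; rewrite ?clamp01 // -derivnS; exact: PA.
  by rewrite ler_wpM2l // clamp_lipschitz.
have sq j x y : (j <= m)%N -> `|Psi j y - Psi j x - (y - x) * Psi j.+1 x| <= 2 * A * `|y - x| ^+ 2.
  move=> jm.
  have t1 : `|Psi j y - Psi j x - (clamp y - clamp x) * Psi j.+1 x| <= A * `|y - x| ^+ 2.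
    apply: (@le_trans _ _ (A * `|clamp y - clamp x| ^+ 2)).
      rewrite /Psi derivnS; apply: horner_taylor01; rewrite ?clamp01 // -!derivnS.
      exact: PA.
    rewrite ler_wpM2l //; apply: lerXn2r; rewrite ?nnegrE //; exact: clamp_lipschitz.
  (* The cost of clamping. If [x] is outside the unit interval, the derivative vanishes; otherwise
     an end point [z] separates [x] from [y], and the derivative at [x] is at most [A * |x - z|],
     which supplies the second small factor. *)
  have t2 : `|((y - x) - (clamp y - clamp x)) * Psi j.+1 x| <= A * `|y - x| ^+ 2.
    have Z0 : 0 <= A * `|y - x| ^+ 2 by rewrite mulr_ge0 // exprn_ge0.
    have [[x0 _]|[/andP[x0 x1] ->]|[x1 _]] := clamp_cases x.
    - by rewrite [Psi _ _]zero ?mulr0 ?normr0 //; left.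
    - have step z : (z = 0 \/ z = 1) -> `|y - z| <= `|y - x| -> `|x - z| <= `|y - x| ->
          `|(y - x - (z - x)) * Psi j.+1 x| <= A * `|y - x| ^+ 2.
        move=> z01 yz xz; have -> : y - x - (z - x) = y - z by ring.
        have -> : Psi j.+1 x = Psi j.+1 x - Psi j.+1 z.
          by rewrite [Psi _ z]zero ?subr0 //; case: z01 => ->; [left | right].
        rewrite normrM expr2 mulrCA; apply: ler_pM => //.
        by apply: le_trans (lip _ _ _ _) _; [lia | rewrite ler_wpM2l].
      have [[y0 ->]|[_ ->]|[y1 ->]] := clamp_cases y; last 2 first.
      + by rewrite subrr mul0r normr0.
      + by apply: step; [right | rewrite !ger0_norm; lra | rewrite ler0_norm ?ger0_norm; lra].
      + by apply: step; [left | rewrite !ler0_norm; lra | rewrite ger0_norm ?ler0_norm; lra].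
    - by rewrite [Psi _ _]zero ?mulr0 ?normr0 //; right.
  have := ler_normB (Psi j y - Psi j x - (clamp y - clamp x) * Psi j.+1 x)
    ((y - x - (clamp y - clamp x)) * Psi j.+1 x).
  rewrite (_ : _ - _ - _ = Psi j y - Psi j x - (y - x) * Psi j.+1 x); last by ring.
  lra.
exists Psi, (2 * A); split.
- split; first by rewrite mulr_ge0.
  split=> x x01; rewrite /Psi derivn0; have [[? e]|[/andP[? ?] e]|[? e]] := clamp_cases x; rewrite e //.
  + by have -> : x = 0 by lra.
  + by have : False by lra.
  + by have : False by lra.
  + by have -> : x = 1 by lra.
- exact: zero.
- move=> j x y jm; apply: (le_powers al (normr_ge0 (y - x)) _).1; first by rewrite mulr_ge0.
    exact: sq.
  apply: le_trans (ler_normB _ _) _; rewrite normrM.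
  rewrite [leRHS](_ : _ = A * `|y - x| + `|y - x| * A); last by ring.
  by apply: lerD; [apply: lip; lia | rewrite ler_wpM2l // bound //; lia].
- move=> j x y jm; apply: (le_powers al (normr_ge0 (y - x)) _).2; first by rewrite mulr_ge0.
    apply: le_trans (lip _ _ _ _) _; first lia.
    by rewrite ler_wpM2r //; lra.
  apply: le_trans (ler_normB _ _) _.
  by rewrite (_ : 2 * A = A + A); [apply: lerD; apply: bound; lia | ring].
- move=> j x y jm; apply: le_trans (lip _ _ _ _) _; first lia.
  by rewrite ler_wpM2r //; lra.
Qed.

End SmoothStep.


(** A positive exponent [alpha] at least the fractional part of [k] serves both clauses of
    [class_C]: it gives continuity, and on the unit interval, where distances are at most 1, the
    weaker Hölder exponent. *)
Lemma class_C_of_taylor (R : realType) (k alpha K : R) (f : R -> R) (g : nat -> R -> R) :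
  0 < alpha -> 0 <= k - (Num.truncn k)%:R <= alpha -> 0 <= K -> {in `[0, 1], g 0%N =1 f} ->
  (forall j x y, (j < Num.truncn k)%N ->
    `|g j y - g j x - (y - x) * g j.+1 x| <= K * `|y - x| `^ (1 + alpha)) ->
  (forall x y, `|g (Num.truncn k) y - g (Num.truncn k) x| <= K * `|y - x| `^ alpha) ->
  class_C k f.
Proof.
move=> al0 /andP[km0 kma] K0 gf taylor holder.
have small e : 0 < e -> exists2 d, 0 < d & forall z : R, 0 <= z -> z < d -> K * z `^ alpha < e.
  move=> e0; have K1 : 0 < K + 1 by lra.
  exists ((e / (K + 1)) `^ alpha^-1); first by rewrite powR_gt0 // divr_gt0.
  move=> z z0 zd; have : z `^ alpha <= e / (K + 1).
    have le : z `^ alpha <= ((e / (K + 1)) `^ alpha^-1) `^ alpha.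
      by apply: ge0_ler_powR; rewrite ?nnegrE ?powR_ge0 // ltW.
    by move: le; rewrite -powRrM mulVf ?gt_eqF // powRr1 // divr_ge0 // ltW.
  rewrite ler_pdivlMr // => h; have := powR_ge0 z alpha; nra.
exists g; split=> // [j jm|].
  apply/deriv01P => x x01 e e0; have [d d0 hd] := small e e0; exists d => // y y01 yx.
  rewrite [g j.+1 x * _]mulrC; apply: le_trans (taylor _ _ _ jm) _.
  have [->|neq] := eqVneq y x.
    by rewrite subrr normr0 mulr0 powR0 ?mulr0 // gt_eqF //; lra.
  have z0 : `|y - x| != 0 by rewrite normr_eq0 subr_eq0.
  rewrite powRD ?z0 ?implybT // powRr1 // mulrCA [e * _]mulrC ler_wpM2l //.
  by rewrite ltW // hd.
case: ifP => _.
  move=> x; apply: continuous_subspaceT => {}x; apply/cvgrPdist_lt => e e0.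
  have [d d0 hd] := small e e0; apply/nbhs_ballP; exists d => //= y; rewrite /ball /= => xy.
  by apply: le_lt_trans (holder _ _) _; apply: hd.
exists K => x y x01 y01; apply: le_trans (holder _ _) _; rewrite ler_wpM2l //.
have xy1 : `|x - y| <= 1.
  by move: x01 y01; rewrite !in_itv /= => /andP[? ?] /andP[? ?]; rewrite ler_norml; lra.
have [km|km] := eqVneq (k - (Num.truncn k)%:R) 0.
  rewrite km powRr0 -(powRr0 `|x - y|).
  have [->|xy0] := eqVneq `|x - y| 0; first by rewrite powR0 ?gt_eqF // powRr0.
  by apply: ger_powR; rewrite ?(ltW al0) // xy1 lt_neqAle eq_sym xy0 normr_ge0.
have [->|xy0] := eqVneq `|x - y| 0; first by rewrite !powR0 // gt_eqF.
by apply: ger_powR => //; rewrite xy1 lt_neqAle eq_sym xy0 normr_ge0.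
Qed.


(** * Addresses, lengths and positions *)

Section Words.
Implicit Types v w : seq bool.

Lemma words_split v w : [\/ exists u, w = v ++ u, exists u, v = w ++ u |
  exists p a u u', v = p ++ a :: u /\ w = p ++ (~~ a) :: u'].
Proof.
elim: v w => [|a v IH] [|b w]; first by apply: Or31; exists [::].
- by apply: Or31; exists (b :: w).
- by apply: Or32; exists (a :: v).
have [->|ab] := eqVneq a b.
  have [[u ->]|[u ->]|[p [d [u [u' [-> ->]]]]]] := IH w.
  - by apply: Or31; exists u.
  - by apply: Or32; exists u.
  - by apply: Or33; exists (b :: p), d, u, u'.
apply: Or33; exists [::], a, v, w; split => //=.
by case: a b ab => -[].
Qed.

End Words.

Section Geometry.
Variables (R : realType) (lam mu c : R) (act : pred (seq bool)).
Implicit Types (v w u : seq bool) (x y : R).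

(* Words are addresses whose first letter is the coarsest one.  For every active
   word [v] the left branch lengthens both children of the interval of address
   [v] by [amp v]; [tau w] is the lengthening of the interval of address [w]. *)
Definition amp v : R := c * mu ^+ size v.

Definition tau w : R :=
  if w is _ :: _ then (if act (take (size w).-1 w) then amp (take (size w).-1 w) else 0) else 0.

(** The recursion removes the coarsest letter, that is, the map applied last. It describes the
    lengths that the branches must realise without mentioning the branches. *)
Fixpoint len w : R :=
  match w with
  | [::] => 1
  | a :: w' => lam * (len w' + if a then 0 else tau w')
  end.

Definition child w : R := len (rcons w true).

Definition gap w : R := len w - 2 * child w.

Definition pos w : R :=
  \sum_(i < size w) if nth false w i then len (take i w) - child (take i w) else 0.

(* The displacement of the left end of the interval of address [w]. *)
Definition shift w : R :=
  \sum_(i < size w) if nth false w i then tau (take i w) - tau (rcons (take i w) true) else 0.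

Lemma tau_rcons v a : tau (rcons v a) = if act v then amp v else 0.
Proof.
rewrite /tau; case E: (rcons v a) => [|b s]; first by case: v E.
by rewrite -E size_rcons /= -cats1 take_size_cat.
Qed.

Lemma len_rcons w a : len (rcons w a) = child w.
Proof.
rewrite /child; elim: w => [|b w IH] /=; first by case: a; rewrite /tau addr0.
by rewrite IH !tau_rcons.
Qed.

Lemma sum_rcons (F : seq bool -> R) w a :
  \sum_(i < size (rcons w a)) (if nth false (rcons w a) i then F (take i (rcons w a)) else 0) =
  \sum_(i < size w) (if nth false w i then F (take i w) else 0) + if a then F w else 0.
Proof.
rewrite size_rcons big_ord_recr /= nth_rcons ltnn eqxx -cats1 take_size_cat //; congr (_ + _).
by apply: eq_bigr => i _; rewrite nth_cat takel_cat // ?ltn_ord // ltnW.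
Qed.

Lemma pos_rcons w a : pos (rcons w a) = pos w + if a then len w - child w else 0.
Proof. exact: (sum_rcons (fun w => len w - child w)). Qed.

Lemma shift_rcons w a :
  shift (rcons w a) = shift w + if a then tau w - tau (rcons w true) else 0.
Proof. exact: (sum_rcons (fun w => tau w - tau (rcons w true))). Qed.

Lemma pos_true w : pos (true :: w) = lam * pos w + 1 - lam.
Proof.
have -> : lam * pos w + 1 - lam = (1 - lam) + lam * pos w by ring.
rewrite /pos [size _]/= big_ord_recl; congr (_ + _); first by rewrite /= /child /= addr0 mulr1.
rewrite mulr_sumr; apply: eq_bigr => i _; rewrite /=; case: ifP => _; rewrite ?mulr0 //.
by rewrite /child /= !addr0 mulrBr.
Qed.

(** Before scaling, the left branch has to move the left end of the interval of address [w] by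
    [shift w]; this is the value prescribed for the perturbation there. *)
Lemma pos_false w : pos (false :: w) = lam * (pos w + shift w).
Proof.
rewrite /pos /shift [size _]/= big_ord_recl add0r -big_split mulr_sumr.
apply: eq_bigr => i _; rewrite /=; case: ifP => _; rewrite ?addr0 ?mulr0 // /child /=; ring.
Qed.

Hypotheses (lam0 : 0 < lam) (lam2 : 2 * lam < 1) (mu0 : 0 < mu) (mulam : mu < lam) (c0 : 0 <= c).
Hypothesis csmall : 4 * lam * c <= (1 - 2 * lam) * (lam - mu).
Hypothesis antichain : forall v u, act v -> act (v ++ u) -> u = [::].

Lemma amp_ge0 v : 0 <= amp v.
Proof. by rewrite mulr_ge0 // exprn_ge0 // ltW. Qed.

Lemma tau_ge0 w : 0 <= tau w.
Proof. by case: w => //= a w; case: ifP => // _; exact: amp_ge0. Qed.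

Lemma len_ge w : lam ^+ size w <= len w.
Proof.
elim: w => [|a w IH] /=; first by rewrite expr0.
rewrite exprS ler_wpM2l ?(ltW lam0) //; apply: le_trans IH _; rewrite lerDl.
by case: a => //; exact: tau_ge0.
Qed.

Lemma len_gt0 w : 0 < len w.
Proof. by apply: lt_le_trans (len_ge w); rewrite exprn_gt0. Qed.

Definition len_bound : R := 1 + lam * c / (mu * (lam - mu)).

Lemma len_bound_ge1 : 1 <= len_bound.
Proof. by rewrite lerDl divr_ge0 // mulr_ge0 ?(ltW lam0) ?(ltW mu0) // subr_ge0 ltW. Qed.

Lemma len_le w : len w <= len_bound * lam ^+ size w.
Proof.
pose B := lam * c / (mu * (lam - mu)).
have lm : 0 < lam - mu by rewrite subr_gt0.
have B0 : 0 <= B by rewrite divr_ge0 // mulr_ge0 ?(ltW lam0) ?(ltW mu0) // ltW.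
have BE : B * mu * (lam - mu) = lam * c.
  by rewrite /B; field; rewrite !gt_eqF.
(* The subtracted term makes the induction close: [B] is the solution of
   [lam * (c / mu - B) = - B * mu]. *)
suff H : len w <= (1 + B) * lam ^+ size w - B * mu ^+ size w.
  apply: le_trans H _; rewrite /len_bound -/B lerBlDr lerDl mulr_ge0 // exprn_ge0 // ltW //.
elim: w => [|a w IH]; first by rewrite !expr0 [len _]/=; lra.
rewrite [len _]/= [size _]/=.
have tw : (if a then 0 else tau w) <= c / mu * mu ^+ size w.
  have t0 : 0 <= c / mu * mu ^+ size w by rewrite mulr_ge0 ?divr_ge0 ?exprn_ge0 // ltW.
  case: a => //; case: w {IH} t0 => //= b w t0; case: ifP => // _.
  rewrite /amp size_takel //= exprS mulrA divfK ?gt_eqF //.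
apply: (@le_trans _ _ (lam * ((1 + B) * lam ^+ size w - B * mu ^+ size w + c / mu * mu ^+ size w))).
  by rewrite ler_wpM2l ?(ltW lam0) // lerD.
have -> : lam * ((1 + B) * lam ^+ size w - B * mu ^+ size w + c / mu * mu ^+ size w) =
  (1 + B) * lam ^+ (size w).+1 + (lam * (c / mu - B)) * mu ^+ size w by rewrite exprS; ring.
have -> : lam * (c / mu - B) = - B * mu.
  have -> : c = B * mu * (lam - mu) / lam by rewrite BE [lam * c]mulrC mulfK // gt_eqF.
  by field; rewrite !gt_eqF.
by rewrite [leRHS](_ : _ = (1 + B) * lam ^+ (size w).+1 + - B * mu * mu ^+ size w) // !exprS; ring.
Qed.

Definition gap_bound : R := (1 - 2 * lam) / 2.

Lemma gap_bound_gt0 : 0 < gap_bound.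
Proof. by rewrite /gap_bound; have := lam2; lra. Qed.

Lemma gap_true w : gap (true :: w) = lam * gap w.
Proof. by rewrite /gap /child /= !addr0; ring. Qed.

Lemma gap_false w : gap (false :: w) = lam * (gap w + tau w - 2 * tau (rcons w true)).
Proof. by rewrite /gap /child /=; ring. Qed.

Lemma gap_ge w : gap_bound * lam ^+ size w <= gap w.
Proof.
pose B := 2 * lam * c / (lam - mu).
have lm : 0 < lam - mu by rewrite subr_gt0.
have B0 : 0 <= B by rewrite divr_ge0 ?(ltW lm) // !mulr_ge0 // ltW.
have BE : B * (lam - mu) = 2 * lam * c by rewrite divfK // gt_eqF.
have Bs : 2 * B <= 1 - 2 * lam.
  by rewrite -(ler_pM2r lm) -mulrA BE; have := csmall; lra.
(* Again a correction in [mu ^+ n] closes the induction. Here [csmall] means [2 * B <= 1 - 2 * lam],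
   so half of the unperturbed gap survives, whence [gap_bound]. *)
suff H : (1 - 2 * lam - B) * lam ^+ size w + B * mu ^+ size w <= gap w.
  apply: le_trans H; have h1 : 0 <= lam ^+ size w by rewrite exprn_ge0 // ltW.
  have h2 : 0 <= B * mu ^+ size w by rewrite mulr_ge0 // exprn_ge0 // ltW.
  have : gap_bound * lam ^+ size w <= (1 - 2 * lam - B) * lam ^+ size w.
    by rewrite ler_wpM2r // /gap_bound; lra.
  lra.
elim: w => [|a w IH].
  by rewrite /gap /child /= !expr0 addr0; lra.
have p0 : 0 <= B * mu ^+ size w by rewrite mulr_ge0 // exprn_ge0 // ltW.
case: a => /=.
  rewrite gap_true; apply: le_trans (ler_wpM2l (ltW lam0) IH).
  rewrite !exprS; have : mu * (B * mu ^+ size w) <= lam * (B * mu ^+ size w).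
    by rewrite ler_wpM2r // ltW.
  lra.
rewrite gap_false.
have tw : tau (rcons w true) <= c * mu ^+ size w.
  by rewrite tau_rcons; case: ifP => // _; exact: (amp_ge0 w).
apply: (@le_trans _ _ (lam * ((1 - 2 * lam - B) * lam ^+ size w + B * mu ^+ size w - 2 * (c * mu ^+ size w)))).
  have -> : lam * ((1 - 2 * lam - B) * lam ^+ size w + B * mu ^+ size w - 2 * (c * mu ^+ size w)) =
    (1 - 2 * lam - B) * (lam * lam ^+ size w) + (lam * B - 2 * lam * c) * mu ^+ size w by ring.
  rewrite -BE !exprS; lra.
rewrite ler_wpM2l ?(ltW lam0) //; have := tau_ge0 w; lra.
Qed.

Lemma gap_gt0 w : 0 < gap w.
Proof. by apply: lt_le_trans (gap_ge w); rewrite mulr_gt0 ?gap_bound_gt0 // exprn_gt0. Qed.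

Lemma child_gt0 w : 0 < child w.
Proof. exact: len_gt0. Qed.

Definition inJ w x : Prop := pos w <= x <= pos w + len w.

Lemma inJ_left w : inJ w (pos w).
Proof. by rewrite /inJ lexx lerDl ltW // len_gt0. Qed.

Lemma inJ_right w : inJ w (pos w + len w).
Proof. by rewrite /inJ lexx lerDl ltW // len_gt0. Qed.

Lemma rcons_sub w a : pos w <= pos (rcons w a) /\
  pos (rcons w a) + len (rcons w a) <= pos w + len w.
Proof.
rewrite pos_rcons len_rcons; have := gap_gt0 w; have := child_gt0 w.
by rewrite /gap; case: a; lra.
Qed.

Lemma cat_sub w u : pos w <= pos (w ++ u) /\ pos (w ++ u) + len (w ++ u) <= pos w + len w.
Proof.
elim/last_ind: u => [|u a [IH1 IH2]]; first by rewrite cats0; lra.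
rewrite -rcons_cat; have := rcons_sub (w ++ u) a; lra.
Qed.

Lemma inJ_cat w u x : inJ (w ++ u) x -> inJ w x.
Proof. by have := cat_sub w u; rewrite /inJ => -[h1 h2] /andP[h3 h4]; apply/andP; split; lra. Qed.

Lemma inJ_gap p u u' x y : inJ (p ++ false :: u) x -> inJ (p ++ true :: u') y -> x + gap p <= y.
Proof.
rewrite -!cat_rcons => /inJ_cat /andP[_ hx] /inJ_cat /andP[hy _].
by move: hx hy; rewrite !pos_rcons !len_rcons /gap; lra.
Qed.

Lemma inJ_diff p a u u' x : inJ (p ++ a :: u) x -> inJ (p ++ (~~ a) :: u') x -> False.
Proof.
have g := gap_gt0 p.
by case: a => /= h1 h2; [have := inJ_gap h2 h1 | have := inJ_gap h1 h2]; lra.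
Qed.

Lemma inJ_same_size v w x : size v = size w -> inJ v x -> inJ w x -> v = w.
Proof.
move=> sz hv hw; have [[u e]|[u e]|[p [a [u [u' [e e']]]]]] := words_split v w.
- by move: sz; rewrite e size_cat => /esym/eqP; rewrite -[X in _ == X]addn0 eqn_add2l => /nilP ->; rewrite cats0.
- by move: sz; rewrite e size_cat => /eqP; rewrite -[X in _ == X]addn0 eqn_add2l => /nilP ->; rewrite cats0.
- by move: hv hw; rewrite e e' => hv /(inJ_diff hv).
Qed.

Lemma act_unique v w x : act v -> act w -> inJ v x -> inJ w x -> v = w.
Proof.
move=> av aw hv hw; have [[u e]|[u e]|[p [a [u [u' [e e']]]]]] := words_split v w.
- by move: aw; rewrite e => /(antichain av) ->; rewrite cats0.
- by move: av; rewrite e => /(antichain aw) ->; rewrite cats0.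
- by move: hv hw; rewrite e e' => hv /(inJ_diff hv).
Qed.

Lemma shift_inactive w : (forall v u, act v -> w = v ++ u -> u = [::]) -> shift w = 0.
Proof.
elim/last_ind: w => [_|w a IH hw]; first by rewrite /shift big_ord0.
have nact v u : act v -> w = v ++ u -> False.
  by move=> av e; have := hw v (rcons u a) av; rewrite e rcons_cat => /(_ erefl); case: (u).
rewrite shift_rcons IH; last by move=> v u av /(nact v u av).
have aw : act w = false by apply/negP => aw; apply: (nact w [::] aw); rewrite cats0.
rewrite tau_rcons aw subr0 add0r; case: a {hw} => //.
elim/last_ind: w nact {IH aw} => // w b _ nact; rewrite tau_rcons; case: ifP => // aw.
by case: (nact w [:: b] aw); rewrite cats1.
Qed.

Lemma tau_inactive w : (forall v u, act v -> w = v ++ u -> u = [::]) -> tau w = 0.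
Proof.
case/lastP: w => // w b hw; rewrite tau_rcons; case: ifP => // aw.
by have := hw w [:: b] aw; rewrite cats1 => /(_ erefl).
Qed.

Lemma tau_act v : act v -> tau v = 0.
Proof.
move=> av; apply: tau_inactive => v' u av' e; apply: antichain av' _.
by rewrite -e.
Qed.

Lemma shift_act1 v a : act v -> shift (rcons v a) = if a then - amp v else 0.
Proof.
move=> av; rewrite shift_rcons tau_act // tau_rcons av shift_inactive ?add0r; last first.
  by move=> v' u av' e; apply: antichain av' _; rewrite -e.
by case: a; rewrite ?sub0r.
Qed.

Lemma act_false v b u : act v -> act (v ++ b :: u) = false.
Proof. by move=> av; apply/negP => /(antichain av). Qed.

(** By incomparability no word below [v] is active, so the displacement is constant on each
    grandchild: from left to right 0, [amp v], [- amp v], 0. These are the plateaus of the bump. *)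
Lemma shift_act2 v a b u : act v ->
  shift (v ++ [:: a, b & u]) = (if b then amp v else 0) - (if a then amp v else 0) /\
  tau (v ++ [:: a, b & u]) = 0.
Proof.
move=> av; elim/last_ind: u => [|u d [IH1 IH2]].
  have -> : v ++ [:: a; b] = rcons (rcons v a) b by rewrite -cats1 cat_rcons.
  rewrite shift_rcons shift_act1 // !tau_rcons av -cats1 act_false //.
  by split=> //; case: a; case: b; ring.
have -> : v ++ [:: a, b & rcons u d] = rcons (v ++ [:: a, b & u]) d by rewrite rcons_cat.
rewrite shift_rcons IH1 IH2 !tau_rcons act_false //; split=> //.
by case: d; rewrite ?subr0 addr0.
Qed.



(** * The perturbation *)

Variables (m : nat) (alpha : R) (Psi : nat -> R -> R) (A : R).
Hypotheses (m1 : (0 < m)%N) (alpha01 : 0 < alpha <= 1) (muE : mu = lam `^ (m%:R + alpha)).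
Hypotheses (A0 : 0 <= A)
  (Psi_left : forall x, x <= 0 -> Psi 0%N x = 0)
  (Psi_right : forall x, 1 <= x -> Psi 0%N x = 1)
  (Psi_flat : forall j x, (0 < j <= m.+1)%N -> x <= 0 \/ 1 <= x -> Psi j x = 0)
  (Psi_taylor : forall j x y, (j <= m)%N ->
    `|Psi j y - Psi j x - (y - x) * Psi j.+1 x| <= A * `|y - x| `^ (1 + alpha))
  (Psi_holder : forall j x y, (j <= m)%N -> `|Psi j y - Psi j x| <= A * `|y - x| `^ alpha)
  (Psi_lip : forall j x y, (j <= m)%N -> `|Psi j y - Psi j x| <= A * `|y - x|).

(** The [j]-th derivative of the step that rises from 0 to 1 across the interval of length [g]
    starting at [s]. *)
Definition piece (j : nat) (s g x : R) : R := Psi j ((x - s) / g) / g ^+ j.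

Lemma piece_left j s g x : (j <= m.+1)%N -> 0 < g -> x <= s -> piece j s g x = 0.
Proof.
move=> jm g0 xs; have le : (x - s) / g <= 0 by rewrite pmulr_lle0 ?invr_gt0 // subr_le0.
rewrite /piece; case: j jm => [|j] jm; first by rewrite Psi_left // mul0r.
by rewrite Psi_flat ?mul0r //; left.
Qed.

Lemma piece0_right s g x : 0 < g -> s + g <= x -> piece 0 s g x = 1.
Proof.
move=> g0 sx; rewrite /piece Psi_right ?expr0 ?divr1 // ler_pdivlMr // mul1r; lra.
Qed.

Lemma piece_right j s g x : (0 < j <= m.+1)%N -> 0 < g -> s + g <= x -> piece j s g x = 0.
Proof.
move=> jm g0 sx; rewrite /piece Psi_flat ?mul0r //; right.
by rewrite ler_pdivlMr // mul1r; lra.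
Qed.

Lemma powR_div (z g s : R) : 0 <= z -> 0 < g -> (z / g) `^ s = z `^ s / g `^ s.
Proof. by move=> z0 g0; rewrite powRM ?invr_ge0 ?(ltW g0) // -powR_inv1 ?(ltW g0) // -powRrM mulN1r powRN. Qed.

Lemma piece_taylor j s g x y : (j <= m)%N -> 0 < g ->
  `|piece j s g y - piece j s g x - (y - x) * piece j.+1 s g x|
  <= A * `|y - x| `^ (1 + alpha) / g `^ (1 + alpha + j%:R).
Proof.
move=> jm g0; have gj : 0 < g ^+ j by rewrite exprn_gt0.
have d : (y - s) / g - (x - s) / g = (y - x) / g by rewrite -mulrBl; congr (_ / _); ring.
have -> : piece j s g y - piece j s g x - (y - x) * piece j.+1 s g x =
  (Psi j ((y - s) / g) - Psi j ((x - s) / g) - ((y - s) / g - (x - s) / g) * Psi j.+1 ((x - s) / g)) / g ^+ j.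
  by rewrite d /piece exprS; field; rewrite !gt_eqF.
rewrite normrM [`|_^-1|]gtr0_norm ?invr_gt0 // ler_pdivrMr //.
apply: le_trans (Psi_taylor _ _ jm) _; rewrite d normrM [`|g^-1|]gtr0_norm ?invr_gt0 //.
rewrite powR_div // [g `^ (_ + j%:R)]powRD ?(gt_eqF g0) ?implybT // powR_mulrn ?(ltW g0) //.
by rewrite invfM -!mulrA mulVf ?gt_eqF // mulr1.
Qed.

Lemma piece_holder j s g x y : (j <= m)%N -> 0 < g ->
  `|piece j s g y - piece j s g x| <= A * `|y - x| `^ alpha / g `^ (alpha + j%:R).
Proof.
move=> jm g0; have gj : 0 < g ^+ j by rewrite exprn_gt0.
have d : (y - s) / g - (x - s) / g = (y - x) / g by rewrite -mulrBl; congr (_ / _); ring.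
rewrite /piece -mulrBl normrM [`|_^-1|]gtr0_norm ?invr_gt0 // ler_pdivrMr //.
apply: le_trans (Psi_holder _ _ jm) _; rewrite d normrM [`|g^-1|]gtr0_norm ?invr_gt0 //.
rewrite powR_div // [g `^ (_ + j%:R)]powRD ?(gt_eqF g0) ?implybT // powR_mulrn ?(ltW g0) //.
by rewrite invfM -!mulrA mulVf ?gt_eqF // mulr1.
Qed.

Lemma piece_lip s g x y : 0 < g -> `|piece 0 s g y - piece 0 s g x| <= A * `|y - x| / g.
Proof.
move=> g0; rewrite /piece expr0 !divr1; apply: le_trans (Psi_lip _ _ (leq0n m)) _.
rewrite (_ : (y - s) / g - _ = (y - x) / g); last by rewrite -mulrBl; congr (_ / _); ring.
by rewrite normrM [`|g^-1|]gtr0_norm ?invr_gt0 // mulrA.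
Qed.

Definition bump_bound : R := c / (gap_bound * lam) `^ (m%:R + alpha).

Lemma bump_bound_ge0 : 0 <= bump_bound.
Proof. by rewrite divr_ge0 // powR_ge0. Qed.

(** The balance behind [muE]: the amplitude [c * mu ^+ n], divided by the power [m + alpha] of a gap
    of size [lam ^+ n], does not depend on the depth. Lower powers are harmless because the lower
    bound for the gap is at most 1. *)
Lemma scale_bound v g s : gap_bound * lam ^+ (size v).+1 <= g -> 0 <= s <= m%:R + alpha ->
  amp v / g `^ s <= bump_bound.
Proof.
move=> gg /andP[s0 sm]; set t := gap_bound * _ in gg.
have gb := gap_bound_gt0; have ll := lam2; have l0 := lam0.
have t0 : 0 < t by rewrite mulr_gt0 // exprn_gt0.
have t1 : t <= 1.
  rewrite mulr_ile1 ?(ltW gb) ?exprn_ge0 ?(ltW lam0) //; first by rewrite /gap_bound; lra.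
  by rewrite exprn_ile1 ?(ltW lam0) //; lra.
have g0 : 0 < g by apply: lt_le_trans gg.
have al0 : 0 < alpha by case/andP: alpha01.
have sm0 : 0 <= m%:R + alpha by rewrite addr_ge0 // ltW.
apply: (@le_trans _ _ (amp v / t `^ (m%:R + alpha))).
  rewrite ler_wpM2l ?amp_ge0 // lef_pV2 ?posrE ?powR_gt0 //.
  apply: (@le_trans _ _ (t `^ s)); first by apply: ger_powR; rewrite ?t0.
  by apply: ge0_ler_powR => //; rewrite nnegrE ltW.
have -> : t `^ (m%:R + alpha) = (gap_bound * lam) `^ (m%:R + alpha) * mu ^+ size v.
  have gl0 : 0 <= gap_bound * lam by rewrite mulr_ge0 // ltW.
  have ln0 : 0 <= lam ^+ size v by rewrite exprn_ge0 // ltW.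
  have -> : t = gap_bound * lam * lam ^+ size v by rewrite /t exprS mulrA.
  rewrite (powRM _ gl0 ln0).
  congr (_ * _).
  rewrite -powR_mulrn ?(ltW lam0) // -powRrM mulrC powRrM -muE powR_mulrn //; exact: ltW.
rewrite /bump_bound /amp invfM mulrA [X in X / _]mulrAC mulfK ?gt_eqF //; exact: exprn_gt0.
Qed.

Definition gstart w : R := pos w + child w.

(* Steps [+1, -2, +1] across the gaps of the two children and of [v]: the bump
   vanishes outside [J_v] and is constant on the four grandchildren. *)
Definition bump v (j : nat) x : R :=
  amp v * (piece j (gstart (rcons v false)) (gap (rcons v false)) x
           - 2 * piece j (gstart v) (gap v) x
           + piece j (gstart (rcons v true)) (gap (rcons v true)) x).

Lemma gap_scale v : gap_bound * lam ^+ (size v).+1 <= gap v /\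
  forall a, gap_bound * lam ^+ (size v).+1 <= gap (rcons v a).
Proof.
split=> [|a]; last by rewrite -(size_rcons v a) gap_ge.
apply: le_trans (gap_ge v); rewrite ler_wpM2l ?(ltW gap_bound_gt0) // exprS.
by rewrite ler_piMl ?exprn_ge0 ?(ltW lam0) //; have := lam2; have := lam0; lra.
Qed.

Lemma combine3 (a p q r P Q : R) : 0 <= a -> `|p| <= P -> `|q| <= P -> `|r| <= P -> a * P <= Q ->
  `|a * (p - 2 * q + r)| <= 4 * Q.
Proof.
move=> a0 hp hq hr aP; rewrite normrM (ger0_norm a0).
apply: (@le_trans _ _ (a * (4 * P))); last by rewrite mulrCA ler_wpM2l.
rewrite ler_wpM2l //; have h1 := ler_normD (p - 2 * q) r; have h2 := ler_normB p (2 * q).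
by rewrite normrM (ger0_norm (ler0n _ 2)) in h2; lra.
Qed.

Lemma bump_taylor v j x y : (j < m)%N ->
  `|bump v j y - bump v j x - (y - x) * bump v j.+1 x|
  <= 4 * (A * `|y - x| `^ (1 + alpha) * bump_bound).
Proof.
move=> jm; pose T w := piece j (gstart w) (gap w) y - piece j (gstart w) (gap w) x
  - (y - x) * piece j.+1 (gstart w) (gap w) x.
have -> : bump v j y - bump v j x - (y - x) * bump v j.+1 x =
  amp v * (T (rcons v false) - 2 * T v + T (rcons v true)) by rewrite /bump /T; ring.
have al0 : 0 < alpha by case/andP: alpha01.
have P0 : 0 <= A * `|y - x| `^ (1 + alpha) by rewrite mulr_ge0 ?powR_ge0.
pose t := gap_bound * lam ^+ (size v).+1.
have t0 : 0 < t by rewrite mulr_gt0 ?gap_bound_gt0 // exprn_gt0.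
have [gv gva] := gap_scale v.
have TP w : t <= gap w -> `|T w| <= A * `|y - x| `^ (1 + alpha) / t `^ (1 + alpha + j%:R).
  move=> tw; apply: le_trans (piece_taylor _ _ _ (ltnW jm) (gap_gt0 w)) _.
  rewrite ler_wpM2l // lef_pV2 ?posrE ?powR_gt0 ?gap_gt0 //.
  apply: ge0_ler_powR => //; rewrite ?nnegrE ?(ltW t0) ?(ltW (gap_gt0 _)) //.
  by rewrite !addr_ge0 // ltW.
apply: (combine3 (amp_ge0 v) (TP _ _) (TP _ _) (TP _ _)) => //.
rewrite mulrCA ler_wpM2l //; apply: scale_bound => //.
have : (j.+1)%:R <= m%:R :> R by rewrite ler_nat.
have : 0 <= j%:R :> R by [].
by rewrite -natr1 => h1 h2; apply/andP; split; lra.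
Qed.

Lemma bump_holder v x y :
  `|bump v m y - bump v m x| <= 4 * (A * `|y - x| `^ alpha * bump_bound).
Proof.
pose T w := piece m (gstart w) (gap w) y - piece m (gstart w) (gap w) x.
have -> : bump v m y - bump v m x =
  amp v * (T (rcons v false) - 2 * T v + T (rcons v true)) by rewrite /bump /T; ring.
have al0 : 0 < alpha by case/andP: alpha01.
have P0 : 0 <= A * `|y - x| `^ alpha by rewrite mulr_ge0 ?powR_ge0.
pose t := gap_bound * lam ^+ (size v).+1.
have t0 : 0 < t by rewrite mulr_gt0 ?gap_bound_gt0 // exprn_gt0.
have [gv gva] := gap_scale v.
have TP w : t <= gap w -> `|T w| <= A * `|y - x| `^ alpha / t `^ (alpha + m%:R).
  move=> tw; apply: le_trans (piece_holder _ _ _ (leqnn m) (gap_gt0 w)) _.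
  rewrite ler_wpM2l // lef_pV2 ?posrE ?powR_gt0 ?gap_gt0 //.
  apply: ge0_ler_powR => //; rewrite ?nnegrE ?(ltW t0) ?(ltW (gap_gt0 _)) //.
  by rewrite !addr_ge0 // ltW.
apply: (combine3 (amp_ge0 v) (TP _ _) (TP _ _) (TP _ _)) => //.
rewrite mulrCA ler_wpM2l //; apply: scale_bound => //.
by rewrite addr_ge0 ?(ltW al0) //= addrC.
Qed.

(** Since [mu < lam], the slopes are bounded by a multiple of [c]. Taking [c] small then makes the
    left branch an increasing contraction. *)
Lemma bump_lip v x y :
  `|bump v 0 y - bump v 0 x| <= 4 * (A * `|y - x| * (c / (gap_bound * lam))).
Proof.
pose T w := piece 0 (gstart w) (gap w) y - piece 0 (gstart w) (gap w) x.
have -> : bump v 0 y - bump v 0 x =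
  amp v * (T (rcons v false) - 2 * T v + T (rcons v true)) by rewrite /bump /T; ring.
have P0 : 0 <= A * `|y - x| by rewrite mulr_ge0.
pose t := gap_bound * lam ^+ (size v).+1.
have t0 : 0 < t by rewrite mulr_gt0 ?gap_bound_gt0 // exprn_gt0.
have [gv gva] := gap_scale v.
have TP w : t <= gap w -> `|T w| <= A * `|y - x| / t.
  move=> tw; apply: le_trans (piece_lip _ _ _ (gap_gt0 w)) _.
  by rewrite ler_wpM2l // lef_pV2 ?posrE ?gap_gt0.
apply: (combine3 (amp_ge0 v) (TP _ _) (TP _ _) (TP _ _)) => //.
have gl : 0 < gap_bound * lam by rewrite mulr_gt0 // gap_bound_gt0.
rewrite mulrCA ler_wpM2l // ler_pdivrMr // /t exprS mulrA [leRHS]mulrA divfK ?gt_eqF //.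
by rewrite ler_wpM2l // lerXn2r ?nnegrE ?(ltW lam0) ?(ltW mu0) // ltW.
Qed.

Lemma gstart_false v : gstart v = pos (rcons v false) + len (rcons v false).
Proof. by rewrite /gstart pos_rcons len_rcons addr0. Qed.

Lemma gstart_gap v : gstart v + gap v = pos (rcons v true).
Proof. by rewrite /gstart /gap pos_rcons; ring. Qed.

Lemma gstart_le v : pos v <= gstart v /\ gstart v <= pos (rcons v true) /\
  pos (rcons v true) <= pos v + len v.
Proof.
have := child_gt0 v; have := gap_gt0 v; rewrite -gstart_gap /gstart /gap => h1 h2; lra.
Qed.

Lemma bump_order v :
  gstart (rcons v false) + gap (rcons v false) <= gstart v /\
  gstart v + gap v <= gstart (rcons v true).
Proof.
rewrite !gstart_gap; split.
  by rewrite gstart_false; exact: (gstart_le _).2.2.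
exact: (gstart_le _).1.
Qed.

Lemma bump_left v j x : (j <= m.+1)%N -> x <= gstart (rcons v false) -> bump v j x = 0.
Proof.
move=> jm xs; have [ord1 ord2] := bump_order v.
have g := gap_gt0 v; have gap1 := gap_gt0 (rcons v false).
by rewrite /bump !piece_left ?gap_gt0 //; [ring | lra | lra].
Qed.

Lemma bump_right v j x : (j <= m.+1)%N -> pos (rcons (rcons v true) true) <= x -> bump v j x = 0.
Proof.
rewrite -gstart_gap => jm xs; have [ord1 ord2] := bump_order v.
have g := gap_gt0 v; have gap1 := gap_gt0 (rcons v true).
rewrite /bump; case: j jm => [|j] jm.
  by rewrite !piece0_right ?gap_gt0 //; [ring | lra | lra].
by rewrite !piece_right ?gap_gt0 //; [ring | lra | lra].
Qed.

Lemma bump_plateau_false v x : pos (rcons (rcons v false) true) <= x -> x <= gstart v ->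
  bump v 0 x = amp v.
Proof.
rewrite -gstart_gap => h1 h2; have [ord1 ord2] := bump_order v; have g := gap_gt0 v.
rewrite /bump piece0_right ?gap_gt0 // !piece_left ?gap_gt0 //; [ring | lra].
Qed.

Lemma bump_plateau_true v x : pos (rcons v true) <= x -> x <= gstart (rcons v true) ->
  bump v 0 x = - amp v.
Proof.
rewrite -gstart_gap => h1 h2; have [ord1 ord2] := bump_order v; have g := gap_gt0 v.
rewrite /bump [piece 0 (gstart (rcons v true)) _ _]piece_left ?gap_gt0 //.
rewrite !piece0_right ?gap_gt0 //; [ring | lra].
Qed.

Lemma bump_outside v j x : (j <= m.+1)%N -> ~ inJ v x -> bump v j x = 0.
Proof.
move=> jm nx; have [xl|xl] := ltP x (pos v).
  apply: bump_left => //; apply: le_trans (ltW xl) _.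
  exact: le_trans (rcons_sub v false).1 (gstart_le _).1.
have [xr|xr] := leP x (pos v + len v); first by case: nx; rewrite /inJ xl xr.
apply: bump_right => //; apply: le_trans (ltW xr).
exact: le_trans (gstart_le _).2.2 (rcons_sub v true).2.
Qed.

Definition pert (j : nat) x : R :=
  if pselect (exists v, act v /\ inJ v x) is left e then bump (projT1 (cid e)) j x else 0.

Lemma pert_active v j x : act v -> inJ v x -> pert j x = bump v j x.
Proof.
move=> av vx; rewrite /pert; case: pselect => [e|]; last by case; exists v.
have [aw wx] := projT2 (cid e).
by rewrite (act_unique aw av wx vx).
Qed.

Lemma pert_inactive j x : ~ (exists v, act v /\ inJ v x) -> pert j x = 0.
Proof. by move=> nv; rewrite /pert; case: pselect. Qed.

(** Two points meet at most two active intervals, and each bump vanishes outside its own, with its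
    derivatives. Estimates for one bump thus pass to the whole perturbation at the cost of a factor
    2. *)
Lemma pert_pair x y : exists2 s : seq (seq bool), (size s <= 2)%N &
  forall j, (j <= m.+1)%N ->
    pert j x = \sum_(v <- s) bump v j x /\ pert j y = \sum_(v <- s) bump v j y.
Proof.
have [[v [av vx]]|nx] := pselect (exists v, act v /\ inJ v x);
have [[w [aw wy]]|ny] := pselect (exists v, act v /\ inJ v y).
- have [vw|vw] := eqVneq v w.
    exists [:: v] => // j jm; rewrite !big_seq1 (pert_active j av vx).
    by rewrite vw (pert_active j aw wy).
  exists [:: v; w] => // j jm; rewrite !big_cons !big_nil !addr0.
  rewrite (pert_active j av vx) (pert_active j aw wy).
  rewrite [bump w j x]bump_outside ?addr0; last 2 first => //.
    by move=> wx; move/eqP: vw; apply; exact: act_unique av aw vx wx.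
  rewrite [bump v j y]bump_outside ?add0r //.
  by move=> vy; move/eqP: vw; apply; exact: act_unique av aw vy wy.
- exists [:: v] => // j jm; rewrite !big_seq1 (pert_active j av vx) (pert_inactive _ ny).
  by rewrite [bump v j y]bump_outside // => vy; apply: ny; exists v.
- exists [:: w] => // j jm; rewrite !big_seq1 (pert_active j aw wy) (pert_inactive _ nx).
  by rewrite [bump w j x]bump_outside // => wx; apply: nx; exists w.
- by exists [::] => // j jm; rewrite !big_nil !pert_inactive.
Qed.

Lemma sum_bound2 (s : seq (seq bool)) (F : seq bool -> R) (Q : R) : (size s <= 2)%N -> 0 <= Q ->
  (forall v, `|F v| <= Q) -> `|\sum_(v <- s) F v| <= 2 * Q.
Proof.
move=> s2 Q0 FQ; apply: le_trans (ler_norm_sum _ _ _) _.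
case: s s2 => [|a [|b []]] //= _; rewrite ?big_cons ?big_nil ?addr0; first lra.
  by have := FQ a; lra.
by have := FQ a; have := FQ b; lra.
Qed.

Lemma pert_taylor j x y : (j < m)%N ->
  `|pert j y - pert j x - (y - x) * pert j.+1 x|
  <= 8 * A * bump_bound * `|y - x| `^ (1 + alpha).
Proof.
move=> jm; have [s s2 hs] := pert_pair x y.
have [-> ->] := hs j (ltnW (leqW jm)); have [-> _] := hs j.+1 (leqW jm).
rewrite mulr_sumr -!sumrB.
have -> : 8 * A * bump_bound * `|y - x| `^ (1 + alpha) =
  2 * (4 * (A * `|y - x| `^ (1 + alpha) * bump_bound)) by ring.
apply: sum_bound2 => //; last by move=> v; exact: bump_taylor.
by rewrite mulr_ge0 // mulr_ge0 ?bump_bound_ge0 // mulr_ge0 ?powR_ge0.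
Qed.

Lemma pert_holder x y :
  `|pert m y - pert m x| <= 8 * A * bump_bound * `|y - x| `^ alpha.
Proof.
have [s s2 hs] := pert_pair x y; have [-> ->] := hs m (leqnSn m).
rewrite -!sumrB.
have -> : 8 * A * bump_bound * `|y - x| `^ alpha =
  2 * (4 * (A * `|y - x| `^ alpha * bump_bound)) by ring.
apply: sum_bound2 => //; last by move=> v; exact: bump_holder.
by rewrite mulr_ge0 // mulr_ge0 ?bump_bound_ge0 // mulr_ge0 ?powR_ge0.
Qed.

Lemma pert_lip x y :
  `|pert 0 y - pert 0 x| <= 8 * A * c / (gap_bound * lam) * `|y - x|.
Proof.
have [s s2 hs] := pert_pair x y; have [-> ->] := hs 0%N (leq0n _).
rewrite -!sumrB.
have -> : 8 * A * c / (gap_bound * lam) * `|y - x| =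
  2 * (4 * (A * `|y - x| * (c / (gap_bound * lam)))) by ring.
apply: sum_bound2 => //; last by move=> v; exact: bump_lip.
rewrite mulr_ge0 // mulr_ge0 //; first by rewrite mulr_ge0.
by rewrite divr_ge0 // mulr_ge0 ?(ltW lam0) ?(ltW gap_bound_gt0).
Qed.


(** * The two branches *)

Definition branch (a : bool) x : R := if a then lam * x + 1 - lam else lam * (x + pert 0 x).

Lemma pert_sub2 v a b u x : act v -> inJ (v ++ [:: a, b & u]) x ->
  pert 0 x = (if b then amp v else 0) - (if a then amp v else 0).
Proof.
move=> av hx; rewrite (pert_active 0 av (inJ_cat hx)).
have {hx} : inJ (rcons (rcons v a) b) x.
  by apply: (@inJ_cat _ u); rewrite -!cats1 -!catA.
rewrite /inJ => /andP[h1 h2]; case: a b h1 h2 => -[] h1 h2.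
- by rewrite bump_right // subrr.
- rewrite sub0r bump_plateau_true //; last by rewrite gstart_false.
  by apply: le_trans h1; exact: (rcons_sub _ _).1.
- rewrite subr0 bump_plateau_false //; apply: le_trans h2 _.
  by rewrite gstart_false; exact: (rcons_sub _ _).2.
- by rewrite subr0 bump_left // gstart_false.
Qed.

(** The smooth perturbation realises the prescribed displacements. Two or more letters below an
    active word the interval lies on a plateau; one letter below, its ends are computed directly;
    otherwise every bump supported inside the interval vanishes at both ends. *)
Lemma pert_ends w : pert 0 (pos w) = shift w /\ pert 0 (pos w + len w) = shift w + tau w.
Proof.
have [[v [a [u [av ->]]]]|nw] := pselect (exists v a u, act v /\ w = v ++ a :: u).
  case: u => [|b u]; last first.
    have [-> ->] := shift_act2 a b u av; rewrite addr0.
    by split; apply: pert_sub2 av _; [exact: inJ_left | exact: inJ_right].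
  rewrite cats1 shift_act1 // tau_rcons av.
  have hl : inJ v (pos (rcons v a)) by apply: (@inJ_cat _ [:: a]); rewrite cats1; exact: inJ_left.
  have hr : inJ v (pos (rcons v a) + len (rcons v a)).
    by apply: (@inJ_cat _ [:: a]); rewrite cats1; exact: inJ_right.
  rewrite (pert_active 0 av hl) (pert_active 0 av hr); case: a {hl hr}; split.
  - by rewrite bump_plateau_true // (gstart_le _).1.
  - rewrite addNr bump_right //; apply: le_trans (rcons_sub (rcons v true) true).2.
    by rewrite lerDl ltW // len_gt0.
  - by rewrite bump_left // (gstart_le _).1.
  - rewrite add0r -gstart_false bump_plateau_false // gstart_false.
    by apply: le_trans (rcons_sub (rcons v false) true).2; rewrite lerDl ltW // len_gt0.
have nw' v u : act v -> w = v ++ u -> u = [::].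
  by case: u => // a u av e; case: nw; exists v, a, u.
rewrite (shift_inactive nw') (tau_inactive nw') addr0.
have ext v x : act v -> inJ v x -> inJ w x -> exists u, v = w ++ u.
  move=> av vx wx; have [[u e]|[u e]|[p [a [u [u' [e e']]]]]] := words_split v w.
  - by exists [::]; rewrite cats0 e (nw' _ _ av e) cats0.
  - by exists u.
  - by move: vx wx; rewrite e e' => vx /(inJ_diff vx).
split.
  have [[v [av vx]]|nx] := pselect (exists v, act v /\ inJ v (pos w)); last exact: pert_inactive.
  have [u e] := ext v _ av vx (inJ_left w).
  rewrite (pert_active 0 av vx) bump_left //.
  have := (cat_sub w u).1; rewrite -e => h; apply: le_trans h _.
  exact: le_trans (rcons_sub v false).1 (gstart_le _).1.
have [[v [av vx]]|nx] := pselect (exists v, act v /\ inJ v (pos w + len w)); last exact: pert_inactive.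
have [u e] := ext v _ av vx (inJ_right w).
rewrite (pert_active 0 av vx) bump_right //.
have := (cat_sub w u).2; rewrite -e => h; apply: le_trans h.
exact: le_trans (gstart_le (rcons v true)).2.2 (rcons_sub v true).2.
Qed.

Lemma branch_pos a w : branch a (pos w) = pos (a :: w).
Proof. by case: a; rewrite /branch ?pos_true // pos_false (pert_ends w).1. Qed.

Lemma branch_end a w : branch a (pos w + len w) = pos (a :: w) + len (a :: w).
Proof.
case: a; rewrite /branch /= ?pos_true ?pos_false ?(pert_ends w).2; first by rewrite addr0; ring.
by ring.
Qed.

Hypothesis csmall2 : 8 * A * c / (gap_bound * lam) <= 2^-1.

Lemma pert_half x y : `|pert 0 y - pert 0 x| <= 2^-1 * `|y - x|.
Proof. by apply: le_trans (pert_lip x y) _; rewrite ler_wpM2r. Qed.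

Lemma branch_incr a x y : x < y -> branch a x < branch a y.
Proof.
move=> xy; case: a; rewrite /branch; first by rewrite !ltrD2r ltr_pM2l.
rewrite ltr_pM2l //; have := pert_half x y.
by rewrite [`|y - x|]gtr0_norm ?subr_gt0 // ler_norml => /andP[h _]; lra.
Qed.

Lemma branch_le a x y : x <= y -> branch a x <= branch a y.
Proof. by rewrite le_eqVlt => /orP[/eqP -> //|/(branch_incr a)/ltW]. Qed.

Lemma branch_inj a : injective (branch a).
Proof.
move=> x y e; have [xy|yx|//] := ltgtP x y.
  by have := branch_incr a xy; rewrite e ltxx.
by have := branch_incr a yx; rewrite e ltxx.
Qed.

Lemma branch_lip a x y : `|branch a x - branch a y| <= 3 / 2 * lam * `|x - y|.
Proof.
rewrite [3 / 2 * lam]mulrC -mulrA; case: a; rewrite /branch.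
  rewrite (_ : _ - _ = lam * (x - y)); last by ring.
  rewrite normrM gtr0_norm // ler_wpM2l ?(ltW lam0) //; have := normr_ge0 (x - y); lra.
rewrite -mulrBr normrM gtr0_norm // ler_wpM2l ?(ltW lam0) //.
rewrite (_ : _ - _ = (x - y) + (pert 0 x - pert 0 y)); last by ring.
by apply: le_trans (ler_normD _ _) _; have := pert_half y x; lra.
Qed.

Lemma branch_continuous a : continuous (branch a).
Proof.
move=> x; apply/cvgrPdist_lt => e e0; apply/nbhs_ballP.
exists e => //= y; rewrite /ball /= => xy; apply: le_lt_trans (branch_lip _ _ _) _.
have l0 := lam0; have l2 := lam2; apply: le_lt_trans xy; rewrite ler_piMl //; lra.
Qed.

Definition J w : set R := `[pos w, pos w + len w]%classic.

Lemma JE w x : J w x <-> inJ w x.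
Proof. by rewrite /J /= in_itv /inJ. Qed.

Lemma branch_image a w : branch a @` J w = J (a :: w).
Proof.
rewrite predeqE => y; split.
  move=> [x /JE/andP[h1 h2] <-]; apply/JE; rewrite /inJ -branch_end -branch_pos.
  by rewrite !branch_le.
move=> /JE; rewrite /inJ -branch_end -branch_pos => yI.
have pl : pos w <= pos w + len w by rewrite lerDl ltW // len_gt0.
have bl := branch_le a pl.
have cb : {within `[pos w, pos w + len w], continuous (branch a)}.
  by apply: continuous_subspaceT => x; exact: branch_continuous.
have yI' : Num.min (branch a (pos w)) (branch a (pos w + len w)) <= y
    <= Num.max (branch a (pos w)) (branch a (pos w + len w)) by rewrite min_l // max_r.
by have [z zI <-] := IVT pl cb yI'; exists z.
Qed.

Lemma branch_class_C (k : R) a : m = Num.truncn k -> 0 <= k - m%:R <= alpha -> class_C k (branch a).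
Proof.
move=> mE km; have al0 : 0 < alpha by case/andP: alpha01.
pose e (j : nat) x : R := match j with 0 => x | 1 => 1 | _ => 0 end.
have eT j x y : e j y - e j x - (y - x) * e j.+1 x = 0.
  by case: j => [|[|j]] /=; ring.
have bb := bump_bound_ge0.
have K0 : 0 <= lam * (8 * A * bump_bound).
  by rewrite mulr_ge0 ?(ltW lam0) // mulr_ge0 // mulr_ge0.
case: a.
  apply: (@class_C_of_taylor _ _ alpha 1 _ (fun j x => lam * e j x + (if j == 0%N then 1 - lam else 0))) => //.
  - by rewrite -mE.
  - by move=> x _; rewrite /= addrA.
  - move=> j x y _; rewrite [X in `|X|](_ : _ = lam * (e j y - e j x - (y - x) * e j.+1 x)); last first.
      by case: j => [|j] /=; ring.
    by rewrite eT mulr0 normr0 mul1r powR_ge0.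
  - move=> x y; rewrite -mE.
    (* The top derivative of the affine part is constant because [0 < m]. *)
    case: m m1 => [|[|n]] //= _.
      by rewrite subrr normr0 mul1r powR_ge0.
    by rewrite subrr normr0 mul1r powR_ge0.
apply: (@class_C_of_taylor _ _ alpha (lam * (8 * A * bump_bound)) _ (fun j x => lam * (e j x + pert j x))) => //.
- by rewrite -mE.
- move=> j x y; rewrite -mE => jm.
  rewrite [X in `|X|](_ : _ = lam * ((e j y - e j x - (y - x) * e j.+1 x) +
     (pert j y - pert j x - (y - x) * pert j.+1 x))); last by ring.
  rewrite eT add0r normrM gtr0_norm // -mulrA ler_wpM2l ?(ltW lam0) //.
  exact: pert_taylor.
- move=> x y; rewrite -mE -mulrBr normrM gtr0_norm // -mulrA ler_wpM2l ?(ltW lam0) //.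
  have -> : e m y + pert m y - (e m x + pert m x) = pert m y - pert m x.
    by case: m m1 => [|[|n]] //= _; ring.
  exact: pert_holder.
Qed.


(** * The Cantor set *)

(** No compatibility is asked between the words of different lengths: intervals of equal depth are
    disjoint, which forces it. *)
Definition cantor : set R := [set x | forall n, exists2 w, size w = n & inJ w x].

Lemma pos_nil : pos [::] = 0.
Proof. by rewrite /pos big_ord0. Qed.

Lemma pos_pad w n : pos (w ++ nseq n false) = pos w.
Proof.
elim: n => [|n IH]; first by rewrite cats0.
have -> : nseq n.+1 false = rcons (nseq n false) false by elim: n {IH} => //= n <-.
by rewrite -rcons_cat pos_rcons IH addr0.
Qed.

Lemma end_pad w n : pos (w ++ nseq n true) + len (w ++ nseq n true) = pos w + len w.
Proof.
elim: n => [|n IH]; first by rewrite cats0.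
have -> : nseq n.+1 true = rcons (nseq n true) true by elim: n {IH} => //= n <-.
by rewrite -rcons_cat pos_rcons len_rcons -IH; ring.
Qed.

Lemma cantor_of_pad b w x : (forall n, inJ (w ++ nseq n b) x) -> cantor x.
Proof.
move=> h n; have [nw|wn] := leqP n (size w).
  exists (take n w); first by rewrite size_takel.
  by apply: (@inJ_cat _ (drop n w)); rewrite cat_take_drop; have := h 0%N; rewrite cats0.
exists (w ++ nseq (n - size w) b) => //.
by rewrite size_cat size_nseq subnKC // ltnW.
Qed.

Lemma cantor_left w : cantor (pos w).
Proof. by apply: (@cantor_of_pad false w) => n; rewrite -(pos_pad w n); exact: inJ_left. Qed.

Lemma cantor_right w : cantor (pos w + len w).
Proof. by apply: (@cantor_of_pad true w) => n; rewrite -(end_pad w n); exact: inJ_right. Qed.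

Lemma J_nil : J [::] = `[0, 1]%classic.
Proof. by rewrite /J pos_nil add0r. Qed.

Lemma J_cat w u : J (w ++ u) `<=` J w.
Proof. by move=> x /JE/inJ_cat/JE. Qed.

Lemma cantor_sub : cantor `<=` `[0, 1]%classic.
Proof. by move=> x /(_ 0%N)[w /size0nil ->]; rewrite -J_nil => /JE. Qed.

Lemma cantor_compact : compact cantor.
Proof.
apply: (subclosed_compact _ (@segment_compact R 0 1) cantor_sub).
have -> : cantor = \bigcap_(n in setT) \bigcup_(w in [set w : seq bool | size w = n]) J w.
  rewrite predeqE => x; split.
    by move=> h n _; have [w wn wx] := h n; exists w => //; exact/JE.
  by move=> h n; have [w wn /JE wx] := h n I; exists w.
apply: closed_bigI => n _; apply: closed_bigcup; last by move=> w _; exact: itv_closed.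
have -> : [set w : seq bool | size w = n] = (@tval n bool) @` [set: n.-tuple bool].
  rewrite predeqE => w; split => [/= wn|[t _ <-]]; last exact: size_tuple.
  have sz : size w == n by rewrite wn.
  by exists (Tuple sz).
by apply: finite_image; exact: finite_finset.
Qed.

Lemma branch_cantor a x : cantor x -> cantor (branch a x).
Proof.
move=> h; have im w : inJ w x -> inJ (a :: w) (branch a x).
  by move=> wx; apply: (JE _ _).1; rewrite -branch_image; exists x => //; exact: (JE _ _).2.
case=> [|n].
  by exists [::] => //; have [w _ /im/(@inJ_cat [::] (a :: w))] := h 0%N.
by have [w wn /im wx] := h n; exists (a :: w); rewrite //= wn.
Qed.

Lemma cantor_branch y : cantor y -> exists a x, cantor x /\ branch a x = y.
Proof.
move=> h; have [w w1 wy] := h 1%N.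
have {w1} [a wE] : exists a, w = [:: a] by case: w w1 {wy} => [|a []] // _; exists a.
have := (JE _ _).2 wy; rewrite wE -branch_image => -[x x0 xy]; exists a, x; split => // n.
have [[|b u] //= [un] uy] := h n.+1.
have ab : [:: b] = [:: a].
  apply: (@inJ_same_size _ _ y) => //; last by rewrite -wE.
  by apply: (@inJ_cat _ u).
case: ab uy => -> /(JE _ _).2; rewrite -branch_image => -[z /JE zu zy]; exists u => //.
by rewrite -(branch_inj (etrans zy (esym xy))).
Qed.

Lemma cantor_generates : generates branch cantor.
Proof.
split; [by exists (pos [::]); exact: cantor_left | exact: cantor_compact | exact: cantor_sub |].
rewrite predeqE => y; split.
  by move=> /cantor_branch[a [x [cx <-]]]; exists a => //; exists x.
by move=> [a _ [x cx <-]]; exact: branch_cantor.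
Qed.

Lemma branch_ifs : ifs branch.
Proof.
have unit a : branch a @` `[0, 1]%classic = J [:: a] by rewrite -J_nil branch_image.
split.
- by rewrite card_bool.
- by move=> a; rewrite unit -J_nil; exact: (@J_cat [::] [:: a]).
- by move=> a x y _ _; exact: branch_inj.
- exists (3 / 2 * lam); have l0 := lam0; have l2 := lam2; split; [lra | lra |].
  by move=> a x y _ _; exact: branch_lip.
- move=> a b ab; rewrite !unit -subset0 => x [/JE ax /JE bx].
  by have := @inJ_same_size [:: a] [:: b] x erefl ax bx => -[e]; rewrite e eqxx in ab.
Qed.

(** In [Jint] the last letter is the outermost map, while an address begins with its coarsest
    letter. Hence prepending a letter to a [Jint] word appends it to the address. *)
Lemma branch_Jint w : Jint branch w = J (rev w).
Proof.
elim/last_ind: w => [|w a IH]; first by rewrite /Jint /= J_nil.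
by rewrite /Jint foldl_rcons -/(Jint branch w) IH branch_image rev_rcons.
Qed.

Lemma branch_central : central branch.
Proof.
move=> w; exists (pos (rev w)), (pos (rev w) + len (rev w)), (child (rev w)).
have g := gap_gt0 (rev w); rewrite /gap in g.
split; [exact: child_gt0 | lra | exact: branch_Jint |].
left; rewrite !branch_Jint !rev_cons /J !pos_rcons !len_rcons addr0; split=> //.
by rewrite addrA subrK.
Qed.

(** * Separation of end points and box dimension *)

Lemma pos_separated v w n : size v = n.+1 -> size w = n.+1 -> v <> w ->
  gap_bound * lam ^+ n <= `|pos v - pos w|.
Proof.
clear csmall2 A0 alpha01 m1.
move=> vn wn vw; have [[u e]|[u e]|[p [a [u [u' [e e']]]]]] := words_split v w.
- case: vw; move/eqP: wn; rewrite e size_cat vn -[X in _ == X]addn0 eqn_add2l => /nilP ->.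
  by rewrite cats0.
- case: vw; move/eqP: vn; rewrite e size_cat wn -[X in _ == X]addn0 eqn_add2l => /nilP ->.
  by rewrite cats0.
have pn : (size p <= n)%N by move: vn; rewrite e size_cat /=; lia.
have : gap_bound * lam ^+ n <= gap p.
  apply: le_trans (gap_ge p); rewrite ler_wpM2l ?(ltW gap_bound_gt0) //.
  have l0 := lam0; have l2 := lam2.
  by apply: ler_wiXn2l => //; lra.
have := inJ_left v; have := inJ_left w; rewrite {1}e {1}e'; case: a {e e'} => /= hw hv.
  by have := inJ_gap hw hv => h1 h2; rewrite ger0_norm; have := gap_gt0 p; lra.
by have := inJ_gap hv hw => h1 h2; rewrite ler0_norm; have := gap_gt0 p; lra.
Qed.

Lemma scale_between (b e : R) : 0 < e -> e < b ->
  exists n, e < b * lam ^+ n /\ b * lam ^+ n.+1 <= e.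
Proof.
clear csmall2 A0 alpha01 m1.
move=> e0 eb; have l0 := lam0; have l2 := lam2; have l1 : lam < 1 by lra.
have b0 : 0 < b by apply: lt_trans eb.
have ex : exists n, b * lam ^+ n <= e.
  have := @cvg_geometric R b lam; rewrite ger0_norm ?(ltW lam0) // => /(_ l1).
  move=> /cvgr0Pnorm_lt /(_ e e0) [n _ hn]; exists n; have := hn n (leqnn n).
  by rewrite /= => /ltW; apply: le_trans; exact: ler_norm.
case: (ex_minnP ex) => -[|n] hn minn; first by move: hn; rewrite expr0 mulr1 leNgt eb.
exists n; split=> //; rewrite ltNge; apply/negP => /minn; by rewrite ltnn.
Qed.

Lemma cantor_cover_upper n : covered_by cantor (len_bound * lam ^+ n) (2 ^ n).
Proof.
have -> : (2 ^ n = #|{: n.-tuple bool}|)%N by rewrite card_tuple card_bool.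
exists (fun i => pos (enum_val i : n.-tuple bool)) => x /(_ n)[w wn wx].
have sz : size w == n by rewrite wn.
exists (enum_rank (Tuple sz)) => //=; rewrite in_itv /= enum_rankK /=.
move: wx => /andP[-> h] /=; apply: le_trans h _; rewrite lerD2l -wn; exact: len_le.
Qed.

(** The [2 ^ n.+1] left ends of depth [n.+1] belong to the set and are more than [e] apart, so each
    covering interval holds at most one. *)
Lemma cantor_cover_lower (e : R) n N : e < gap_bound * lam ^+ n -> covered_by cantor e N ->
  (2 ^ n.+1 <= N)%N.
Proof.
clear csmall2 A0 alpha01 m1.
move=> en [a cov].
have /choice[f hf] : forall t : n.+1.-tuple bool, exists i : 'I_N, a i <= pos t <= a i + e.
  by move=> t; have [i _] := cov _ (cantor_left t); rewrite /= in_itv /= => h; exists i.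
have finj : injective f.
  move=> t u tu; apply/val_inj/eqP/negPn/negP => /eqP neq.
  have := pos_separated (size_tuple t) (size_tuple u) neq.
  apply/negP; rewrite -ltNge; apply: le_lt_trans en; rewrite ler_norml.
  have := hf t; have := hf u; rewrite tu => /andP[? ?] /andP[? ?]; lra.
have := leq_card f finj; by rewrite card_tuple card_bool card_ord.
Qed.

(** As [2 ^ n] is [lam ^+ n] to the power [- D], and both covering estimates live at scale
    [lam ^+ n] up to constants, [ln (box_count cantor e) + D * ln e] is bounded by [K]; dividing by
    [ln e] removes it. *)
Lemma cantor_box_dim (D : R) : 0 < D -> lam `^ D = 2^-1 -> box_dim cantor D.
Proof.
clear csmall2 A0 alpha01 m1.
move=> D0 lamD; have l0 := lam0; have l2 := lam2; have gb := gap_bound_gt0.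
have lb1 := len_bound_ge1; have lb0 : 0 < len_bound by lra.
have lam_ln : D * ln lam = - ln 2 by rewrite -ln_powR lamD lnV ?posrE.
have pw n : ln (2 ^ n)%:R = - D * ln (lam ^+ n) :> R.
  rewrite natrX !lnXn // -[ln 2 *+ n]mulr_natr -[ln lam *+ n]mulr_natr.
  by rewrite mulNr mulrA lam_ln mulNr opprK.
pose K := `|D * ln (lam / len_bound)| + `|D * ln gap_bound|.
have K0 : 0 <= K by rewrite addr_ge0.
have main e : 0 < e -> e < 1 -> e < gap_bound -> `|ln (box_count cantor e) + D * ln e| <= K.
  move=> e0 e1 eg; have bc1 : 1 <= box_count cantor e.
    by apply: box_count_ge1 => //; [exists (pos [::]); exact: cantor_left | exact: cantor_sub].
  have bc0 : 0 < box_count cantor e by lra.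
  rewrite ler_norml; apply/andP; split.
    have [n [en ne]] := scale_between e0 eg.
    have le : (2 ^ n.+1)%:R <= box_count cantor e.
      apply: lb_le_inf => [|_ [N hN <-]]; last by rewrite ler_nat; exact: cantor_cover_lower en hN.
      by have [N hN] := covered_by_unit cantor_sub e0; exists N%:R, N.
    have p0 : 0 < (2 ^ n.+1)%:R :> R by rewrite ltr0n expn_gt0.
    have : ln ((2 ^ n.+1)%:R) <= ln (box_count cantor e) by rewrite ler_ln ?posrE.
    rewrite pw => h.
    have : ln (gap_bound * lam ^+ n.+1) <= ln e by rewrite ler_ln ?posrE // mulr_gt0 // exprn_gt0.
    rewrite lnM ?posrE ?exprn_gt0 // => h2.
    have h3 := ler_wpM2l (ltW D0) h2; rewrite mulrDr in h3.
    have := ler_norm (D * ln gap_bound); have := ler_norm (- (D * ln gap_bound)); rewrite normrN.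
    have := normr_ge0 (D * ln (lam / len_bound)); rewrite /K; lra.
  have elb : e < len_bound by lra.
  have [n [en ne]] := scale_between e0 elb.
  have le : box_count cantor e <= (2 ^ n.+1)%:R.
    apply: box_count_le; have [a cov] := cantor_cover_upper n.+1.
    exists a => x /cov[i _ h]; exists i => //; move: h; rewrite /= !in_itv /= => /andP[-> h] /=.
    by apply: le_trans h _; rewrite lerD2l.
  have p0 : 0 < (2 ^ n.+1)%:R :> R by rewrite ltr0n expn_gt0.
  have : ln (box_count cantor e) <= ln ((2 ^ n.+1)%:R) by rewrite ler_ln ?posrE.
  rewrite pw => h.
  have : ln (lam / len_bound * e) <= ln (lam ^+ n.+1).
    rewrite ler_ln ?posrE ?exprn_gt0 //; last by rewrite mulr_gt0 // divr_gt0.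
    rewrite exprS -mulrA ler_wpM2l ?(ltW lam0) // mulrC ler_pdivrMr // mulrC; exact: ltW.
  rewrite lnM ?posrE ?divr_gt0 // => h2.
  have h3 := ler_wpM2l (ltW D0) h2; rewrite mulrDr in h3.
  have := ler_norm (D * ln (lam / len_bound)); have := ler_norm (- (D * ln (lam / len_bound))); rewrite normrN.
  have := normr_ge0 (D * ln gap_bound); rewrite /K; lra.
apply/cvgrPdist_lt => eps eps0; apply/near_rightP.
exists (Num.min (Num.min 1 gap_bound) (expR (- (K + 1) / eps))).
  by rewrite !lt_min ltr01 gb expR_gt0.
move=> e e0; rewrite !lt_min => /andP[/andP[e1 eg] ee].
have lne : (K + 1) / eps < - ln e.
  have : ln e < ln (expR (- (K + 1) / eps)) by rewrite ltr_ln ?posrE ?expR_gt0.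
  by rewrite expRK mulNr; lra.
have K1 : 0 < (K + 1) / eps by rewrite divr_gt0 //; lra.
have lne0 : 0 < - ln e by lra.
rewrite (_ : _ - _ = - (ln (box_count cantor e) + D * ln e) / - ln e); last first.
  by field; rewrite -oppr_eq0 gt_eqF.
rewrite normrM normfV [`|- ln e|]gtr0_norm // ltr_pdivrMr // normrN.
apply: le_lt_trans (main e e0 e1 eg) _.
move: lne; rewrite ltr_pdivrMr // mulrC; lra.
Qed.


Lemma cantor_gap w x : cantor x -> x <= gstart w \/ gstart w + gap w <= x.
Proof.
clear csmall2 A0 alpha01 m1.
move=> /(_ (size w).+1)[u un ux].
have [[u' e]|[u' e]|[p [a [u1 [u2 [e e']]]]]] := words_split w u.
- case: u' e => [e|a [|b u'] e]; first by move/eqP: un; rewrite e cats0 eqn_leq ltnn andbF.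
    move: ux; rewrite e cats1 => /andP[h1 h2]; case: a h1 h2 {e} => h1 h2.
      by right; rewrite gstart_gap.
    by left; rewrite gstart_false.
  by move/eqP: un; rewrite e size_cat /=; lia.
- by move/eqP: un; rewrite e size_cat /=; lia.
have hl := inJ_left w; have hr := inJ_right w; have gp := gap_gt0 p.
have [b1 [b2 b3]] := gstart_le w.
rewrite [X in inJ X _]e in hl; rewrite [X in inJ X _]e in hr.
move: ux; rewrite e'; case: a hl hr {e e'} => /= hl hr ux.
  by left; have := inJ_gap ux hl; lra.
by right; rewrite gstart_gap; have := inJ_gap hr ux; lra.
Qed.


End Geometry.


(** * Programs determine their output *)

Lemma reads_inj (G : finType) (t : int -> cell G) y y' : reads t y -> reads t y' -> y = y'.
Proof.
have le z z' : reads t z -> reads t z' -> (size z' <= size z)%N.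
  move=> [_ zend] [z't _]; rewrite leqNgt; apply/negP => /z't; exact: zend.
move=> ry ry'; have sz : size y = size y'.
  by apply/eqP; rewrite eqn_leq !le.
apply: (@eq_from_nth _ false) => // i iy.
have := ry.1 i iy; have := ry'.1 i; rewrite -sz => /(_ iy) -> [] //.
Qed.

Lemma computes_inj (M : machine) x y y' : computes M x y -> computes M x y' -> y = y'.
Proof.
wlog suff main : y y' / forall t t' (c c' : config M), (t <= t')%N ->
    iter t (obind (@step M)) (Some (initial M x)) = Some c ->
    iter t' (obind (@step M)) (Some (initial M x)) = Some c' ->
    step c = None -> step c' = None -> c = c'.
  move=> [t [c [tc c0 rc]]] [t' [c' [tc' c'0 rc']]].
  have cc' : c = c'.
    case/orP: (leq_total t t') => tt'; first exact: main tt' tc tc' c0 c'0.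
    by apply/esym; exact: main tt' tc' tc c'0 c0.
  by move: rc'; rewrite -cc' => rc'; exact: reads_inj rc rc'.
move=> t t' c c' tt' tc; rewrite -(subnK tt') iterD tc => + c0 _.
case: (t' - t)%N => [|n]; first by case.
rewrite iterSr /= c0.
by have -> : iter n (obind (@step M)) None = None by elim: n => //= n ->.
Qed.

Lemma encode_word_inj s s' r r' :
  encode_word s ++ r = encode_word s' ++ r' -> s = s' /\ r = r'.
Proof.
rewrite /encode_word; elim: s s' => [|b s IH] [|b' s'] //=; first by case.
by move=> [<-] /IH[-> ->].
Qed.

Lemma encode_fraction_inj q q' r r' :
  encode_fraction q ++ r = encode_fraction q' ++ r' -> q = q' /\ r = r'.
Proof.
case: q q' => [n s d] [n' s' d'].
rewrite /encode_fraction !cat_cons -(catA (encode_word s)) -(catA (encode_word s')) => -[->].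
by move=> /encode_word_inj[-> /encode_word_inj[-> ->]].
Qed.

Lemma encode_list_inj : injective encode_list.
Proof.
elim=> [|q l IH] [|q' l'] // e.
have {e} : encode_fraction q ++ encode_list l = encode_fraction q' ++ encode_list l'.
  have cons p k : encode_list (p :: k) = true :: (encode_fraction p ++ encode_list k).
    by rewrite /encode_list /= -!catA.
  by move: e; rewrite !cons => /(congr1 behead).
by move=> /encode_fraction_inj[-> /IH ->].
Qed.

Lemma produces_inj (R : realType) (U : machine) P (F F' : set R) :
  produces U P F -> produces U P F' -> F = F'.
Proof.
move=> [l [cl _ ->]] [l' [cl' _ ->]].
by have /encode_list_inj -> := computes_inj cl cl'.
Qed.


(** * Choosing the perturbation level by level *)

Section Comparison.
Variables (R : realType) (lam mu c : R) (a1 a2 : pred (seq bool)).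
Implicit Types (v w u : seq bool).

Lemma tau_agree w : (forall u, (size u < size w)%N -> a1 u = a2 u) ->
  tau mu c a1 w = tau mu c a2 w.
Proof.
case/lastP: w => // w b h; rewrite !tau_rcons h //.
by rewrite size_rcons.
Qed.

Lemma len_agree w : (forall u, (size u < (size w).-1)%N -> a1 u = a2 u) ->
  len lam mu c a1 w = len lam mu c a2 w.
Proof.
elim: w => //= b w IH h; rewrite IH; last first.
  by move=> u uw; apply: h; apply: leq_trans uw _; exact: leq_pred.
by case: b => //; rewrite tau_agree.
Qed.

Lemma pos_agree w : (forall u, (size u < (size w).-1)%N -> a1 u = a2 u) ->
  pos lam mu c a1 w = pos lam mu c a2 w.
Proof.
elim/last_ind: w => [_|w b IH h]; first by rewrite /pos !big_ord0.
have h' u : (size u < size w)%N -> a1 u = a2 u.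
  by move=> uw; apply: h; rewrite size_rcons.
rewrite !pos_rcons IH; last by move=> u uw; apply: h'; apply: leq_trans uw (leq_pred _).
rewrite /child !(@len_agree w) ?(@len_agree (rcons w true)) //.
- by move=> u; rewrite size_rcons; exact: h'.
- by move=> u uw; apply: h'; apply: leq_trans uw (leq_pred _).
Qed.

Lemma shift_agree w : (forall u, (size u < size w)%N -> a1 u = a2 u) ->
  shift mu c a1 w = shift mu c a2 w.
Proof.
elim/last_ind: w => [_|w b IH h]; first by rewrite /shift !big_ord0.
have h' u : (size u < size w)%N -> a1 u = a2 u.
  by move=> uw; apply: h; rewrite size_rcons ltnW.
rewrite !shift_rcons IH // (@tau_agree w) // !tau_rcons h //.
by rewrite size_rcons.
Qed.

(** The right end of the left child of [false :: v] displays the bit of [v]: everything coarser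
    agrees, and the bit moves this end by the scaled amplitude. *)
Lemma gstart_differ v : (forall u, (size u < size v)%N -> a1 u = a2 u) ->
  ~~ a1 v -> a2 v ->
  gstart lam mu c a2 (false :: v) = gstart lam mu c a1 (false :: v) + lam * amp mu c v.
Proof.
move=> h n1 y2; rewrite !gstart_false !pos_rcons !addr0 !pos_false /=.
have h' u : (size u < (size v).-1)%N -> a1 u = a2 u.
  by move=> uv; apply: h; apply: leq_trans uv (leq_pred _).
rewrite pos_agree // shift_agree // (@len_agree (rcons v false)); last first.
  by move=> u; rewrite size_rcons; exact: h.
by rewrite !tau_rcons (negbTE n1) y2; ring.
Qed.

Hypotheses (lam0 : 0 < lam) (lam2 : 2 * lam < 1) (mu0 : 0 < mu) (mulam : mu < lam) (c0 : 0 <= c)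
  (csmall : 4 * lam * c <= (1 - 2 * lam) * (lam - mu)).

Lemma two_amp_le_gap v w (a : pred (seq bool)) : size w = (size v).+1 ->
  2 * (lam * amp mu c v) <= gap lam mu c a w.
Proof.
move=> wv; apply: le_trans (gap_ge a lam0 mu0 mulam c0 csmall w); rewrite wv exprS.
have c2 : 2 * c <= gap_bound lam.
  rewrite /gap_bound -(ler_pM2r lam0); have l0 := lam0; have m0 := mu0; have l2 := lam2.
  have : (1 - 2 * lam) * (lam - mu) <= (1 - 2 * lam) * lam by rewrite ler_wpM2l //; lra.
  by have := csmall; lra.
have mul : mu ^+ size v <= lam ^+ size v.
  by apply: lerXn2r; rewrite ?nnegrE ltW.
have l0 : 0 <= lam by exact: ltW.
rewrite /amp mulrCA [leRHS]mulrCA ler_wpM2l // mulrA; apply: ler_pM => //.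
  by rewrite mulr_ge0.
by rewrite exprn_ge0 // ltW.
Qed.

(** The displaced end belongs to the second set but falls into a gap of the first, at distance at
    least [lam * amp mu c v] from both sides of it. An approximation within half that distance of
    both sets would bring a point of the first set too near. *)
Lemma cantor_distinguish v (F : set R) : (forall u, (size u < size v)%N -> a1 u = a2 u) ->
  ~~ a1 v -> a2 v ->
  (hausdorff_dist F (cantor lam mu c a1) < (lam * amp mu c v / 2)%:E)%E ->
  (hausdorff_dist F (cantor lam mu c a2) < (lam * amp mu c v / 2)%:E)%E -> False.
Proof.
move=> h n1 y2 d1 d2; pose w := false :: v.
have right2 : cantor lam mu c a2 (gstart lam mu c a2 w).
  by rewrite gstart_false; exact: cantor_right.
have [y Fy zy] := (hausdorff_dist_lt d2).1 _ right2.
have [x Cx yx] := (hausdorff_dist_lt d1).2 _ Fy.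
have := @two_amp_le_gap v w a1 erefl.
have := cantor_gap lam0 lam2 mu0 mulam c0 csmall w Cx.
move: zy yx; rewrite (gstart_differ h n1 y2) -/w !ltr_norml => /andP[? ?] /andP[? ?].
by case; lra.
Qed.

End Comparison.

(** * The free bits of each level and the counting argument *)

Section Levels.
Variable K : nat.

Definition level (v : seq bool) : nat := index false v.

Definition level_word (p : nat) (u : seq bool) : seq bool := nseq p true ++ false :: u.

(* Level [p] uses the words [1^p 0 u] with [size u = K * p]: words of all levels
   are pairwise incomparable, and level [p] has [2 ^ (K * p)] of them. *)
Definition at_level (v : seq bool) : bool :=
  (level v < size v)%N && (size v == (level v).+1 + K * level v)%N.

Definition active (theta : pred (seq bool)) : pred (seq bool) := fun v => at_level v && theta v.

Lemma level_level_word p u : level (level_word p u) = p.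
Proof.
rewrite /level /level_word index_cat size_nseq mem_nseq andbF /= addn0 //.
Qed.

Lemma size_level_word p u : size (level_word p u) = (p.+1 + size u)%N.
Proof. by rewrite size_cat size_nseq /= addnS. Qed.

Lemma at_level_word p u : size u = (K * p)%N -> at_level (level_word p u).
Proof.
by move=> su; rewrite /at_level level_level_word size_level_word su eqxx andbT addSn ltnS leq_addr.
Qed.

Lemma active_antichain theta v u : active theta v -> active theta (v ++ u) -> u = [::].
Proof.
move=> /andP[/andP[lv /eqP sv] _] /andP[/andP[_ /eqP svu] _]; apply: size0nil.
have e : level (v ++ u) = level v by rewrite /level index_cat -index_mem lv.
by move: svu; rewrite e size_cat sv; lia.
Qed.

Lemma at_level_lt v q : at_level v -> (size v < q.+1 + K * q)%N -> (level v < q)%N.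
Proof.
move=> /andP[_ /eqP ->] lt; rewrite ltnNge; apply/negP => ql.
have := leq_mul (leqnn K) ql; lia.
Qed.

Variables (R : realType) (U : machine) (lam mu c : R).
Hypotheses (lam0 : 0 < lam) (lam2 : 2 * lam < 1) (mu0 : 0 < mu) (mulam : mu < lam) (c0 : 0 <= c)
  (csmall : 4 * lam * c <= (1 - 2 * lam) * (lam - mu)).

Definition level_eps (p : nat) : R := lam * (c * mu ^+ (p.+1 + K * p)) / 2.

Definition hard_at (p : nat) (theta : pred (seq bool)) : Prop :=
  forall P F, (size P < 2 ^ (K * p))%N -> produces U P F ->
    ~ (hausdorff_dist F (cantor lam mu c (active theta)) < (level_eps p)%:E)%E.

(** Words shorter than [M] become words of length exactly [M], the last [true] marking the end. The
    word without any [true] is missed, which is the one lacking program in the count. *)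
Definition pad (M : nat) (s : seq bool) : seq bool := s ++ true :: nseq (M - (size s).+1) false.

Lemma pad_inj M s s' : (size s < M)%N -> (size s' < M)%N -> pad M s = pad M s' -> s = s'.
Proof.
have aux t t' : (size t < size t')%N -> pad M t = pad M t' -> False.
  move=> tt' e; have := congr1 (fun z => nth false z (size t')) e.
  by rewrite /pad !nth_cat ltnn subnn ltnNge (ltnW tt') /= -(subnSK tt') /= nth_nseq if_same.
move=> _ _ e; have sz : size s = size s'.
  by case: (ltngtP (size s) (size s')) => // lt; [case: (aux _ _ lt e) | case: (aux _ _ lt (esym e))].
have := congr1 (take (size s)) e; rewrite /pad take_size_cat // take_size_cat //.
Qed.

(* Below length [M] there are only [2 ^ M - 1] programs, and each of them is
   close to the Cantor set for at most one choice of the bits of level [p]. *)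
Lemma level_choice p (theta0 : pred (seq bool)) : exists beta : pred (seq bool),
  forall theta : pred (seq bool),
    (forall v, at_level v -> (level v < p)%N -> theta v = theta0 v) ->
    (forall u, size u = (K * p)%N -> theta (level_word p u) = beta u) -> hard_at p theta.
Proof.
apply: contrapT => /forallNP no.
pose M := (2 ^ (K * p))%N; pose B := {ffun (K * p).-tuple bool -> bool}.
pose bits_of (b : B) : pred (seq bool) := fun u =>
  if insub u is Some t then b (t : (K * p).-tuple bool) else false.
have bits_ofE (b : B) (t : (K * p).-tuple bool) : bits_of b t = b t.
  by rewrite /bits_of valK.
(* If no choice of bits worked, each [b] would have a completion, a short program and an output of
   this program close to the Cantor set of the completion. *)
have /choice[f hf] : forall b : B, exists r : pred (seq bool) * seq bool * set R,
    [/\ forall v, at_level v -> (level v < p)%N -> r.1.1 v = theta0 v,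
        forall u, size u = (K * p)%N -> r.1.1 (level_word p u) = bits_of b u &
        [/\ (size r.1.2 < M)%N, produces U r.1.2 r.2 &
        (hausdorff_dist r.2 (cantor lam mu c (active r.1.1)) < (level_eps p)%:E)%E]].
  move=> b; have /existsNP[theta /not_implyP[h1 /not_implyP[h2]]] := no (bits_of b).
  move=> /existsNP[P /existsNP[F /not_implyP[h3 /not_implyP[h4 /contrapT h5]]]].
  by exists (theta, P, F).
pose prog (b : B) : seq bool := (f b).1.2.
have prog_lt b : (size (prog b) < M)%N by have [_ _ []] := hf b.
have prog_inj : injective prog.
  have aux b b' (t : (K * p).-tuple bool) : prog b = prog b' -> b t = false -> b' t = true -> False.
    move=> e bt b't; have [l1 w1 [_ p1 d1]] := hf b; have [l2 w2 [_ p2 d2]] := hf b'.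
    have FF : (f b).2 = (f b').2 by apply: produces_inj p1 _; rewrite -/(prog b) e.
    pose v := level_word p t.
    have lv := @at_level_word p t (size_tuple t).
    have sv : size v = (p.+1 + K * p)%N by rewrite size_level_word size_tuple.
    have eps : level_eps p = lam * amp mu c v / 2 by rewrite /level_eps /amp sv.
    apply: (@cantor_distinguish R lam mu c (active (f b).1.1) (active (f b').1.1)
      lam0 lam2 mu0 mulam c0 csmall v (f b).2); last 2 first.
    - by rewrite -eps.
    - by rewrite -eps FF.
    (* All words of level [p] have the same size, so a shorter word of the family has a lower level,
       where both completions follow [theta0]. *)
    - move=> u uv; rewrite /active; have [lu|//] := boolP (at_level u).
      have lt : (level u < p)%N by apply: at_level_lt => //; rewrite -sv.
      by rewrite /= l1 // l2.
    - by rewrite /active lv /= w1 ?size_tuple // bits_ofE bt.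
    - by rewrite /active lv /= w2 ?size_tuple // bits_ofE.
  move=> b b' e; apply/ffunP => t.
  case bt: (b t); case b't: (b' t) => //; first by case: (aux b' b t (esym e) b't bt).
  by case: (aux b b' t e bt b't).
have padM b : size (pad M (prog b)) == M.
  by rewrite size_cat /= size_nseq; have := prog_lt b; lia.
pose g (b : B) : M.-tuple bool := Tuple (padM b).
have ginj : injective g.
  by move=> b b' /(congr1 val) /= /(pad_inj (prog_lt b) (prog_lt b')) /prog_inj.
have gcard : #|B| = #|{: M.-tuple bool}|.
  by rewrite card_ffun card_tuple card_bool card_tuple card_bool.
(* Both finite sets have [2 ^ M] elements, so the injection is onto; but its image misses the word
   of [M] zeros. *)
have zero_size : size (nseq M false) == M by rewrite size_nseq.
have := inj_card_onto ginj; rewrite gcard leqnn => /(_ isT (Tuple zero_size)) /codomP[b].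
move=> /(congr1 (fun t => true \in val t)) /=.
by rewrite mem_nseq andbF /pad mem_cat in_cons eqxx orbT.
Qed.

(** [stage p] settles the levels below [p] and no later stage changes them, so [theta] can read each
    bit from the stage following its level. The guarantee of [level_choice] survives since it holds
    for all deeper bits. *)
Lemma hard_theta : exists theta : pred (seq bool), forall p, hard_at p theta.
Proof.
have /choice[choose hchoose] : forall pt : nat * pred (seq bool), exists beta : pred (seq bool),
  forall theta : pred (seq bool),
    (forall v, at_level v -> (level v < pt.1)%N -> theta v = pt.2 v) ->
    (forall u, size u = (K * pt.1)%N -> theta (level_word pt.1 u) = beta u) -> hard_at pt.1 theta.
  by move=> [p theta0]; exact: level_choice.
pose next p (theta : pred (seq bool)) : pred (seq bool) := fun v =>
  if level v == p then choose (p, theta) (drop p.+1 v) else theta v.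
pose stage p : pred (seq bool) := iteri p next pred0.
have stable p v : (level v < p)%N -> stage p v = stage (level v).+1 v.
  elim: p => // p IH; rewrite ltnS leq_eqVlt => /orP[/eqP -> //|lt].
  by rewrite -IH // /stage /= /next (ltn_eqF lt).
pose theta : pred (seq bool) := fun v => stage (level v).+1 v.
exists theta => p; apply: (hchoose (p, stage p)) => [v _ lt|u _] /=.
  by rewrite /theta [stage p v]stable.
rewrite /theta level_level_word /stage /= /next level_level_word eqxx.
by rewrite /level_word -cat_rcons drop_size_cat // size_rcons size_nseq.
Qed.

End Levels.


(** * The lower bound *)

Section LowerBound.
Variable R : realType.

Lemma powR_lt_base (x p : R) : 0 < x -> x < 1 -> 1 < p -> x `^ p < x.
Proof.
move=> x0 x1 p1; rewrite -mulr_powRB1 ?(ltW x0) //; last by lra.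
rewrite gtr_pMr // -[ltRHS](congr1 (fun f => f (p - 1)) (powR1 R)) gt0_ltr_powR ?nnegrE ?(ltW x0) //.
by lra.
Qed.

Lemma inverse_root_half (D : R) : 0 < D -> D < 1 ->
  exists lam : R, [/\ 0 < lam, 2 * lam < 1 & lam `^ D = 2^-1].
Proof.
move=> D0 D1; exists (2^-1 `^ D^-1); split.
- by rewrite powR_gt0.
- have : (2^-1 : R) `^ D^-1 < 2^-1 by apply: powR_lt_base; rewrite ?invf_gt1 //; lra.
  by lra.
- by rewrite -powRrM mulVf ?gt_eqF // powRr1.
Qed.

(** [x0] is kept positive even when [D / k - delta] is not. As [x0 < D / k], some [k'] lies strictly
    between [k] and [D / x0] without exceeding the next integer; then [x0 * k' < D], and any [K]
    above [x0 * k' / (D - x0 * k')] gives the last inequality. *)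
Lemma interpolate_smoothness (D delta k : R) : 0 < D -> 1 <= k -> 0 < delta ->
  exists x0 alpha : R, exists K : nat,
    [/\ 0 < x0, D / k - delta <= x0, 0 < alpha <= 1,
        k < (Num.truncn k)%:R + alpha &
        x0 * ((Num.truncn k)%:R + alpha) * K.+1%:R <= D * K%:R].
Proof.
move=> D0 k1 delta0; have k0 : 0 < k by lra.
have Dk : 0 < D / k by rewrite divr_gt0.
pose x0 := Num.max (D / k - delta) (D / k / 2); pose m := Num.truncn k.
have x00 : 0 < x0 by rewrite lt_max orbC divr_gt0.
have x0Dk : x0 < D / k by rewrite gt_max; apply/andP; split; lra.
have /andP[mk km] : m%:R <= k < m.+1%:R by apply: truncn_itv; exact: ltW.
have kDx : k < D / x0 by rewrite ltr_pdivlMr // mulrC -ltr_pdivlMr.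
pose k' := (k + Num.min m.+1%:R (D / x0)) / 2.
have [kk' k'm k'D] : [/\ k < k', k' <= m.+1%:R & k' < D / x0].
  by rewrite /k'; have [h|h] := leP (m.+1%:R : R) (D / x0); split; lra.
have x0k' : x0 * k' < D by rewrite mulrC -ltr_pdivlMr.
have k'E : m%:R + (k' - m%:R) = k' by ring.
pose z := x0 * k' / (D - x0 * k').
exists x0, (k' - m%:R), (Num.truncn z).+1; rewrite k'E; split => //.
- by rewrite le_max lexx.
- by move: k'm; rewrite -natr1 => k'm; apply/andP; split; lra.
- have dz : 0 < D - x0 * k' by lra.
  have := truncnS_gt z; set n := (Num.truncn z).+1; rewrite ltr_pdivrMr // => h.
  by rewrite -natr1; lra.
Qed.

Lemma distortion_ge (U : machine) (C : set R) (e : R) (n : nat) :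
  (forall P F, (size P < n)%N -> produces U P F -> ~ (hausdorff_dist F C < e%:E)%E) ->
  (n%:R%:E <= distortion_complexity U C e)%E.
Proof.
move=> h; apply: le_ereal_inf_tmp => _ [P [F UP FC] <-]; rewrite lee_fin ler_nat leqNgt.
by apply/negP => /h /(_ UP).
Qed.

Variables (U : machine) (lam mu c D alpha x0 : R) (m K : nat).
Hypotheses (D0 : 0 < D) (lam0 : 0 < lam) (lamD : lam `^ D = 2^-1)
  (muE : mu = lam `^ (m%:R + alpha)) (mu_lt : 2 * mu < 1) (c0 : 0 < c)
  (x00 : 0 < x0) (hK : x0 * (m%:R + alpha) * K.+1%:R <= D * K%:R).

Let mu0 : 0 < mu. Proof. by rewrite muE powR_gt0. Qed.

(** From one level to the next the scale shrinks by [mu ^+ K.+1] and the number of free bits grows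
    by [2 ^+ K]; [hK] says that the bits keep up with the exponent [x0]. *)
Lemma rate_powR : (mu ^+ K.+1) `^ (- x0) <= 2 ^+ K.
Proof.
have -> : (mu ^+ K.+1) `^ (- x0) = (lam `^ D) `^ (- (x0 * (m%:R + alpha) * K.+1%:R / D)).
  rewrite -(powR_mulrn K.+1 (ltW mu0)) muE -!powRrM; congr (_ `^ _).
  set y := m%:R + alpha; set n : R := K.+1%:R.
  have -> : D * - (x0 * y * n / D) = - (x0 * y * n) * (D / D) by ring.
  by rewrite divff ?gt_eqF //; ring.
rewrite lamD -powR_inv1 // -powRrM mulrN mulNr opprK mul1r -powR_mulrn //.
by rewrite ler_powR ?ler1n // ler_pdivrMr // [leRHS]mulrC.
Qed.

Lemma level_eps_geo p : level_eps K lam mu c p = lam * c * mu / 2 * (mu ^+ K.+1) ^+ p.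
Proof. by rewrite /level_eps -exprM mulSn addSn exprS !mulrA mulrAC; ring. Qed.

Lemma hard_preceq (s : R) theta : s <= x0 ->
  (forall p, hard_at K U lam mu c p theta) ->
  preceq (fun e => (e `^ (- s))%:E)
    (fun e => distortion_complexity U (cantor lam mu c (active K theta)) e).
Proof.
move=> sx hard; pose b := lam * c * mu / 2; pose q := mu ^+ K.+1.
have b0 : 0 < b by rewrite divr_gt0 // !mulr_gt0.
have q0 : 0 < q by rewrite exprn_gt0.
have q2 : 2 * q < 1.
  apply: le_lt_trans mu_lt; rewrite ler_pM2l // /q exprS ler_piMr ?(ltW mu0) //.
  by rewrite exprn_ile1 ?(ltW mu0) //; have := mu_lt; have := mu0; lra.
exists (b `^ (- x0) * 2 ^+ K); first by rewrite mulr_gt0 ?powR_gt0 ?exprn_gt0.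
apply/near_rightP; exists (Num.min 1 b); first by rewrite lt_min ltr01.
move=> e e0; rewrite lt_min => /andP[e1 eb].
(* The scale [e] lies between those of the levels [p] and [p.+1]; bits are counted at level [p],
   which loses the factor [2 ^+ K]. *)
have [p [ep pe]] := scale_between q0 q2 e0 eb.
have low : ((2 ^ (K * p))%:R%:E <= distortion_complexity U (cantor lam mu c (active K theta)) e)%E.
  apply: distortion_ge => P F sP UP d; apply: (hard p P F sP UP).
  by apply: lt_trans d _; rewrite lte_fin level_eps_geo.
have pre : e `^ (- s) <= b `^ (- x0) * 2 ^+ K * (2 ^ (K * p))%:R.
  apply: (@le_trans _ _ (e `^ (- x0))).
    by apply: ger_powR; rewrite ?lerN2 // e0 ltW.
  apply: (@le_trans _ _ ((b * q ^+ p.+1) `^ (- x0))).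
    rewrite !powRN lef_pV2 ?posrE ?powR_gt0 ?mulr_gt0 ?exprn_gt0 //.
    by rewrite ge0_ler_powR // ?nnegrE ?ltW // mulr_gt0 ?exprn_gt0.
  have qp0 : 0 <= q ^+ p.+1 by rewrite exprn_ge0 // ltW.
  rewrite (powRM (- x0) (ltW b0) qp0) -[leRHS]mulrA ler_pM2l ?powR_gt0 //.
  rewrite natrX exprM -exprS -(powR_mulrn p.+1 (ltW q0)) powRAC powR_mulrn ?powR_ge0 //.
  by rewrite lerXn2r ?nnegrE ?powR_ge0 ?exprn_ge0 //; exact: rate_powR.
apply: (@le_trans _ _ ((b `^ (- x0) * 2 ^+ K)%:E * (2 ^ (K * p))%:R%:E)%E).
  by rewrite -EFinM lee_fin.
by apply: lee_pmul => //; rewrite lee_fin // mulr_ge0 ?powR_ge0 ?exprn_ge0.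
Qed.

End LowerBound.

Lemma distortion_lower_bound (R : realType) (U : machine) (k : R) (hk : 1 <= k) (D delta : R) :
  0 < D -> D < 1 -> 0 < delta ->
  exists C : set R, [/\ Ck_central_cantor k C, box_dim C D &
    preceq (fun e => (e `^ (- (D / k) + delta))%:E) (fun e => distortion_complexity U C e)].
Proof.
move=> D0 D1 delta0.
have [lam [lam0 lam2 lamD]] := inverse_root_half D0 D1.
have [x0 [alpha [K [x00 x0D alpha01 kalpha hK]]]] := interpolate_smoothness D0 hk delta0.
pose m := Num.truncn k.
have m1 : (0 < m)%N by rewrite truncn_gt0.
have mk : m%:R <= k by rewrite truncn_le; lra.
pose mu := lam `^ (m%:R + alpha).
have mu0 : 0 < mu by rewrite powR_gt0.
have mulam : mu < lam.
  by apply: powR_lt_base => //; rewrite -/m in kalpha; lra.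
have [Psi [A [[A0 [Psi_left Psi_right]] Psi_flat Psi_taylor Psi_holder Psi_lip]]] :=
  smooth_step m alpha01.
have g0 := gap_bound_gt0 lam2.
(* The first bound preserves the gaps ([csmall]), the second makes the perturbation half-Lipschitz
   ([csmall2]); [A + 1] avoids a zero denominator. *)
pose c := Num.min ((1 - 2 * lam) * (lam - mu) / (4 * lam)) (gap_bound lam * lam / (16 * (A + 1))).
have c_gt0 : 0 < c.
  by rewrite lt_min; apply/andP; split; rewrite divr_gt0 ?mulr_gt0 //; lra.
have c0 := ltW c_gt0.
have csmall : 4 * lam * c <= (1 - 2 * lam) * (lam - mu).
  by rewrite mulrC -ler_pdivlMr ?mulr_gt0 // ge_min lexx.
have csmall2 : 8 * A * c / (gap_bound lam * lam) <= 2^-1.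
  have g1 : 0 < gap_bound lam * lam by rewrite mulr_gt0.
  have : c <= gap_bound lam * lam / (16 * (A + 1)) by rewrite ge_min lexx orbT.
  rewrite ler_pdivlMr; last by lra.
  by rewrite ler_pdivrMr //; lra.
have [theta hard] := hard_theta K U lam0 lam2 mu0 mulam c0 csmall.
exists (cantor lam mu c (active K theta)); split.
- have anti := @active_antichain K theta.
  exists (branch lam mu c (active K theta) Psi); split.
  + exact: (branch_ifs lam0 lam2 mu0 mulam c0 csmall anti A0 Psi_left Psi_right Psi_flat Psi_lip csmall2).
  + move=> a; apply: (branch_class_C lam0 lam2 mu0 mulam c0 csmall anti m1 alpha01 erefl A0
      Psi_left Psi_right Psi_flat Psi_taylor Psi_holder) => //.
    by apply/andP; split; lra.
  + exact: (cantor_generates lam0 lam2 mu0 mulam c0 csmall anti A0 Psi_left Psi_right Psi_flat Psi_lip csmall2).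
  + exact: (branch_central lam0 lam2 mu0 mulam c0 csmall anti A0 Psi_left Psi_right Psi_flat Psi_lip csmall2).
- exact: (cantor_box_dim _ lam0 lam2 mu0 mulam c0 csmall D0 lamD).
- have -> : - (D / k) + delta = - (D / k - delta) by ring.
  apply: (hard_preceq D0 lam0 lamD (erefl mu) _ c_gt0 x00 hK x0D hard).
  by have := mulam; lra.
Qed.

Theorem theorem2p4 (R : realType) (U : machine) (hU : universal U)
    (k : R) (hk : 1 <= k) :
  (forall (delta : R) (C : set R) (D : R),
      0 < delta -> Ck_cantor k C -> box_dim C D ->
      preceq (fun e => distortion_complexity U C e)
             (fun e => (e `^ (- (D / k) - delta))%:E))
  /\
  (forall D delta : R, 0 < D -> D < 1 -> 0 < delta ->
      exists C : set R,
        [/\ Ck_central_cantor k C,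
            exists2 D' : R, box_dim C D' & D' <= D + delta
          & preceq (fun e => (e `^ (- (D / k) + delta))%:E)
                   (fun e => distortion_complexity U C e)]).
Proof.
split=> [delta C D|D delta D0 D1 delta0]; first exact: distortion_upper_bound.
have [C [CC CD Ce]] := distortion_lower_bound U hk D0 D1 delta0.
by exists C; split => //; exists D => //; lra.
Qed.
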